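(* Let $\gamma$ be a simple closed, smooth curve in the hyperbolic plane $\mathbf{H}^2$ (constant curvature $-1$) with length $P$, enclosed area $A$, and geodesic curvature $k(x)$ satisfying $k_{\min}=\min_x k(x)>1$ (convexity with respect to horocycles). For the billiard inside $\gamma$, let $\delta$ be the proportion of the phase space not occupied by $m$-orbits. Then $$\delta \geq \frac{\pi}{2\,\mathrm{arctanh}(\frac{1}{k_{\min}})}\cdot \frac{P^2-A^2-4\pi A}{P\left(2\pi+\sqrt{(2\pi+A)^2-P^2}\right)}.$$
   Context: Billiard setup on the surface: $x$ is an arclength parameter on $\gamma$ ($x\in\mathbf{R}/P\mathbf{Z}$); the billiard trajectories inside $\gamma$ are geodesic segments of the surface. The phase space is $\Omega=\{(x,\varphi): x\in\mathbf{R}/P\mathbf{Z},\ \varphi\in(0,\pi)\}$, $\varphi$ the angle between the tangent to $\gamma$ at $\gamma(x)$ and a geodesic chord leaving $\gamma(x)$ into the region bounded by $\gamma$. The billiard map $T(x,\varphi)=(y,\psi)$ sends it to the next hit point and reflected angle (angle of reflection equals angle of incidence). $T$ preserves $d\mu=\sin\varphi\,dx\,d\varphi$ and $\mu(\Omega)=2P$. Let $L(x,y)$ be the (geodesic) distance between $\gamma(x)$ and $\gamma(y)$. A billiard configuration $\{x_n\}_{n\in\mathbf{Z}}$ (consecutive bounce points of a trajectory) is an $m$-configuration if for all $M<N$ the second variation of $\sum_{n=M}^{N-1}L(x_n,x_{n+1})$ with respect to $x_{M+1},\dots,x_{N-1}$ (endpoints fixed) is negative definite; the corresponding orbits of $T$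 are $m$-orbits. $\mathcal{M}\subseteq\Omega$ is the set of points on $m$-orbits, $\Delta=\Omega\setminus\mathcal{M}$, $\delta=\mu(\Delta)/\mu(\Omega)$. *)

(* Defs.v *)
(* Billiards in the hyperbolic plane, modelled as the
   upper sheet of the hyperboloid { p in R^{2,1} | <p,p> = -1, p_3 > 0 }. *)
From HB Require Import structures.
From mathcomp Require Import all_boot all_order all_algebra.
From mathcomp Require Import all_classical all_reals all_analysis.
Set Implicit Arguments.
Unset Strict Implicit.
Unset Printing Implicit Defensive.
Import Order.TTheory GRing.Theory Num.Theory.
Import numFieldNormedType.Exports.
Local Open Scope classical_set_scope.
Local Open Scope ring_scope.

Section Hyperbolic.
Variable R : realType.

Definition pt := (R * R * R)%type.

Definition mink (p q : pt) : R := p.1.1 * q.1.1 + p.1.2 * q.1.2 - p.2 * q.2.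

Definition onH2 (p : pt) : Prop := mink p p = -1 /\ 0 < p.2.

Definition ptadd (p q : pt) : pt := (p.1.1 + q.1.1, p.1.2 + q.1.2, p.2 + q.2).
Definition ptscale (a : R) (p : pt) : pt := (a * p.1.1, a * p.1.2, a * p.2).

Definition arcosh (t : R) : R := ln (t + Num.sqrt (t ^+ 2 - 1)).
Definition artanh (t : R) : R := 2^-1 * ln ((1 + t) / (1 - t)).

(* hyperbolic distance: cosh d(p,q) = - <p,q> *)
Definition hdist (p q : pt) : R := arcosh (- mink p q).

(* unit initial tangent vector (at p) of the geodesic segment from p to q:
   q = cosh d p + sinh d u *)
Definition gdir (p q : pt) : pt :=
  ptscale (Num.sqrt ((mink p q) ^+ 2 - 1))^-1 (ptadd q (ptscale (mink p q) p)).

Definition cderiv (g : R -> pt) (x : R) : pt :=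
  (derive1 (fun t => (g t).1.1) x, derive1 (fun t => (g t).1.2) x, derive1 (fun t => (g t).2) x).

Definition smooth (f : R -> R) : Prop :=
  forall (n : nat) (x : R), derivable (derive1n n f) x 1.

Definition smooth_curve (g : R -> pt) : Prop :=
  smooth (fun t => (g t).1.1) /\ smooth (fun t => (g t).1.2) /\ smooth (fun t => (g t).2).

Definition arclength_closed_curve (gam : R -> pt) (P : R) : Prop :=
  [/\ 0 < P /\ smooth_curve gam,
      (forall x, onH2 (gam x)),
      (forall x, gam (x + P) = gam x),
      (forall x y, (0 <= x < P) -> (0 <= y < P) -> gam x = gam y -> x = y)
    & (forall x, mink (cderiv gam x) (cderiv gam x) = 1)].

(* geodesic curvature: the covariant acceleration of a unit speed curve on the
   hyperboloid is gam'' - gam; k is its (Riemannian) length. *)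
Definition gcurv (gam : R -> pt) (x : R) : R :=
  let a := ptadd (cderiv (cderiv gam) x) (ptscale (-1) (gam x)) in
  Num.sqrt (mink a a).

Definition Lgen (gam : R -> pt) (x y : R) : R := hdist (gam x) (gam y).

Definition cosang (gam : R -> pt) (x y : R) : R :=
  mink (cderiv gam x) (gdir (gam x) (gam y)).

(* billiard configuration: consecutive bounce points (lifted to R) of a
   billiard trajectory: consecutive points distinct and angle of reflection
   equals angle of incidence at each bounce. *)
Definition billiard_config (gam : R -> pt) (xs : int -> R) : Prop :=
  (forall n : int, gam (xs n) <> gam (xs (n + 1)))
  /\ (forall n : int, cosang gam (xs n) (xs (n + 1)) = - cosang gam (xs n) (xs (n - 1))).

Definition action (gam : R -> pt) (ys : int -> R) (M : int) (k : nat) : R :=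
  \sum_(i < k) Lgen gam (ys (M + i%:Z)) (ys (M + i%:Z + 1)).

(* m-configuration: for all M < N = M + k, the second variation of the action
   with respect to x_{M+1},...,x_{N-1} (endpoints fixed) is negative definite *)
Definition m_config (gam : R -> pt) (xs : int -> R) : Prop :=
  forall (M : int) (k : nat) (xi : int -> R),
    (forall n : int, n <= M -> xi n = 0) ->
    (forall n : int, M + k%:Z <= n -> xi n = 0) ->
    (exists n : int, xi n <> 0) ->
    derive1n 2 (fun t : R => action gam (fun n => xs n + t * xi n) M k) 0 < 0.

Definition phase_space (P : R) : set (R * R) :=
  [set z | 0 <= z.1 < P /\ 0 < z.2 < pi].

Definition m_set (gam : R -> pt) (P : R) : set (R * R) :=
  [set z | phase_space P z /\
     exists xs : int -> R, [/\ billiard_config gam xs, m_config gam xs,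
        xs 0 = z.1 & cos z.2 = cosang gam (xs 0) (xs 1)]].

Definition bmu (S : set (R * R)) : \bar R :=
  (\int[(@lebesgue_measure R \x @lebesgue_measure R)%E]_(z in S) (sin z.2)%:E)%E.

Definition delta (gam : R -> pt) (P : R) : R :=
  fine (bmu (phase_space P `\` m_set gam P)) / fine (bmu (phase_space P)).

(* enclosed area: the projection (p1,p2) is a global chart of H^2, in which
   the hyperbolic area element is dp1 dp2 / sqrt(1 + p1^2 + p2^2).  The
   enclosed region is the bounded connected component of the complement of
   the projected curve. *)
Definition curve_image2 (gam : R -> pt) : set (R * R) :=
  [set z | exists x, z = ((gam x).1.1, (gam x).1.2)].

Definition bounded2 (S : set (R * R)) : Prop :=
  exists B : R, forall z, S z -> `|z.1| <= B /\ `|z.2| <= B.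

Definition enclosed_region (gam : R -> pt) : set (R * R) :=
  [set z | ~ curve_image2 gam z /\
           bounded2 (connected_component (~` curve_image2 gam) z)].

Definition harea (S : set (R * R)) : \bar R :=
  (\int[(@lebesgue_measure R \x @lebesgue_measure R)%E]_(z in S)
     ((Num.sqrt (1 + z.1 ^+ 2 + z.2 ^+ 2))^-1)%:E)%E.

End Hyperbolic.

(* Main.v *)
(** By Gauss-Bonnet, A >= A' := int k - 2 pi, and the bound decreases in A.

    An m-orbit carries a discrete Jacobi field that vanishes at one bounce and is
    positive at all later ones. Its focal distances a_n ahead of and b_n
    behind the n-th bounce satisfy the mirror equation
    coth a_n + coth b_n = 2 k / sin phi_n and a_n + b_(n+1) = L_n, so convexity
    of coth bounds sum_(n < K) (2 artanh (sin phi_n / k) - L_n) along the orbit,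
    uniformly in K. Off the m-orbits the summand is at most
    2 artanh (1 / k_min). Integrating the orbit sums over the phase space,
    where T preserves the measure, and letting K tend to infinity gives
    int (2 artanh (sin phi / k) - L) <= 2 artanh (1 / k_min) mu (Delta).
    The first integral is 2 pi int (k - sqrt (k^2 - 1)), the second is
    2 pi A' (Santalo), and Jensen's inequality bounds
    int sqrt (k^2 - 1) by sqrt ((int k)^2 - P^2).

    Convexity with respect to horocycles enters through the support
    inequality <gamma y, n x> > cosh d(x, y) - 1, which makes the chord angle
    monotone in its end point and splits the curve into two graphs over the
    first coordinate. *)
Require Import Defs.
From HB Require Import structures.
From mathcomp Require Import all_boot all_order all_algebra.
From mathcomp Require Import all_classical all_reals all_analysis.
From mathcomp Require Import measurable_realfun zify ring lra.
Set Implicit Arguments.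
Unset Strict Implicit.
Unset Printing Implicit Defensive.
Import Order.TTheory GRing.Theory Num.Theory.
Import numFieldNormedType.Exports.
Local Open Scope classical_set_scope.
Local Open Scope ring_scope.

(** * Calculus on the real line *)

Section Calculus.
Variable R : realType.
Implicit Types (f g df dg : R -> R) (x a b : R).

(** With I = int k, the two integrals are 2 pi (I - int sqrt (k^2 - 1)) and 2 pi (I - 2 pi), so I
    cancels in their difference and only int sqrt (k^2 - 1) is left to bound, by S = sqrt ((2 pi +
    A)^2 - P^2). The numerator of the theorem is (2 pi - S) (2 pi + S), which explains its
    denominator.

    Both integrals rest on one elementary primitive. For a unit direction u at p, the logarithm of
    the third coordinate of the null vector p + u increases along a chord by exactly the length of
    the chord, and its integral against sin phi over a full turn is explicit; 2 artanh (sin phi / k)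
    is a difference of two logarithms of the same shape.

    The geometric obstacle is the turning number: the tangent of a closed locally convex curve may
    turn several times, and this has to be excluded by producing a self-intersection or a second
    strict minimum.

    Integrands are made nonnegative by constants that cancel at the end, so that Tonelli's theorem
    applies throughout. The complement of the m-set and the enclosed region are estimated on one
    side only, through measurable subsets. *)

Lemma der_cst (k : R) x : is_derive x 1 (fun=> k : R) 0.
Proof. exact: is_derive_cst. Qed.

Lemma der_id x : is_derive x 1 (fun y : R => y) 1.
Proof. exact: is_derive_id. Qed.

Lemma derD f g x a b : is_derive x 1 f a -> is_derive x 1 g b ->
  is_derive x 1 (fun y => f y + g y) (a + b).
Proof. exact: is_deriveD. Qed.

Lemma derN f x a : is_derive x 1 f a -> is_derive x 1 (fun y => - f y) (- a).
Proof. exact: is_deriveN. Qed.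

Lemma derM f g x a b : is_derive x 1 f a -> is_derive x 1 g b ->
  is_derive x 1 (fun y => f y * g y) (f x * b + g x * a).
Proof. by move=> fa gb; exact: (@is_deriveM R R f g x 1 a b). Qed.

Lemma derX f x a n : is_derive x 1 f a ->
  is_derive x 1 (fun y => f y ^+ n) (n%:R * f x ^+ n.-1 * a).
Proof.
move=> fa; have := @is_deriveX R R f n x 1 a fa.
by rewrite exprfctE.
Qed.

Lemma derV f x a : f x != 0 -> is_derive x 1 f a ->
  is_derive x 1 (fun y => (f y)^-1) (- a / f x ^+ 2).
Proof.
move=> fx fa; have [df Df] := fa.
apply: DeriveDef; first exact: derivableV.
by rewrite deriveV// Df /GRing.scale/=; field.
Qed.

Lemma der_comp f g x a b : is_derive (g x) 1 f a -> is_derive x 1 g b ->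
  is_derive x 1 (fun y => f (g y)) (a * b).
Proof. by move=> fa gb; exact: (@is_derive1_comp R f g x a b). Qed.

Lemma der_sin f x a : is_derive x 1 f a ->
  is_derive x 1 (fun y => sin (f y)) (cos (f x) * a).
Proof. exact: der_comp. Qed.

Lemma der_cos f x a : is_derive x 1 f a ->
  is_derive x 1 (fun y => cos (f y)) (- sin (f x) * a).
Proof. exact: der_comp. Qed.

Lemma der_atan f x a : is_derive x 1 f a ->
  is_derive x 1 (fun y => atan (f y)) ((1 + f x ^+ 2)^-1 * a).
Proof. exact: der_comp. Qed.

Lemma der_ln f x a : 0 < f x -> is_derive x 1 f a ->
  is_derive x 1 (fun y => ln (f y)) ((f x)^-1 * a).
Proof. by move=> fx; apply: der_comp; exact: is_derive1_ln. Qed.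

Lemma der_sqrt f x a : 0 < f x -> is_derive x 1 f a ->
  is_derive x 1 (fun y => Num.sqrt (f y)) ((2 * Num.sqrt (f x))^-1 * a).
Proof. by move=> fx; apply: der_comp; exact: is_derive1_sqrt. Qed.

Lemma der_eq f x a b : is_derive x 1 f a -> a = b -> is_derive x 1 f b.
Proof. by move=> + <-. Qed.

Lemma der_ext f g x a : (forall y, f y = g y) -> is_derive x 1 f a ->
  is_derive x 1 g a.
Proof. by move=> /funext ->. Qed.

Lemma der_near f g x a : (\forall y \near x, f y = g y) -> is_derive x 1 f a ->
  is_derive x 1 g a.
Proof. by move=> fg; apply: near_eq_is_derive => //; rewrite oner_eq0. Qed.

Lemma der_cont f x a : is_derive x 1 f a -> {for x, continuous f}.
Proof. by move=> [/derivable1_diffP/differentiable_continuous]. Qed.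

Lemma der_contT f df : (forall x, is_derive x 1 f (df x)) -> continuous f.
Proof. by move=> fd x; exact: der_cont (fd x). Qed.

Lemma der_uniq f x a b : is_derive x 1 f a -> is_derive x 1 f b -> a = b.
Proof. by move=> [_ <-] [_ <-]. Qed.

Lemma cont_within f (A : set R) : continuous f -> {within A, continuous f}.
Proof. exact: continuous_subspaceT. Qed.

Lemma contD (T : topologicalType) (u v : T -> R) (z : T) :
  continuous_at z u -> continuous_at z v -> continuous_at z (fun y => u y + v y).
Proof. by move=> fx gx; exact: cvgD. Qed.

Lemma contN (T : topologicalType) (u : T -> R) (z : T) :
  continuous_at z u -> continuous_at z (fun y => - u y).
Proof. by move=> fx; exact: cvgN. Qed.

Lemma contM (T : topologicalType) (u v : T -> R) (z : T) :
  continuous_at z u -> continuous_at z v -> continuous_at z (fun y => u y * v y).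
Proof. by move=> fx gx; exact: cvgM. Qed.

Lemma contV (T : topologicalType) (u : T -> R) (z : T) : u z != 0 ->
  continuous_at z u -> continuous_at z (fun y => (u y)^-1).
Proof. by move=> f0 fx; exact: cvgV. Qed.

Lemma cont_comp (T S : topologicalType) (u : T -> S) (f : S -> R) (z : T) :
  continuous_at z u -> continuous_at (u z) f ->
  continuous_at z (fun y => f (u y)).
Proof. by move=> gx fx; exact: (@continuous_comp _ _ _ u f). Qed.

Lemma cont_cst (T : topologicalType) (c : R) (z : T) :
  continuous_at z (fun=> c).
Proof. exact: cst_continuous. Qed.

Lemma cont_sin (T : topologicalType) (u : T -> R) (z : T) :
  continuous_at z u -> continuous_at z (fun y => sin (u y)).
Proof. by move=> uz; apply: cont_comp uz _; exact: continuous_sin. Qed.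

Lemma cont_cos (T : topologicalType) (u : T -> R) (z : T) :
  continuous_at z u -> continuous_at z (fun y => cos (u y)).
Proof. by move=> uz; apply: cont_comp uz _; exact: continuous_cos. Qed.

Lemma cont_sqrt (T : topologicalType) (u : T -> R) (z : T) :
  continuous_at z u -> continuous_at z (fun y => Num.sqrt (u y)).
Proof. by move=> uz; apply: cont_comp uz _; exact: sqrt_continuous. Qed.

Lemma cont_ln (T : topologicalType) (u : T -> R) (z : T) : 0 < u z ->
  continuous_at z u -> continuous_at z (fun y => ln (u y)).
Proof. by move=> u0 uz; apply: cont_comp uz _; exact: continuous_ln. Qed.

Lemma cont_fst (z : R * R) : continuous_at z (fun w : R * R => w.1).
Proof. exact: cvg_fst. Qed.

Lemma cont_snd (z : R * R) : continuous_at z (fun w : R * R => w.2).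
Proof. exact: cvg_snd. Qed.

Lemma MVT_der f df a b : a < b -> (forall x, is_derive x 1 f (df x)) ->
  exists2 c, a < c < b & f b - f a = df c * (b - a).
Proof.
move=> ab fd.
have [|c] := @MVT _ f df a b ab (fun x _ => fd x).
  exact/cont_within/der_contT.
by rewrite in_itv/=; exists c.
Qed.

Lemma der_lt f df a b : (forall x, is_derive x 1 f (df x)) ->
  (forall x, a < x < b -> 0 < df x) ->
  forall x y, a <= x -> x < y -> y <= b -> f x < f y.
Proof.
move=> fd f0 x y ax xy yb; rewrite -subr_gt0.
have [c /andP[xc cy] ->] := MVT_der xy fd.
by rewrite mulr_gt0 ?subr_gt0// f0// (le_lt_trans ax xc) (lt_le_trans cy yb).
Qed.

Lemma der_gt f df a b : (forall x, is_derive x 1 f (df x)) ->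
  (forall x, a < x < b -> df x < 0) ->
  forall x y, a <= x -> x < y -> y <= b -> f y < f x.
Proof.
move=> fd f0 x y ax xy yb; rewrite -ltrN2.
apply: (@der_lt (fun z => - f z) (fun z => - df z) a b) => //.
by move=> z zab; rewrite oppr_gt0 f0.
Qed.

Lemma der0_cst f : (forall x, is_derive x 1 f 0) -> forall x y, f x = f y.
Proof. by move=> fd x y; exact: is_derive_0_is_cst. Qed.

End Calculus.

Ltac derh := match goal with
  | H : _ |- is_derive _ _ _ _ => notypeclasses refine H
  | H : _ |- is_derive _ _ _ _ => notypeclasses refine (H _)
  end.
Ltac der1 :=
  first [ notypeclasses refine (der_cst _ _) | notypeclasses refine (der_id _)
        | derh
        | notypeclasses refine (derD _ _) | notypeclasses refine (derN _)
        | notypeclasses refine (derM _ _) | notypeclasses refine (derX _ _)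
        | notypeclasses refine (der_sin _) | notypeclasses refine (der_cos _)
        | notypeclasses refine (der_atan _) ].
Ltac der := repeat der1.
Ltac cont1 := match goal with
  | |- continuous_at _ (fun y => y) => exact: cvg_id
  | |- continuous_at _ (fun y => y.1) => exact: cont_fst
  | |- continuous_at _ fst => exact: cont_fst
  | |- continuous_at _ (fun y => y.2) => exact: cont_snd
  | |- continuous_at _ snd => exact: cont_snd
  | |- continuous_at _ (fun=> _) => exact: cont_cst
  | |- continuous_at _ (fun y => - @?u y) => refine (@contN _ _ u _ _)
  | |- continuous_at _ (fun y => @?u y + @?v y) => refine (@contD _ _ u v _ _ _)
  | |- continuous_at _ (fun y => @?u y * @?v y) => refine (@contM _ _ u v _ _ _)
  | |- continuous_at _ (fun y => @?u y ^+ 2) => refine (@contM _ _ u u _ _ _)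
  | |- continuous_at _ (fun y => (@?u y)^-1) => refine (@contV _ _ u _ _ _)
  | |- continuous_at _ (fun y => sin (@?u y)) => refine (@cont_sin _ _ u _ _)
  | |- continuous_at _ (fun y => cos (@?u y)) => refine (@cont_cos _ _ u _ _)
  | |- continuous_at _ (fun y => Num.sqrt (@?u y)) => refine (@cont_sqrt _ _ u _ _)
  | |- continuous_at _ (fun y => ln (@?u y)) => refine (@cont_ln _ _ u _ _ _)
  | H : continuous_at ?z ?f |- continuous_at ?z ?f => exact H
  | H : forall z, continuous_at z ?f |- continuous_at _ ?f => exact (H _)
  | H : forall z, continuous_at z ?f |- continuous_at _ (fun y => ?f (@?u y)) =>
      refine (@cont_comp _ _ _ u f _ _ (H _))
  end.
Ltac cont := intros; repeat cont1.
Ltac dereq := notypeclasses refine (der_eq _ _); [der|cbv beta].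

Section CalculusTheorems.
Variable R : realType.
Implicit Types (f g df dg : R -> R) (x a b : R).

Lemma der_eq_cst f g df : (forall x, is_derive x 1 f (df x)) ->
  (forall x, is_derive x 1 g (df x)) -> forall x y, f y - f x = g y - g x.
Proof.
move=> fd gd x y.
have h (z : R) : is_derive z 1 (fun z => f z - g z) 0.
  by dereq; ring.
have := der0_cst h x y; lra.
Qed.

Lemma IVT_cont f a b v : a <= b -> continuous f ->
  f a <= v <= f b -> exists2 c, a <= c <= b & f c = v.
Proof.
move=> ab fc /andP[av vb].
have [||c] := @IVT R f a b v ab; first exact: cont_within.
  by rewrite ge_min av/= le_max vb orbT.
by rewrite in_itv/=; exists c.
Qed.

(** The integral from [a] is a primitive only to the right of [a]. Normalised to vanish at 0 it does
    not depend on [a], as long as [a] lies to the left of 0 and of the argument, so the base point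
    can move with the argument. *)
Lemma primitive f : continuous f -> exists F, forall x, is_derive x 1 F (f x).
Proof.
move=> fc; pose G a x := (\int[lebesgue_measure]_(t in `[a, x]) f t)%R.
have dG a x : a < x -> is_derive x 1 (G a) (f x).
  move=> ax; have xu : x < x + 1 by lra.
  have [|||d1 d2] := @continuous_FTC1 R f (BLeft a) x (x + 1) xu.
  - apply: continuous_compact_integrable; first exact: segment_compact.
    exact: cont_within.
  - by rewrite ?ltBSide ?bnd_simp/= ?ltW//.
  - exact: fc.
  - by split; [exact: d1|rewrite -derive1E; exact: d2].
have cst a b p q : a < p -> b < p -> p < q -> G a p - G b p = G a q - G b q.
  move=> ap bp pq.
  have h z : p <= z -> is_derive z 1 (fun z => G a z - G b z) 0.
    move=> pz; rewrite -(subrr (f z)).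
    by apply: derD; [|apply: derN]; apply: dG; apply: lt_le_trans pz.
  have [z||c _] := @MVT _ (fun z => G a z - G b z) (fun=> 0) _ _ pq.
  - by rewrite in_itv/= => /andP[pz _]; apply/h/ltW.
  - by apply: derivable_within_continuous => z; rewrite in_itv/= => /andP[/h[]].
  - by rewrite mul0r => /eqP; rewrite subr_eq0 => /eqP.
have indep a b x : a < x -> b < x -> a < 0 -> b < 0 -> G a x - G a 0 = G b x - G b 0.
  move=> ax bx a0 b0; have [x0|x0|<-] := ltrgtP 0 x; last by rewrite !subrr.
    by have := cst _ _ _ _ a0 b0 x0; lra.
  by have := cst _ _ _ _ ax bx x0; lra.
exists (fun x => G (- (`|x| + 1)) x - G (- (`|x| + 1)) 0) => x.
have lt (y : R) : - (`|y| + 1) < y /\ - (`|y| + 1) < 0.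
  by have := ler_norm (- y); rewrite normrN; have := normr_ge0 y; lra.
have [l1 l2] := lt x.
apply: (@der_near _ (fun y => G (- (`|x| + 1)) y - G (- (`|x| + 1)) 0)).
  near=> y; have [l3 l4] := lt y; apply: indep => //.
  by near: y; exact: lt_nbhsr.
by apply: der_eq (derD (dG _ _ l1) (der_cst _ _)) _; rewrite addr0.
Unshelve. all: by end_near. Qed.

Lemma der_shift f a c x : is_derive (x + c) 1 f a ->
  is_derive x 1 (fun y => f (y + c)) a.
Proof.
move=> fa; have sh : is_derive x 1 (fun y => y + c) (1:R) by dereq; ring.
by apply: der_eq (@der_comp R f (fun y => y + c) x _ _ fa sh) _; rewrite mulr1.
Qed.

Lemma der_shiftl f a c x : is_derive (c + x) 1 f a ->
  is_derive x 1 (fun y => f (c + y)) a.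
Proof.
by rewrite addrC => /der_shift; apply: der_ext => y; rewrite addrC.
Qed.

Lemma der_per_shift f df T : (forall x, is_derive x 1 f (df x)) ->
  (forall x, df (x + T) = df x) -> forall x, f (x + T) - f x = f T - f 0.
Proof.
move=> fd dfT x.
have fT (y : R) : is_derive y 1 (fun y => f (y + T)) (df y) by rewrite -dfT; exact: der_shift.
by have := der_eq_cst fT fd 0 x; rewrite add0r; lra.
Qed.

End CalculusTheorems.

(** * Periodic functions, extrema and inverses of monotone arcs *)

Section RealTools.
Variable R : realType.
Implicit Types (f g df dg : R -> R) (x a b T : R).

Lemma sinD2p a : sin (a + 2 * pi) = sin a :> R.
Proof. by rewrite mulr_natl; exact: (@sinD2pi R). Qed.

Lemma cosD2p a : cos (a + 2 * pi) = cos a :> R.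
Proof. by rewrite mulr_natl; exact: (@cosD2pi R). Qed.

Lemma sin_lt0 a : pi < a < 2 * pi -> sin a < 0.
Proof.
move=> ap; have -> : sin a = - sin (a - pi) by rewrite -[in LHS](subrK pi a) sinDpi.
by rewrite oppr_lt0; apply: sin_gt0_pi; lra.
Qed.

Lemma per_red T x : 0 < T -> exists n : int, 0 <= x + n%:~R * T < T.
Proof.
move=> T0; exists (- Num.floor (x / T)).
have /andP[h1 h2] := floor_itv (x / T).
have e : x = x / T * T by rewrite divfK// gt_eqF.
rewrite mulrNz mulNr; apply/andP; split.
  by rewrite subr_ge0 {2}e ler_pM2r.
move: h2; rewrite intrD => h2.
by rewrite {1}e -mulrBl -[ltRHS]mul1r ltr_pM2r// ltrBlDl.
Qed.

Lemma per_int (V : Type) (f : R -> V) T : (forall x, f (x + T) = f x) ->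
  forall (n : int) x, f (x + n%:~R * T) = f x.
Proof.
move=> fT; have fn (n : nat) x : f (x + n%:R * T) = f x.
  elim: n x => [x|n IH x]; first by rewrite mul0r addr0.
  by rewrite -natr1 mulrDl mul1r addrA fT.
case=> n x; first exact: fn.
by rewrite NegzE mulrNz mulNr -[LHS](fn n.+1) subrK.
Qed.

Lemma per_max f T : 0 < T -> continuous f -> (forall x, f (x + T) = f x) ->
  exists2 c, 0 <= c < T & forall x, f x <= f c.
Proof.
move=> T0 fc fT.
have [c _ cm] := @EVT_max R f 0 T (ltW T0) (cont_within fc).
have [n cn] := per_red c T0.
exists (c + n%:~R * T) => // x; rewrite (per_int fT).
have [k /andP[k0 kT]] := per_red x T0.
by rewrite -(per_int fT k x); apply: cm; rewrite in_itv/= k0 ltW.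
Qed.

Lemma max_der0 f df c : (forall x, f x <= f c) ->
  (forall x, is_derive x 1 f (df x)) -> df c = 0.
Proof.
move=> fm fd; apply: (der_uniq (fd c)).
apply: (@derive1_at_max R f (c - 1) (c + 1)) => //; first lra.
by rewrite in_itv/=; lra.
Qed.

Lemma min_der0 f df c : (forall x, f c <= f x) ->
  (forall x, is_derive x 1 f (df x)) -> df c = 0.
Proof.
move=> fm fd; apply/eqP; rewrite -oppr_eq0; apply/eqP.
apply: (@max_der0 (fun x => - f x) (fun x => - df x)) => x.
by rewrite lerN2.
Qed.

(** Clamping the argument to [[f p, f q]] extends the inverse by constants to a continuous function
    on the line. The derivative is positive only in the open interval: in the applications it
    vanishes at the ends. *)
Lemma arc_inverse (f df : R -> R) (p q : R) : p < q ->
  (forall s : R, is_derive s 1 f (df s)) -> (forall s, p < s < q -> 0 < df s) ->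
  exists xi : R -> R, [/\ continuous xi,
    (forall s, p <= s <= q -> xi (f s) = s),
    (forall u, u <= f p -> xi u = p) /\ (forall u, f q <= u -> xi u = q),
    (forall u, f p <= u <= f q -> p <= xi u <= q /\ f (xi u) = u) &
    (forall u : R, f p < u < f q -> is_derive u 1 xi (df (xi u))^-1)].
Proof.
move=> pq dfd df0; have flt := der_lt dfd df0; have fc := der_contT dfd.
have fpq : f p < f q by exact: flt.
have fle x y : p <= x -> x <= y -> y <= q -> f x <= f y.
  by move=> px; rewrite le_eqVlt => /predU1P[->//|xy] yq; apply/ltW/flt.
pose cl u := Num.max (f p) (Num.min u (f q)).
have cl_itv u : f p <= cl u <= f q.
  by rewrite le_max lexx/= ge_max (ltW fpq) ge_min lexx orbT.
have cl_id u : f p <= u <= f q -> cl u = u.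
  by move=> /andP[h1 h2]; rewrite /cl (min_idPl h2) (max_idPr h1).
have cl_lip u v : cl v - cl u <= `|u - v|.
  have := ler_norm (u - v); have := ler_norm (v - u); rewrite (distrC v) => n1 n2.
  rewrite /cl /Num.max /Num.min; move: fpq n1 n2; clear => fpq n1 n2.
  by case: (ltP u (f q)); case: (ltP v (f q)) => ? ?; do ?[case: ltP => ?]; lra.
pose xi u := xget p [set s | p <= s <= q /\ f s = cl u].
have xiP u : p <= xi u <= q /\ f (xi u) = cl u.
  rewrite /xi; case: xgetP => [s -> //|none].
  have [|c cpq fe] := @IVT_cont R f p q (cl u) (ltW pq) fc; first exact: cl_itv.
  by case: (none c).
have finj x y : p <= x <= q -> p <= y <= q -> f x = f y -> x = y.
  move=> /andP[px xq] /andP[py yq] e; case: (ltgtP x y) => // h.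
    by have := flt _ _ px h yq; rewrite e ltxx.
  by have := flt _ _ py h xq; rewrite e ltxx.
have xiK s : p <= s <= q -> xi (f s) = s.
  move=> sb; have [h1 h2] := xiP (f s); apply: finj => //.
  by rewrite h2 cl_id//; move: sb => /andP[ps sq]; rewrite !fle.
have xip u : u <= f p -> xi u = p.
  move=> h; have [h1 h2] := xiP u; apply: finj => //; first by rewrite lexx ltW.
  by rewrite h2 /cl (min_idPl _) ?(max_idPl _)//; apply: le_trans h (ltW fpq).
have xiq u : f q <= u -> xi u = q.
  move=> h; have [h1 h2] := xiP u; apply: finj => //; first by rewrite lexx ltW.
  by rewrite h2 /cl (min_idPr h) (max_idPr (ltW fpq)).
have xir u : f p <= u <= f q -> p <= xi u <= q /\ f (xi u) = u.
  by move=> h; have [h1 h2] := xiP u; rewrite h2 cl_id.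
exists xi; split => //.
- move=> u; have [/andP[h1 h2] h3] := xiP u.
  apply/cvgrPdist_lt => e e0.
  (* The distance by which [f] moves when [xi u] moves by [e] to one side. If that move leaves
     [[p, q]], then [xi] cannot go so far and any positive value serves, here 1. *)
  pose dp := if xi u + e <= q then f (xi u + e) - f (xi u) else 1.
  pose dm := if p <= xi u - e then f (xi u) - f (xi u - e) else 1.
  have dp0 : 0 < dp.
    by rewrite /dp; case: ifP => // h; rewrite subr_gt0; apply: flt => //; lra.
  have dm0 : 0 < dm.
    by rewrite /dm; case: ifP => // h; rewrite subr_gt0; apply: flt => //; lra.
  have vpn : \forall v \near u, `|u - v| < dp by apply/nbhs_ballP; exists dp.
  have vmn : \forall v \near u, `|u - v| < dm by apply/nbhs_ballP; exists dm.
  near=> v.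
  have vp : `|u - v| < dp by near: v.
  have vm : `|u - v| < dm by near: v.
  have [/andP[k1 k2] k3] := xiP v.
  have := cl_lip v u; have := cl_lip u v; rewrite (distrC v) -h3 -k3 => L1 L2.
  rewrite ltr_norml; apply/andP; split; rewrite ltNge; apply/negP => h.
    have q1 : xi u + e <= q by lra.
    by have := fle (xi u + e) (xi v); rewrite /dp q1 in vp; lra.
  have q1 : p <= xi u - e by lra.
  by have := fle (xi v) (xi u - e) k1; rewrite /dm q1 in vm; lra.
- move=> u /andP[u1 u2]; have [|/andP[h1 h2] h3] := xir u; first by rewrite !ltW.
  have l1 : p < xi u by rewrite lt_neqAle h1 andbT; apply: contraTneq u1 => ->; rewrite h3 ltxx.
  have l2 : xi u < q by rewrite lt_neqAle h2 andbT; apply: contraTneq u2 => <-; rewrite h3 ltxx.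
  rewrite -[in is_derive u](h3); apply: is_derive_inverse.
  + near=> z; apply: xiK; apply/andP; split; apply: ltW; near: z.
      exact: lt_nbhsr.
    exact: lt_nbhsl.
  + near=> z; exact: fc.
  + by rewrite gt_eqF// df0// l1.
Unshelve. all: by end_near. Qed.

Lemma pos_near f x : continuous f -> 0 < f x ->
  exists2 e, 0 < e & forall y, `|y - x| < e -> 0 < f y.
Proof.
move=> fc fx.
have /nbhs_ballP[e /= e0 he] : \forall y \near x, 0 < f y.
  exact: (cvgr_gt _ (fc x) _ fx).
by exists e => // y yx; apply: he; rewrite /ball/= distrC.
Qed.

Lemma pos_lower_bound a b : 0 < a -> 0 < b -> exists m, [/\ 0 < m, m <= a & m <= b].
Proof. by exists (Num.min a b); rewrite lt_min !ge_min !lexx orbT; split => //; apply/andP. Qed.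

(** The zero is the last point [z] with [f z <= 0]: as [f] is positive from there up to [b], the
    derivative at [z] is not negative, and by nondegeneracy it is not zero. *)
Lemma crossing f df a b : (forall x, is_derive x 1 f (df x)) -> continuous df ->
  a < b -> f a < 0 -> 0 < f b ->
  (forall x, f x = 0 -> df x <> 0) ->
  exists2 z, a < z < b & f z = 0 /\ 0 < df z.
Proof.
move=> fd dfc ab fa fb nd; have fc := der_contT fd.
pose S := [set x | a <= x <= b /\ f x <= 0].
have Sa : S a by split; [rewrite lexx ltW|exact: ltW].
have hS : has_sup S.
  by split; [exists a|exists b => x [/andP[]]].
set z := sup S.
have az : a <= z by apply: ub_le_sup => //; case: hS.
have zb : z <= b by apply: ge_sup; [exists a|move=> x [/andP[]]].
have pz x : z < x -> x <= b -> 0 < f x.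
  move=> zx xb; rewrite ltNge; apply/negP => fx.
  have : x <= z by apply: ub_le_sup; [case: hS|split => //; rewrite xb (le_trans az) ?ltW].
  by rewrite leNgt zx.
have fz0 : f z <= 0.
  rewrite leNgt; apply/negP => /(pos_near fc)[e e0 he].
  have [y Sy yz] := sup_adherent e0 hS.
  have [yab fy] := Sy.
  have yz' : y <= z by apply: ub_le_sup => //; case: hS.
  suff : 0 < f y by rewrite ltNge fy.
  by apply: he; rewrite ler0_norm ?subr_le0// opprB; move: yz; rewrite -/z; lra.
have zb' : z < b by rewrite lt_neqAle zb andbT; apply/eqP => zb'; move: fz0; rewrite zb' leNgt fb.
have fz : f z = 0.
  have [|c /andP[zc cb] fc0] := IVT_cont zb fc (v := 0); first by rewrite fz0 ltW.
  suff -> : z = c by [].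
  apply/eqP; rewrite eq_le zc; apply: ub_le_sup; first by case: hS.
  by split; [rewrite cb (le_trans az)|rewrite fc0].
have az' : a < z by rewrite lt_neqAle az andbT; apply/eqP => az'; move: fa; rewrite az' fz ltxx.
exists z; first by rewrite az'.
split => //; rewrite ltNge; apply/negP => dz.
have {}dz : 0 < - df z by have := nd _ fz; lra.
have [|e e0 he] := @pos_near (fun x => - df x) z _ dz.
  by cont.
have [||m [m0 m1 m2]] := @pos_lower_bound (e / 2) (b - z); [lra|lra|].
have : f (z + m) < f z.
  apply: (der_gt fd (a := z) (b := z + m)) => // [x /andP[zx xm]|]; last by lra.
  by have := he x; rewrite gtr0_norm ?subr_gt0//; lra.
have := pz (z + m); lra.
Qed.

Lemma rotation_eq0 (x y c s : R) : c ^+ 2 + s ^+ 2 = 1 ->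
  x * s - y * c = 0 -> x * c + y * s = 0 -> x = 0 /\ y = 0.
Proof.
move=> cs h1 h2; split.
  transitivity (x * (c ^+ 2 + s ^+ 2)); first by rewrite cs mulr1.
  by transitivity (c * (x * c + y * s) + s * (x * s - y * c)); [ring|rewrite h1 h2; ring].
transitivity (y * (c ^+ 2 + s ^+ 2)); first by rewrite cs mulr1.
by transitivity (s * (x * c + y * s) - c * (x * s - y * c)); [ring|rewrite h1 h2; ring].
Qed.

End RealTools.

(** * Self-intersections of locally convex arcs *)

Section Loop.
Variable R : realType.

(** Cut at angle pi, the arc has a rising and a falling half, each a graph over the height [v];
    [F y] is their horizontal offset at height [y]. It is negative at the bottom, where the arc has
    advanced, and positive at some height because [u] decreases between the angles pi / 2 and 3 pi /
    2. *)
Lemma loop_crossing (u v r : R -> R) :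
  (forall s : R, is_derive s 1 u (r s * cos s)) ->
  (forall s : R, is_derive s 1 v (r s * sin s)) ->
  (forall s, 0 < r s) -> v (2 * pi) = v 0 -> u 0 < u (2 * pi) ->
  exists s1 s2, [/\ 0 <= s1, s1 < s2, s2 <= 2 * pi, u s1 = u s2 & v s1 = v s2].
Proof.
move=> du dv r0 v2 u2; have p0 : (0:R) < pi := pi_gt0 R.
have uc := der_contT du; have vc := der_contT dv.
have vi : forall x y, 0 <= x -> x < y -> y <= pi -> v x < v y.
  apply: der_lt dv _ => x /andP[x0 xp]; rewrite mulr_gt0//.
  by apply: sin_gt0_pi; rewrite x0.
have vd : forall x y, pi <= x -> x < y -> y <= 2 * pi -> v y < v x.
  apply: der_gt dv _ => x /andP[x0 xp]; rewrite pmulr_rlt0//.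
  by apply: sin_lt0; rewrite x0 xp.
have ud : forall x y, pi / 2 <= x -> x < y -> y <= 3 * pi / 2 -> u y < u x.
  apply: der_gt du _ => x /andP[x0 xp]; rewrite pmulr_rlt0//.
  have -> : cos x = - cos (x - pi) by rewrite -[in LHS](subrK pi x) cosDpi.
  by rewrite oppr_lt0; apply: cos_gt0_pihalf; lra.
have dvr (s : R) : is_derive s 1 (fun t => v (2 * pi - t)) (r (2 * pi - s) * sin s).
  have sh1 : is_derive s 1 (fun t => 2 * pi - t) (-1 : R) by dereq; ring.
  apply: der_eq (@der_comp R v (fun t => 2 * pi - t) s _ _ (dv _) sh1) _.
  by rewrite sinB mulr_natl sin2pi cos2pi; ring.
have pos (q : R -> R) s : (forall s, 0 < q s) -> 0 < s < pi -> 0 < q s * sin s.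
  by move=> q0 sp; rewrite mulr_gt0// sin_gt0_pi.
have [g1 [g1c g1K _ g1P _]] := arc_inverse p0 dv (fun s => pos r s r0).
have [g2 [g2c g2K _ g2P _]] := arc_inverse p0 dvr (fun s => pos (fun s => r (2 * pi - s)) s (fun s => r0 _)).
have e2 : 2 * pi - pi = pi :> R by ring.
rewrite subr0 v2 e2 in g2P.
pose F y := u (g1 y) - u (2 * pi - g2 y).
have Fc : continuous F by rewrite /F; cont.
have v0p : v 0 < v pi by apply: vi.
have F0 : F (v 0) < 0.
  have z0 : 0 <= (0 : R) <= pi by rewrite lexx ltW.
  have k2 := g2K 0 z0; rewrite subr0 v2 in k2.
  by rewrite /F (g1K 0 z0) k2 subr0 subr_lt0.
(* The larger of the heights at angles pi / 2 and 3 pi / 2 works: both points at that height have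
   angles in the range where [u] decreases. *)
have [y1 y1I F1] : exists2 y, v 0 < y < v pi & 0 < F y.
  have q1 : v (pi / 2) < v pi by apply: vi; lra.
  have q2 : v (3 * pi / 2) < v pi by apply: vd; lra.
  have q3 : v 0 < v (pi / 2) by apply: vi; lra.
  have q4 : v 0 < v (3 * pi / 2) by rewrite -v2; apply: vd; lra.
  have [vle|vlt] := leP (v (3 * pi / 2)) (v (pi / 2)).
    exists (v (pi / 2)); first by rewrite q1 q3.
    have [|/andP[b1 b2] b3] := g2P (v (pi / 2)); first by rewrite !ltW.
    rewrite /F g1K; last by lra.
    rewrite subr_gt0; set s := 2 * pi - _ in b3 *.
    have s2 : s <= 2 * pi by rewrite /s; lra.
    have sp : pi <= s by rewrite /s; lra.
    have s1 : s <= 3 * pi / 2.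
      rewrite leNgt; apply/negP => h.
      by have := vd (3 * pi / 2) s; rewrite b3; lra.
    by apply: ud; lra.
  exists (v (3 * pi / 2)); first by rewrite q2 q4.
  have [|/andP[a1 a2] a3] := g1P (v (3 * pi / 2)); first by rewrite !ltW.
  rewrite /F; have {2}-> : 3 * pi / 2 = 2 * pi - pi / 2 :> R by field.
  rewrite g2K ?subr_gt0; last by lra.
  have s1 : pi / 2 <= g1 (v (3 * pi / 2)).
    rewrite leNgt; apply/negP => h.
    by have := vi (g1 (v (3 * pi / 2))) (pi / 2); rewrite a3; lra.
  by apply: ud; lra.
have /andP[y10 y1p] := y1I.
have [|y /andP[y0 yy1] Fy] := @IVT_cont R F (v 0) y1 0 (ltW y10) Fc; first by rewrite !ltW.
have [|/andP[a1 a2] a3] := g1P y; first by rewrite y0 (le_trans yy1)// ltW.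
have [|/andP[b1 b2] b3] := g2P y; first by rewrite y0 (le_trans yy1)// ltW.
exists (g1 y), (2 * pi - g2 y); split => //; [|by lra|by move: Fy; rewrite /F; lra|by rewrite a3 b3].
have : g1 y != pi by apply: contraTneq y1p => e; rewrite -leNgt -e a3.
by rewrite neq_lt; lra.
Qed.

(* With [h] the support function, [h (s + 2 * pi) - h s] changes sign. Where it
   vanishes increasingly, the arc from [s] to [s + 2 * pi] starts and ends at the
   same height and advances, so its rising and falling halves cross. *)
Lemma locally_convex_turning_number (X Y r : R -> R) (m : nat) :
  (forall s : R, is_derive s 1 X (r s * cos s)) ->
  (forall s : R, is_derive s 1 Y (r s * sin s)) ->
  (forall s, 0 < r s) ->
  (forall s, X (s + m%:R * (2 * pi)) = X s) ->
  (forall s, Y (s + m%:R * (2 * pi)) = Y s) ->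
  (1 < m)%N ->
  exists s1 s2, [/\ s1 < s2, s2 < s1 + m%:R * (2 * pi), X s1 = X s2 & Y s1 = Y s2].
Proof.
move=> dX dY r0 pX pY m2; have p0 : (0:R) < pi := pi_gt0 R.
set T := _ * (2 * pi) in pX pY *.
have T4 : 2 * (2 * pi) <= T by rewrite ler_pM2r ?ler_nat//; lra.
have [//|inj] := EM (exists s1 s2, [/\ s1 < s2, s2 < s1 + T, X s1 = X s2 & Y s1 = Y s2]).
have sc (n : int) s : sin (s + n%:~R * (2 * pi)) = sin s :> R by apply: per_int; exact: sinD2p.
have cc (n : int) s : cos (s + n%:~R * (2 * pi)) = cos s :> R by apply: per_int; exact: cosD2p.
pose h s := X s * sin s - Y s * cos s.
pose h' s := X s * cos s + Y s * sin s.
have dh (s : R) : is_derive s 1 h (h' s) by dereq; rewrite /h'; ring.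
have dh' (s : R) : is_derive s 1 h' (r s + Y s * cos s - X s * sin s).
  dereq.
  transitivity (r s * (cos s ^+ 2 + sin s ^+ 2) + Y s * cos s - X s * sin s); first ring.
  by rewrite cos2Dsin2 mulr1.
have ph s : h (s + T) = h s by rewrite /h pX pY (sc m) (cc m).
have [|c _ cm] := per_max _ (der_contT dh) ph; first by lra.
pose D s := h (s + 2 * pi) - h s.
pose E s := h' (s + 2 * pi) - h' s.
have dD (s : R) : is_derive s 1 D (E s).
  exact: derD (der_shift (dh _)) (derN (dh s)).
have dE (s : R) := derD (der_shift (dh' (s + 2 * pi))) (derN (dh' s)).
(* [D s] and [E s] are the components, in a frame rotated by [s], of the displacement from [s] to
   [s + 2 * pi]. If both vanish, these two parameters give a self-intersection, since [T] is at
   least [4 * pi]. *)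
have ndeg s : D s = 0 -> E s <> 0.
  rewrite /D /E /h /h' sinD2p cosD2p => Ds Es; apply: inj; exists s, (s + 2 * pi).
  have [|||e1 e2] := @rotation_eq0 _ (X (s + 2 * pi) - X s) (Y (s + 2 * pi) - Y s) (cos s) (sin s).
  - exact: cos2Dsin2.
  - by rewrite -[RHS]Ds; ring.
  - by rewrite -[RHS]Es; ring.
  by split; [lra|lra|lra|lra].
have h'0 s : h s = h c -> h' s = 0.
  by move=> hs; apply: max_der0 dh => x; rewrite hs.
(* At a maximum [c] of [h], [D c <= 0] and [D (c - 2 * pi) >= 0]. Equality would produce a second
   maximum of [h], so [E] would vanish as well. *)
have Dneg : D c < 0.
  rewrite lt_neqAle subr_le0 cm andbT; apply/eqP => Dc; apply: (ndeg c Dc).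
  by rewrite /E !h'0 ?subrr//; move: Dc; rewrite /D; lra.
have Dpos : 0 < D (c - 2 * pi + T).
  have -> : D (c - 2 * pi + T) = D (c - 2 * pi).
    rewrite /D ph; congr (_ - _); rewrite -[RHS]ph; congr h; ring.
  have Dp : 0 <= D (c - 2 * pi) by rewrite /D subrK subr_ge0.
  rewrite lt_neqAle Dp andbT eq_sym; apply/eqP => Dc; apply: (ndeg _ Dc).
  by rewrite /E !h'0 ?subrr//; move: Dc; rewrite /D subrK; lra.
have [||z _ [Dz Ez]] := crossing dD _ _ Dneg Dpos ndeg.
- exact: der_contT dE.
- by lra.
(* Coordinates rotated by [z], in which the arc from [z] starts with tangent angle 0. *)
pose v s := - X (z + s) * sin z + Y (z + s) * cos z.
pose u s := X (z + s) * cos z + Y (z + s) * sin z.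
have dXz s := der_shiftl (dX (z + s)).
have dYz s := der_shiftl (dY (z + s)).
have cz s : cos s = cos (z + s) * cos z + sin (z + s) * sin z.
  by rewrite -cosB; congr cos; ring.
have szs s : sin s = sin (z + s) * cos z - cos (z + s) * sin z.
  by rewrite -sinB; congr sin; ring.
have [|||||s1 [s2 [s10 s12 s2p us vs]]] := @loop_crossing u v (fun s => r (z + s)).
- by move=> s; rewrite cz; dereq; ring.
- by move=> s; rewrite szs; dereq; ring.
- by move=> s.
- move: Dz; rewrite /D /h /v sinD2p cosD2p addr0; lra.
- move: Ez; rewrite /E /h' /u sinD2p cosD2p addr0; lra.
have e := cos2Dsin2 z.
have [|||e1 e2] := @rotation_eq0 _ (X (z + s1) - X (z + s2)) (Y (z + s1) - Y (z + s2)) (cos z) (sin z).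
- exact: e.
- by move: vs; rewrite /v; lra.
- by move: us; rewrite /u; lra.
by exists (z + s1), (z + s2); split; lra.
Qed.

End Loop.

(** * Simple locally convex plane curves *)

Section Angle.
Variable R : realType.
Implicit Types (X Y C S om lam th : R -> R) (P x y s : R).

Lemma cos_eq1 (t : R) : cos t = 1 -> exists n : int, t = n%:~R * (2 * pi).
Proof.
move=> t1; have p0 : (0:R) < pi := pi_gt0 R.
have [|n /andP[n0 n1]] := @per_red R (2 * pi) t; first lra.
exists (- n); rewrite mulrNz mulNr; apply/eqP; rewrite -addr_eq0; apply/eqP.
apply/eqP; rewrite eq_le n0 andbT leNgt; apply/negP => h.
set u := _ + _ in n0 n1 h.
have cu : cos u = 1 by rewrite /u (@per_int R R cos (2 * pi))//; exact: cosD2p.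
have su : 0 < sin (u / 2) by apply: sin_gt0_pi; lra.
have : cos u = 1 - 2 * sin (u / 2) ^+ 2.
  have {1}-> : u = (u / 2) *+ 2 by rewrite -mulr_natr divfK.
  by rewrite cos_mulr2n cos2sin2; ring.
by rewrite cu; have := exprn_gt0 2 su; lra.
Qed.

Lemma increasing_inverse th om P (T : R) : 0 < P -> 0 < T ->
  (forall x, is_derive x 1 th (om x)) -> (forall x, 0 < om x) ->
  (forall x, th (x + P) = th x + T) ->
  exists xi : R -> R, [/\ cancel th xi, cancel xi th,
    {homo xi : x y / x < y},
    (forall x, is_derive x 1 xi (om (xi x))^-1) &
    forall x, xi (x + T) = xi x + P].
Proof.
move=> P0 T0 dth om0 thP.
have thlt x y : x < y -> th x < th y.
  by move=> xy; apply: (der_lt dth (a := x) (b := y)).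
have thi : injective th.
  move=> x y; case: (ltgtP x y) => // /thlt + e; by rewrite e ltxx.
have thn (n : int) x : th (x + n%:~R * P) = th x + n%:~R * T.
  pose g x := th x - x * (T / P).
  have gP x0 : g (x0 + P) = g x0.
    by rewrite /g thP; field; rewrite gt_eqF.
  have := per_int gP n x; rewrite /g.
  have -> : (x + n%:~R * P) * (T / P) = x * (T / P) + n%:~R * T.
    by field; rewrite gt_eqF.
  lra.
have sur y : exists x, th x = y.
  have [n /andP[n0 n1]] := per_red (y - th 0) T0.
  have [|||c _ tc] := @IVT_cont R th (0 - n%:~R * P) (P - n%:~R * P) y.
  - by lra.
  - exact: der_contT dth.
  - have e x : th (x - n%:~R * P) = th x - n%:~R * T.
      by have := thn (- n) x; rewrite mulrNz !mulNr.
    by rewrite !e; have := thP 0; rewrite add0r; lra.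
  by exists c.
pose xi y := xget 0 [set x | th x = y].
have xiK : cancel xi th.
  move=> y; rewrite /xi; case: xgetP => [//|none].
  by have [x tx] := sur y; case: (none x).
have thK : cancel th xi by move=> x; apply: thi; rewrite xiK.
exists xi; split => //.
- move=> x y xy; rewrite ltNge; apply/negP; rewrite le_eqVlt => /predU1P[e|/thlt].
    by move: xy; rewrite -(xiK x) -(xiK y) e ltxx.
  by rewrite !xiK => /lt_trans /(_ xy); rewrite ltxx.
- move=> y; rewrite -[y in is_derive y](xiK y).
  apply: is_derive_inverse.
  + by near=> z; exact: thK.
  + near=> z; exact: der_cont (dth z).
  + by rewrite gt_eqF.
- by move=> x; apply: thi; rewrite thP !xiK.
Unshelve. all: by end_near. Qed.

Section Turning.
Variables C S om : R -> R.
Variable P : R.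
Hypotheses (P0 : 0 < P) (dC : forall x, is_derive x 1 C (- om x * S x))
  (dS : forall x, is_derive x 1 S (om x * C x)) (omc : continuous om)
  (om0 : forall x, 0 < om x) (omP : forall x, om (x + P) = om x)
  (CP : C P = 1) (C0 : C 0 = 1) (S0 : S 0 = 0).

(** With respect to the frame turned by a primitive [th] of [om], the vector [(C, S)] has constant
    components 1 and 0. *)
Lemma angle_lift :
  exists th, [/\ th 0 = 0, (forall x, is_derive x 1 th (om x)),
    (forall x, C x = cos (th x)) & (forall x, S x = sin (th x))].
Proof.
have [F dF] := primitive omc.
pose th x := F x - F 0.
have dth (x : R) : is_derive x 1 th (om x) by dereq; ring.
have th0 : th 0 = 0 by rewrite /th subrr.
have h (x : R) : is_derive x 1 (fun x => C x * cos (th x) + S x * sin (th x)) 0.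
  by dereq; ring.
have g (x : R) : is_derive x 1 (fun x => S x * cos (th x) - C x * sin (th x)) 0.
  by dereq; ring.
have e1 x : C x * cos (th x) + S x * sin (th x) = 1.
  by rewrite (der0_cst h x 0) th0 C0 S0 cos0 sin0; ring.
have e2 x : S x * cos (th x) - C x * sin (th x) = 0.
  by rewrite (der0_cst g x 0) th0 C0 S0 cos0 sin0; ring.
exists th; split => // x.
  transitivity (C x * (cos (th x) ^+ 2 + sin (th x) ^+ 2)); first by rewrite cos2Dsin2 mulr1.
  transitivity (cos (th x) * (C x * cos (th x) + S x * sin (th x))
    - sin (th x) * (S x * cos (th x) - C x * sin (th x))); first by ring.
  by rewrite e1 e2; ring.
transitivity (S x * (cos (th x) ^+ 2 + sin (th x) ^+ 2)); first by rewrite cos2Dsin2 mulr1.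
transitivity (sin (th x) * (C x * cos (th x) + S x * sin (th x))
  + cos (th x) * (S x * cos (th x) - C x * sin (th x))); first by ring.
by rewrite e1 e2; ring.
Qed.

Lemma turning_number :
  exists th (m : nat), [/\ th 0 = 0, (forall x, is_derive x 1 th (om x)),
    (forall x, C x = cos (th x)) /\ (forall x, S x = sin (th x)),
    (0 < m)%N & forall x, th (x + P) = th x + m%:R * (2 * pi)].
Proof.
have [th [th0 dth Cth Sth]] := angle_lift.
have p0 : (0:R) < pi := pi_gt0 R.
have [n thP] : exists n : int, th P = n%:~R * (2 * pi).
  by apply: cos_eq1; rewrite -Cth.
have thi : th 0 < th P by apply: (der_lt dth (a := 0) (b := P)).
have n0 : 0 < n.
  by move: thi; rewrite th0 thP pmulr_lgt0 ?ltr0z//; lra.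
case: n thP n0 => // n thP n0.
exists th, n; split => // x.
by have := der_per_shift dth omP x; rewrite th0 thP -[n%:~R]/(n%:R : R); lra.
Qed.

Variables X Y lam : R -> R.
Hypotheses (dX : forall x, is_derive x 1 X (lam x * C x))
  (dY : forall x, is_derive x 1 Y (lam x * S x)) (lam0 : forall x, 0 < lam x)
  (XP : forall x, X (x + P) = X x) (YP : forall x, Y (x + P) = Y x)
  (simple : forall x y, x < y -> y < x + P -> X x = X y -> Y x = Y y -> False).

(** Parametrised by its tangent angle, the curve moves with positive speed [lam / om] in the
    direction of that angle, so two or more turns would force a self-intersection. *)
Lemma simple_convex_turning :
  exists th, [/\ th 0 = 0, (forall x, is_derive x 1 th (om x)),
    (forall x, C x = cos (th x)) /\ (forall x, S x = sin (th x)) &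
    forall x, th (x + P) = th x + 2 * pi].
Proof.
have [th [m [th0 dth [Cth Sth] m0 thP]]] := turning_number.
exists th; split => // x; rewrite thP.
have [->|m1] := eqVneq m 1%N; first by rewrite mul1r.
have {m0 m1} m2 : (1 < m)%N by case: m m0 m1 {thP} => [|[|m]].
have p0 : (0:R) < pi := pi_gt0 R.
have T0 : 0 < m%:R * (2 * pi) :> R by rewrite mulr_gt0 ?ltr0n ?(ltnW m2)//; lra.
have [xi [thK xiK xilt dxi xiT]] := increasing_inverse P0 T0 dth om0 thP.
have ne0 z : om z != 0 by rewrite gt_eqF.
have [|||||//|s1 [s2 [s12 s2T Xs Ys]]] := @locally_convex_turning_number R
   (fun t => X (xi t)) (fun t => Y (xi t)) (fun t => lam (xi t) / om (xi t)) m.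
- move=> s; apply: der_eq (der_comp (dX _) (dxi s)) _.
  by rewrite Cth xiK; field.
- move=> s; apply: der_eq (der_comp (dY _) (dxi s)) _.
  by rewrite Sth xiK; field.
- by move=> s; rewrite divr_gt0.
- by move=> s; rewrite xiT XP.
- by move=> s; rewrite xiT YP.
case: (@simple (xi s1) (xi s2)) => //; first exact: xilt.
by rewrite -xiT; exact: xilt.
Qed.

(** A single turn leaves one stretch where [Y] rises, with angles below pi, and one where it falls
    back to its initial value at [P]. *)
Lemma simple_convex_min s : 0 < s < P -> Y 0 < Y s.
Proof.
move=> /andP[s0 sP]; have [th [th0 dth [Cth Sth] thP]] := simple_convex_turning.
have p0 : (0:R) < pi := pi_gt0 R.
have th2 : th P = 2 * pi by have := thP 0; rewrite add0r th0 add0r.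
have thlt x y : x < y -> th x < th y.
  by move=> xy; apply: (der_lt dth (a := x) (b := y)).
have [||c /andP[c0 cP] thc] := @IVT_cont R th 0 P pi (ltW P0).
- exact: der_contT dth.
- by rewrite th0 th2; lra.
have Yi : forall x y, 0 <= x -> x < y -> y <= c -> Y x < Y y.
  apply: der_lt dY _ => x /andP[x0 xc]; rewrite mulr_gt0// Sth.
  by apply: sin_gt0_pi; have := thlt _ _ x0; have := thlt _ _ xc; lra.
have Yd : forall x y, c <= x -> x < y -> y <= P -> Y y < Y x.
  apply: der_gt dY _ => x /andP[x0 xc]; rewrite pmulr_rlt0// Sth.
  by apply: sin_lt0; have := thlt _ _ x0; have := thlt _ _ xc; lra.
have [sc|cs] := leP s c; first exact: Yi.
have <- : Y P = Y 0 by have := YP 0; rewrite add0r.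
by apply: Yd => //; exact: ltW.
Qed.

End Turning.

End Angle.

(** * Curves in the hyperboloid model *)

Section Lorentz.
Variable R : realType.
Implicit Types (p q u v w a b : pt R).

(** The Lorentzian cross product: [mink (cross p q) w] is the determinant of [p], [q], [w], which
    fixes the sign of the third coordinate. *)
Definition cross p q : pt R :=
  (p.1.2 * q.2 - p.2 * q.1.2, p.2 * q.1.1 - p.1.1 * q.2,
   p.1.2 * q.1.1 - p.1.1 * q.1.2).

Lemma minkC p q : mink p q = mink q p.
Proof. by rewrite /mink; ring. Qed.

Lemma minkDl u v w : mink (ptadd u v) w = mink u w + mink v w.
Proof. by rewrite /mink/=; ring. Qed.

Lemma minkDr u v w : mink w (ptadd u v) = mink w u + mink w v.
Proof. by rewrite /mink/=; ring. Qed.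

Lemma minkZl (k : R) v w : mink (ptscale k v) w = k * mink v w.
Proof. by rewrite /mink/=; ring. Qed.

Lemma minkZr (k : R) v w : mink w (ptscale k v) = k * mink w v.
Proof. by rewrite /mink/=; ring. Qed.

Lemma mink_cross a b u v :
  mink (cross a b) (cross u v) = - (mink a u * mink b v - mink a v * mink b u).
Proof. by rewrite /mink/cross/=; ring. Qed.

Lemma mink_crossl a b : mink (cross a b) a = 0.
Proof. by rewrite /mink/cross/=; ring. Qed.

Lemma mink_crossr a b : mink (cross a b) b = 0.
Proof. by rewrite /mink/cross/=; ring. Qed.

Lemma cross_cross a b u :
  cross a (cross b u) = ptadd (ptscale (mink a b) u) (ptscale (- mink a u) b).
Proof. by rewrite /mink/cross/ptadd/ptscale/=; congr (_, _, _); ring. Qed.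

(** Expansion of [mink v w] in the basis [a], [b], [cross a b], cleared of the Gram determinant of
    [a] and [b]; for a curve point and its unit tangent this determinant is -1. *)
Lemma cross_completeness a b v w :
  mink v w * (mink a a * mink b b - mink a b ^+ 2) =
  mink v a * mink w a * mink b b + mink v b * mink w b * mink a a
  - (mink v a * mink w b + mink v b * mink w a) * mink a b
  - mink v (cross a b) * mink w (cross a b).
Proof. by rewrite /mink/cross/=; ring. Qed.

Lemma pt_eq p q :
  p.1.1 = q.1.1 -> p.1.2 = q.1.2 -> p.2 = q.2 -> p = q.
Proof. by case: p q => [[? ?] ?] [[? ?] ?] /= -> -> ->. Qed.

Lemma mink_ext p q : (forall v, mink p v = mink q v) -> p = q.
Proof.
move=> h; apply: pt_eq.
- by have := h (1, 0, 0); rewrite /mink/=; lra.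
- by have := h (0, 1, 0); rewrite /mink/=; lra.
- by have := h (0, 0, 1); rewrite /mink/=; lra.
Qed.

Definition der_pt (f : R -> pt R) (x : R) (v : pt R) : Prop :=
  [/\ is_derive x 1 (fun y => (f y).1.1) v.1.1,
      is_derive x 1 (fun y => (f y).1.2) v.1.2 &
      is_derive x 1 (fun y => (f y).2) v.2].

Lemma der_mink f g (x : R) u v : der_pt f x u -> der_pt g x v ->
  is_derive x 1 (fun y => mink (f y) (g y)) (mink u (g x) + mink (f x) v).
Proof.
by move=> [f1 f2 f3] [g1 g2 g3]; rewrite /mink; dereq; ring.
Qed.

Lemma der_pt_cst v (x : R) : der_pt (fun=> v) x (0, 0, 0).
Proof. by split => /=; exact: der_cst. Qed.

Lemma der_minkl f (x : R) u w : der_pt f x u ->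
  is_derive x 1 (fun y => mink (f y) w) (mink u w).
Proof.
by move=> fu; apply: der_eq (der_mink fu (der_pt_cst w x)) _; rewrite /mink/=; ring.
Qed.

Lemma der_pt_comp f (h : R -> R) (x a : R) u : der_pt f (h x) u ->
  is_derive x 1 h a -> der_pt (fun y => f (h y)) x (ptscale a u).
Proof.
move=> [f1 f2 f3] dh; split.
- by apply: der_eq (der_comp (f := fun y => (f y).1.1) f1 dh) _; rewrite /= mulrC.
- by apply: der_eq (der_comp (f := fun y => (f y).1.2) f2 dh) _; rewrite /= mulrC.
- by apply: der_eq (der_comp (f := fun y => (f y).2) f3 dh) _; rewrite /= mulrC.
Qed.

Lemma ptscale1 u : ptscale 1 u = u.
Proof. by apply: pt_eq; rewrite /= mul1r. Qed.

Lemma der_pt_shift f (x s : R) u : der_pt f (x + s) u ->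
  der_pt (fun s => f (x + s)) s u.
Proof.
move=> fu; rewrite -(ptscale1 u); apply: (der_pt_comp (h := fun s => x + s)) => //.
by dereq; ring.
Qed.

(* The sign [eps] points the normal [nu] to the side the curve bends to, so that
   [kk] is the unsigned curvature. *)
Record frenet (P : R) := Frenet {
  cu : R -> pt R;
  tg : R -> pt R;
  nu : R -> pt R;
  kk : R -> R;
  eps : R;
  P_gt0 : 0 < P;
  der_cu : forall x, der_pt cu x (tg x);
  der_tg : forall x, der_pt tg x (ptadd (cu x) (ptscale (kk x) (nu x)));
  der_nu : forall x, der_pt nu x (ptscale (- kk x) (tg x));
  eps2 : eps * eps = 1;
  nuE : forall x, nu x = ptscale eps (cross (cu x) (tg x));
  cucu : forall x, mink (cu x) (cu x) = -1;
  tgtg : forall x, mink (tg x) (tg x) = 1;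
  cutg : forall x, mink (cu x) (tg x) = 0;
  cu_gt0 : forall x, 0 < (cu x).2;
  kk_gt1 : forall x, 1 < kk x;
  kk_cont : continuous kk;
  cu_per : forall x, cu (x + P) = cu x;
  tg_per : forall x, tg (x + P) = tg x;
  kk_per : forall x, kk (x + P) = kk x;
  cu_simple : forall x y, x < y -> y < x + P -> cu x = cu y -> False
}.

End Lorentz.

Section Horoconvex.
Variables (R : realType) (P : R) (F : frenet P).
Local Notation g := (cu F).
Local Notation t := (tg F).
Local Notation n := (nu F).
Local Notation k := (kk F).
Implicit Types (x y s : R) (u v w : pt R).

Lemma cunu x : mink (g x) (n x) = 0.
Proof. by rewrite nuE minkZr minkC mink_crossl mulr0. Qed.

Lemma tgnu x : mink (t x) (n x) = 0.
Proof. by rewrite nuE minkZr minkC mink_crossr mulr0. Qed.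

Lemma nunu x : mink (n x) (n x) = 1.
Proof.
rewrite nuE minkZr minkZl mink_cross cucu tgtg (minkC (t x)) cutg mulrA eps2; ring.
Qed.

Lemma nu_per x : n (x + P) = n x.
Proof. by rewrite !nuE cu_per tg_per. Qed.

Lemma completeness x v w : mink v w =
  - (mink v (g x) * mink w (g x)) + mink v (t x) * mink w (t x)
  + mink v (n x) * mink w (n x).
Proof.
have := cross_completeness (g x) (t x) v w.
rewrite cucu tgtg cutg => h.
have -> : mink v (n x) * mink w (n x) =
   mink v (cross (g x) (t x)) * mink w (cross (g x) (t x)).
  rewrite nuE !minkZr mulrACA eps2; ring.
by move: h; rewrite expr0n/=; lra.
Qed.

Lemma frame_ext x v w : mink v (g x) = mink w (g x) ->
  mink v (t x) = mink w (t x) -> mink v (n x) = mink w (n x) -> v = w.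
Proof.
by move=> h1 h2 h3; apply: mink_ext => u; rewrite !(completeness x _ u) h1 h2 h3.
Qed.

(** If l is the length of the chord from [g x] to [g y] and phi its angle with the tangent at [g x],
    then [ch], [cp], [cq] are cosh l, sinh l cos phi and sinh l sin phi. *)
Definition ch x y := - mink (g x) (g y).
Definition cp x y := mink (g y) (t x).
Definition cq x y := mink (g y) (n x).

Lemma chC x y : ch x y = ch y x.
Proof. by rewrite /ch minkC. Qed.

Lemma cpcq x y : cp x y ^+ 2 + cq x y ^+ 2 = ch x y ^+ 2 - 1.
Proof.
have := completeness x (g y) (g y); rewrite cucu /cp /cq /ch (minkC (g x)).
by move=> h; rewrite sqrrN !expr2; lra.
Qed.

(* Reversed Cauchy-Schwarz for future timelike vectors. *)
Lemma timelike_ch (p q : pt R) : onH2 p -> onH2 q -> 1 <= - mink p q.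
Proof.
case: p q => [[p1 p2] p3] [[q1 q2] q3]; rewrite /onH2 /mink/= => -[hp p0] [hq q0].
have h : (p3 * q3) ^+ 2 = (1 + p1 * q1 + p2 * q2) ^+ 2 +
   ((p1 - q1) ^+ 2 + (p2 - q2) ^+ 2 + (p1 * q2 - p2 * q1) ^+ 2).
  have -> : (p3 * q3) ^+ 2 = (p3 * p3) * (q3 * q3) by ring.
  have -> : p3 * p3 = 1 + p1 * p1 + p2 * p2 by lra.
  have -> : q3 * q3 = 1 + q1 * q1 + q2 * q2 by lra.
  ring.
have pq : 0 < p3 * q3 by rewrite mulr_gt0.
have [neg|pos] := leP (1 + p1 * q1 + p2 * q2) 0; first by lra.
suff : 1 + p1 * q1 + p2 * q2 <= p3 * q3 by lra.
rewrite -(@ler_pXn2r _ 2)// ?nnegrE ?(ltW pos) ?(ltW pq)// h lerDl.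
by rewrite !addr_ge0 ?sqr_ge0.
Qed.

Lemma cu_onH2 x : onH2 (g x).
Proof. by split; [exact: cucu|exact: cu_gt0]. Qed.

Lemma ch_ge1 x y : 1 <= ch x y.
Proof. exact: timelike_ch (cu_onH2 _) (cu_onH2 _). Qed.

Lemma chxx x : ch x x = 1.
Proof. by rewrite /ch cucu opprK. Qed.

Lemma cpxx x : cp x x = 0.
Proof. exact: cutg. Qed.

Lemma cqxx x : cq x x = 0.
Proof. exact: cunu. Qed.

Lemma horo_gt0 x y : 0 < ch x y - cq x y.
Proof.
have := cpcq x y; have := ch_ge1 x y; have := sqr_ge0 (cp x y) => h0 h1 h2.
rewrite subr_gt0 ltNge; apply/negP => h.
have := @ler_pM _ (ch x y) (cq x y) (ch x y) (cq x y); rewrite -!expr2; lra.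
Qed.

(** The cross product with [t x] returns the null vector [g x + n x] up to the sign [eps], so this
    is [mink_cross] for the pair [g y], [t y] against the pair [g x + n x], [t x]. It yields the
    derivative of the half-plane abscissa in [horo_support]. *)
Lemma horo_tangent x y :
  (ch x y - cq x y) * mink (t y) (t x) + cp x y * (mink (t y) (g x) + mink (t y) (n x))
  = mink (n y) (g x) + mink (n y) (n x).
Proof.
have L := mink_cross (g y) (t y) (ptadd (g x) (n x)) (t x).
have e : cross (ptadd (g x) (n x)) (t x) = ptscale (eps F) (ptadd (n x) (g x)).
  have e1 : cross (ptadd (g x) (n x)) (t x) =
     ptadd (cross (g x) (t x)) (ptscale (-1) (cross (t x) (n x))).
    by rewrite /cross/ptadd/ptscale/=; congr (_, _, _); ring.
  have e2 : cross (t x) (n x) = ptscale (eps F) (cross (t x) (cross (g x) (t x))).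
    by rewrite nuE /cross/ptadd/ptscale/=; congr (_, _, _); ring.
  rewrite e1 e2 cross_cross tgtg (minkC (t x)) cutg.
  have -> : cross (g x) (t x) = ptscale (eps F) (n x).
    apply: mink_ext => v; rewrite nuE !minkZl mulrA eps2; ring.
  by apply: mink_ext => v; rewrite ?(minkZl, minkDl); ring.
move: L; rewrite e !minkZr !minkDr => L.
have nE v : mink (n y) v = eps F * mink (cross (g y) (t y)) v.
  by rewrite nuE minkZl.
rewrite /ch /cq /cp !nE (minkC (g x)).
lra.
Qed.

(* [X] and [Y] are the coordinates of the curve in the half-plane model whose point
   at infinity is the centre of the horocycle tangent at [x]. The direction [(C, S)]
   turns monotonically because k > 1, hence [Y] is minimal at [x]. *)
Lemma horo_support x s : 0 < s < P -> ch x (x + s) - 1 < cq x (x + s).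
Proof.
move=> sP.
pose l := ptadd (g x) (n x).
have ll : mink l l = 0.
  by rewrite /l !minkDl !minkDr cucu nunu (minkC (n x)) cunu; ring.
pose w s := - mink (g (x + s)) l.
have wE z : w z = ch x (x + z) - cq x (x + z).
  by rewrite /w /l minkDr /ch /cq (minkC (g x)); ring.
have w0 z : 0 < w z by rewrite wE horo_gt0.
have wn0 z : w z != 0 by rewrite gt_eqF.
pose C s := mink (n (x + s)) l / w s.
pose S s := mink (t (x + s)) l / w s.
pose X s := mink (g (x + s)) (t x) / w s.
pose Y s := (w s)^-1.
have dg (z : R) : der_pt (fun s => g (x + s)) z (t (x + z)).
  by apply: der_pt_shift; exact: der_cu.
have dt (z : R) := der_pt_shift (der_tg F (x + z)).
have dn (z : R) := der_pt_shift (der_nu F (x + z)).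
have dw (z : R) : is_derive z 1 w (- mink (t (x + z)) l).
  by apply: derN; exact: der_minkl.
have dwV (z : R) := derV (wn0 z) (dw z).
have dnl (z : R) := der_minkl l (dn z).
have dtl (z : R) := der_minkl l (dt z).
have dgt (z : R) := der_minkl (t x) (dg z).
(* As [l] is null, completeness in the frame at [x + z] writes [w z ^+ 2] as the sum of the squares
   of the tangential and normal components of [l]. *)
have CS z : C z ^+ 2 + S z ^+ 2 = 1.
  rewrite /C /S; have := completeness (x + z) l l; rewrite ll.
  have -> : mink l (g (x + z)) = - w z by rewrite /w opprK minkC.
  rewrite (minkC l (t _)) (minkC l (n _)) => h.
  have h' : mink (t (x + z)) l ^+ 2 + mink (n (x + z)) l ^+ 2 = w z ^+ 2.
    by rewrite !expr2; lra.
  rewrite !expr_div_n -mulrDl addrC h' divff// expf_neq0//.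
have l0 : w 0 = 1 by rewrite wE addr0 chxx cqxx subr0.
have C0 : C 0 = 1.
  by rewrite /C l0 addr0 divr1 /l minkDr minkC cunu nunu add0r.
have S0 : S 0 = 0.
  by rewrite /S addr0 /l minkDr minkC cutg tgnu addr0 mul0r.
have pw z : w (z + P) = w z by rewrite /w addrA cu_per.
have : Y 0 < Y s.
  apply: (@simple_convex_min R C S (fun s => k (x + s) - C s) P (P_gt0 F) _ _ _ _ _ _ C0 S0
    X Y (fun s => (w s)^-1)) => //.
  - move=> z; apply: der_eq (derM (dnl z) (dwV z)) _.
    rewrite minkZl /C /S; field; exact: wn0.
  - move=> z; apply: der_eq (derM (dtl z) (dwV z)) _.
    transitivity (-(C z ^+ 2 + S z ^+ 2) + k (x + z) * C z + S z ^+ 2); last by ring.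
    rewrite CS minkDl minkZl.
    have -> : mink (g (x + z)) l = - w z by rewrite /w opprK.
    rewrite /C /S; field; exact: wn0.
  - have kc := @kk_cont R P F; have Cc : continuous C := der_contT (fun z => derM (dnl z) (dwV z)).
    by cont.
  - move=> z; rewrite subr_gt0; apply: le_lt_trans (kk_gt1 F _).
    rewrite leNgt; apply/negP => h.
    have := CS z; have := sqr_ge0 (S z).
    by have := @ltr_pM R 1 (C z) 1 (C z); rewrite -expr2; lra.
  - by move=> z; rewrite /C pw !addrA kk_per nu_per.
  - by rewrite -C0 -[in LHS](add0r P) /C pw addrA nu_per.
  - move=> z; apply: der_eq (derM (dgt z) (dwV z)) _.
    have := horo_tangent x (x + z).
    rewrite -wE /cp -!minkDr -/l => h.
    rewrite /C -h; field; exact: wn0.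
  - move=> z; apply: der_eq (dwV z) _; rewrite /S; field; exact: wn0.
  - by move=> z; rewrite invr_gt0.
  - by move=> z; rewrite /X pw addrA cu_per.
  - by move=> z; rewrite /Y pw.
  (* Equal half-plane coordinates give equal [w = ch - cq] and equal [cp]. Since
     [cp ^+ 2 = (ch - cq) * (ch + cq) - 1], the sums [ch + cq] agree too, hence all components of
     the two points. *)
  - move=> a b ab bP XE YE; apply: (@cu_simple R P F (x + a) (x + b)); [lra|lra|].
    have we : w a = w b by move: YE => /invr_inj.
    have pe : cp x (x + a) = cp x (x + b).
      move: XE; rewrite /X we => /(congr1 (fun z => z * w b)).
      by rewrite !divfK.
    have wa := wE a; have wb := wE b.
    have ha := cpcq x (x + a); have hb := cpcq x (x + b).
    have sume : ch x (x + a) + cq x (x + a) = ch x (x + b) + cq x (x + b).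
      apply: (@mulfI _ (w b)); first exact: wn0.
      by rewrite -{1}we wa wb; move: ha hb; rewrite pe; lra.
    apply: (@frame_ext x).
    + have : ch x (x + a) = ch x (x + b) by lra.
      by rewrite /ch !(minkC (g x)); lra.
    + exact: pe.
    + by rewrite -/(cq x (x + a)) -/(cq x (x + b)); lra.
rewrite /Y l0 invr1 => h.
have : w s < 1 by rewrite -invf_gt1.
by rewrite wE; lra.
Qed.

End Horoconvex.

(** * Gauss-Bonnet *)

Section GaussBonnet.
Variables (R : realType) (P : R) (F : frenet P).
Local Notation g := (cu F).
Local Notation t := (tg F).
Local Notation n := (nu F).
Local Notation k := (kk F).
Implicit Types (x y s : R).
Let f x := (g x).1.1.
Let f1 x := (t x).1.1.
Let gg x := (n x).1.1.

Lemma mink_e1 (v : pt R) : mink v (1, 0, 0) = v.1.1.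
Proof. by rewrite /mink/=; ring. Qed.

Lemma abscissa_norm x : f1 x ^+ 2 + gg x ^+ 2 = 1 + f x ^+ 2.
Proof.
have := completeness F x (1, 0, 0) (1, 0, 0).
rewrite (minkC _ (g x)) (minkC _ (t x)) (minkC _ (n x)) !mink_e1/=.
by rewrite /f /f1 /gg !expr2; lra.
Qed.

Let den0 x : 0 < 1 + f x ^+ 2.
Proof. by have := sqr_ge0 (f x); lra. Qed.

(** At a critical point, [f (x + s)] is [ch * f x + cq * gg x]. The support inequality replaces [cq]
    by the smaller [ch - 1], and what remains is [(ch - 1) * (e * f x + e * gg x)], which is
    nonnegative. So a critical point is a strict minimum or maximum over the whole curve, according
    to the sign of [gg]. *)
Lemma abscissa_crit (e : R) x s : e ^+ 2 = 1 -> f1 x = 0 -> 0 < e * gg x -> 0 < s < P ->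
  0 < e * (f (x + s) - f x).
Proof.
move=> e2 fx0 gx sP; have h := horo_support F x sP; have c1 := ch_ge1 F x (x + s).
have N : (e * gg x) ^+ 2 = 1 + (e * f x) ^+ 2.
  by rewrite !exprMn e2 !mul1r -abscissa_norm fx0 expr0n add0r.
have fg : 0 < e * f x + e * gg x.
  rewrite ltNge; apply/negP => fg.
  have := @ler_pM R (e * gg x) (- (e * f x)) (e * gg x) (- (e * f x)).
  by rewrite mulrNN -!expr2; lra.
have E := completeness F x (g (x + s)) (1, 0, 0).
rewrite (minkC (1, 0, 0) (g x)) (minkC (1, 0, 0) (t x)) (minkC (1, 0, 0) (n x)) !mink_e1 in E.
rewrite -/(f _) -/(f1 x) fx0 -/(gg x) -/(f x) in E.
have h2 : 0 < (cq F x (x + s) - (ch F x (x + s) - 1)) * (e * gg x) by rewrite mulr_gt0//; lra.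
have h3 : 0 <= (ch F x (x + s) - 1) * (e * f x + e * gg x) by rewrite mulr_ge0//; lra.
move: h2 h3; rewrite /ch /cq (minkC (g x)) => h2 h3; rewrite E; lra.
Qed.

Let df x : is_derive x 1 f (f1 x).
Proof. by have [] := der_cu F x. Qed.

Let df1 x : is_derive x 1 f1 (f x + k x * gg x).
Proof. by have [] := der_tg F x. Qed.

Let dgg x : is_derive x 1 gg (- k x * f1 x).
Proof. by have [] := der_nu F x. Qed.

Let fP x : f (x + P) = f x.
Proof. by rewrite /f cu_per. Qed.

(* The point [a] is the leftmost point of the curve, [a + b] the rightmost one;
   [th] is the angle of the tangent in the frame adapted to the hypercycles
   [p_1 = const]. *)
Lemma abscissa_two_arcs : exists a b th, [/\ 0 < b < P,
  (forall s, 0 < s < b -> 0 < f1 (a + s)),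
  (forall s, b < s < P -> f1 (a + s) < 0),
  (forall s, is_derive s 1 th
     (k (a + s) + f (a + s) * gg (a + s) / (1 + f (a + s) ^+ 2))) &
  th P = th 0 + 2 * pi].
Proof.
have P0 := P_gt0 F; have p0 : (0:R) < pi := pi_gt0 R.
have fc := der_contT df.
have [a _ am] : exists2 c, 0 <= c < P & forall x, - f x <= - f c.
  by apply: per_max => // x; [exact: contN (fc x)|rewrite fP].
have {}am x : f a <= f x by have := am x; lra.
have f1a : f1 a = 0 by exact: min_der0 am df.
(* [gg a = 0] contradicts [abscissa_norm], and a negative value would make the minimum [a] a strict
   maximum. *)
have gga : 0 < gg a.
  rewrite ltNge; apply/negP; rewrite le_eqVlt => /predU1P[e|lt].
    by have := abscissa_norm a; have := den0 a; rewrite f1a e !expr0n/=; lra.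
  have := @abscissa_crit (-1) a (P / 2) _ f1a; rewrite sqrrN expr1n !mulN1r.
  by have := am (a + P / 2); lra.
pose r x := Num.sqrt (1 + f x ^+ 2).
have r0 x : 0 < r x by rewrite sqrtr_gt0.
have rn0 x : r x != 0 by rewrite gt_eqF.
have r2 x : r x ^+ 2 = 1 + f x ^+ 2 by rewrite sqr_sqrtr// ltW.
have dr x : is_derive x 1 r (f x * f1 x / r x).
  have d1 : is_derive x 1 (fun x => 1 + f x ^+ 2) (2 * f x * f1 x) by dereq; ring.
  by apply: der_eq (@der_sqrt R (fun x => 1 + f x ^+ 2) x _ (den0 x) d1) _; rewrite -/(r x); field; exact: rn0.
have drV x := derV (rn0 x) (dr x).
pose om s := k (a + s) + f (a + s) * gg (a + s) / (1 + f (a + s) ^+ 2).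
have dC s : is_derive s 1 (fun s => gg (a + s) / r (a + s)) (- om s * (f1 (a + s) / r (a + s))).
  apply: der_eq (der_shiftl (derM (dgg (a + s)) (drV (a + s)))) _.
  rewrite /om -r2; field; exact: rn0.
have dS s : is_derive s 1 (fun s => f1 (a + s) / r (a + s)) (om s * (gg (a + s) / r (a + s))).
  apply: der_eq (der_shiftl (derM (df1 (a + s)) (drV (a + s)))) _.
  have N : gg (a + s) ^+ 2 = r (a + s) ^+ 2 - f1 (a + s) ^+ 2.
    by rewrite r2; have := abscissa_norm (a + s); lra.
  rewrite /om -r2.
  transitivity (k (a + s) * gg (a + s) / r (a + s) + f (a + s) * (r (a + s) ^+ 2 - f1 (a + s) ^+ 2) / r (a + s) ^+ 3).
    by field; exact: rn0.
  by rewrite -N; field; exact: rn0.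
(* The correction to [k] in [om] is thus at most 1 in absolute value, so that [om >= k - 1 > 0]. *)
have bound x : `|f x * gg x| <= 1 + f x ^+ 2.
  have := abscissa_norm x; have := sqr_ge0 (f1 x); have := sqr_ge0 (f x - gg x); have := sqr_ge0 (f x + gg x).
  rewrite ler_norml sqrrB sqrrD !mulr2n => h1 h2 h3 h4; apply/andP; split; lra.
have om0 s : 0 < om s.
  rewrite /om; have k1 := kk_gt1 F (a + s); set y := a + s in k1 *.
  have : -1 <= f y * gg y / (1 + f y ^+ 2).
    by rewrite ler_pdivlMr//; have := bound y; rewrite ler_norml; lra.
  lra.
have omc : continuous om.
  have kc := @kk_cont R P F; have gc := der_contT dgg.
  by rewrite /om; cont; rewrite gt_eqF.
have gP x : gg (x + P) = gg x by rewrite /gg nu_per.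
have C0 : gg (a + 0) / r (a + 0) = 1.
  have e : gg a = r a.
    apply/eqP; rewrite -(@eqrXn2 _ 2)// ?ltW// r2.
    by have := abscissa_norm a; rewrite f1a expr0n/= add0r => ->.
  by rewrite addr0 e divff.
have S0 : f1 (a + 0) / r (a + 0) = 0 by rewrite addr0 f1a mul0r.
have [||th [m [th0 dth [Cth Sth] m0 thP]]] := turning_number P0 dC dS omc om0 _ _ C0 S0.
- by move=> x; rewrite /om !addrA kk_per fP gP.
- by move: C0; rewrite addr0 /r gP fP.
have thlt x y : (th x < th y) = (x < y).
  apply: leW_mono x y; apply: le_mono => x y xy.
  by apply: (der_lt dth (a := x) (b := y)).
have thc := der_contT dth.
(* With a further turn the angle would equal [2 * pi] before [P], at a critical point with positive
   normal component. That point would be a strict minimum, against the choice of [a]. *)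
have m1 : m = 1%N.
  apply/eqP; rewrite eqn_leq m0 andbT leqNgt; apply/negP => m2.
  have thP2 : 2 * pi < th P.
    have := thP 0; rewrite add0r th0 add0r => ->.
    by rewrite -{1}(mul1r (2 * pi)) ltr_pM2r ?ltr1n//; lra.
  have [|s /andP[s0 sP] ths] := @IVT_cont R th 0 P (2 * pi) (ltW P0) thc; first by rewrite th0; lra.
  have s0' : 0 < s by rewrite -thlt th0 ths; lra.
  have sP' : s < P by rewrite -thlt ths.
  have := Sth s; have := Cth s; rewrite ths mulr_natl cos2pi sin2pi => c1 s1.
  have f1s : f1 (a + s) = 0.
    by move/eqP: s1; rewrite mulf_eq0 invr_eq0 (negPf (rn0 _)) orbF => /eqP.
  have ggs : 0 < gg (a + s).
    by have := r0 (a + s); rewrite -(divfK (rn0 (a + s)) (gg (a + s))) c1 mul1r.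
  have := @abscissa_crit 1 (a + s) (P - s) (expr1n _ _) f1s; rewrite !mul1r.
  have -> : a + s + (P - s) = a + P by ring.
  by rewrite fP; have := am (a + s); lra.
rewrite m1 in thP.
have thP1 : th P = 2 * pi by have := thP 0; rewrite add0r th0 mul1r add0r.
have [|b /andP[b0 bP] thb] := @IVT_cont R th 0 P pi (ltW P0) thc.
  by rewrite th0 thP1; lra.
have b0' : 0 < b by rewrite -thlt th0 thb.
have bP' : b < P by rewrite -thlt thb thP1; lra.
have f1E s : f1 (a + s) = sin (th s) * r (a + s) by rewrite -Sth divfK.
exists a, b, th; split => //; [by rewrite b0'| | |by rewrite th0 thP1 add0r].
- move=> s /andP[s0 sb]; rewrite f1E mulr_gt0//; apply: sin_gt0_pi.
  by rewrite -th0 -thb !thlt s0.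
- move=> s /andP[s0 sb]; rewrite f1E pmulr_llt0//.
  by apply: sin_lt0; rewrite -thP1 -thb !thlt s0.
Qed.

(** The second term of the integrand is the rotation of the hypercycle frame along the curve. By
    Stokes it integrates to minus the enclosed area, so this is the formula int k = 2 pi + area
    before the area is identified. *)
Lemma gauss_bonnet (K : R -> R) :
  (forall x, is_derive x 1 K (k x + f x * gg x / (1 + f x ^+ 2))) ->
  forall x, K (x + P) - K x = 2 * pi.
Proof.
move=> dK; have [a [b [th [_ _ _ dth thP]]]] := abscissa_two_arcs.
have dKa s : is_derive s 1 (fun s => K (a + s)) (k (a + s) + f (a + s) * gg (a + s) / (1 + f (a + s) ^+ 2)).
  exact: der_shiftl.
have e := der_eq_cst dKa dth 0 P; rewrite addr0 thP in e.
have kP s : k (s + P) + f (s + P) * gg (s + P) / (1 + f (s + P) ^+ 2) = k s + f s * gg s / (1 + f s ^+ 2).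
  by rewrite kk_per fP /gg nu_per.
by move=> x; have := der_per_shift dK kP x; have := der_per_shift dK kP a; lra.
Qed.

(* The primitives [p_1 d(arsinh (p_2 / sqrt (1 + p_1^2)))] and
   [(p_1 dp_2 - p_2 dp_1) / (1 + p_3)] of the area form differ by the exact form
   [d atan (p_1 p_2 / (1 + p_1^2 + p_3))]. *)
Lemma gauss_bonnet_polar (K : R -> R) :
  (forall x, is_derive x 1 K (k x + (n x).2 / (1 + (g x).2))) ->
  forall x, K (x + P) - K x = 2 * pi.
Proof.
move=> dK.
pose psi x := atan ((g x).1.1 * (g x).1.2 / (1 + (g x).1.1 ^+ 2 + (g x).2)).
have dpsi x : is_derive x 1 psi
   (eps F * ((n x).2 / (1 + (g x).2) - f x * gg x / (1 + f x ^+ 2))).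
  have [du dv dw] := der_cu F x.
  have w0 := cu_gt0 F x; have := cucu F x; have := cutg F x.
  rewrite /gg /f nuE /ptscale /cross /mink /=.
  move: du dv dw w0.
  set u := (g x).1.1; set v := (g x).1.2; set w := (g x).2.
  set u' := (t x).1.1; set v' := (t x).1.2; set w' := (t x).2.
  move=> du dv dw w0 h1 h2.
  have D0 : 0 < 1 + u ^+ 2 + w by have := sqr_ge0 u; lra.
  have U0 : 0 < 1 + u ^+ 2 by have := sqr_ge0 u; lra.
  have DN : 1 + u ^+ 2 + w != 0 by rewrite gt_eqF.
  have UN : 1 + u ^+ 2 != 0 by rewrite gt_eqF.
  have WN : 1 + w != 0 by rewrite gt_eqF//; lra.
  have dD : is_derive x 1 (fun x => 1 + (g x).1.1 ^+ 2 + (g x).2) (2 * u * u' + w').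
    by dereq; ring.
  have dq := derM (derM du dv) (derV (f := fun x => 1 + (g x).1.1 ^+ 2 + (g x).2) DN dD).
  apply: der_eq (der_atan dq) _; rewrite -/u -/v -/w.
  (* The denominator in the derivative of the arctangent factors on the hyperboloid, which splits
     that derivative into the two fractions of the claim. *)
  have key : (1 + u ^+ 2 + w) ^+ 2 + (u * v) ^+ 2 = (1 + u ^+ 2) * (1 + w) ^+ 2.
    have : v * v = w * w - 1 - u * u by lra.
    move=> vv; rewrite exprMn -(expr2 v) in vv *; rewrite vv; ring.
  have KN : (1 + u ^+ 2 + w) ^+ 2 + (u * v) ^+ 2 != 0.
    by rewrite key mulf_neq0// expf_neq0.
  have e2 := eps2 F.
  transitivity (((u' * v + u * v') * (1 + u ^+ 2 + w) - u * v * (2 * u * u' + w'))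
     / ((1 + u ^+ 2 + w) ^+ 2 + (u * v) ^+ 2)).
    by field; rewrite DN/= KN.
  rewrite key.
  transitivity (eps F * eps F * ((v * u' - u * v') / (1 + w) - u * (v * w' - w * v') / (1 + u ^+ 2))).
    rewrite e2 mul1r.
    have key2 : (u' * v + u * v') * (1 + u ^+ 2 + w) - u * v * (2 * u * u' + w')
      = - u * (v * w' - w * v') * (1 + w) ^+ 2 - (u * v' - v * u') * (1 + u ^+ 2) * (1 + w).
      apply/eqP; rewrite eq_sym -subr_eq0; apply/eqP.
      transitivity (u * v' * (2 + w) * (w * w - 1 - u * u - v * v)
        - u * v * (2 + w) * (w * w' - u * u' - v * v')); first by ring.
      have -> : w * w - 1 - u * u - v * v = 0 by lra.
      have -> : w * w' - u * u' - v * v' = 0 by lra.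
      by ring.
    by rewrite key2; field; rewrite UN WN.
  by field; rewrite UN WN.
have psiP x : psi (x + P) = psi x by rewrite /psi cu_per.
have h := @gauss_bonnet (fun x => K x - eps F * psi x).
move=> x; rewrite -[RHS](h _ x) ?psiP; first by ring.
move=> y; apply: der_eq (derD (dK y) (derN (derM (der_cst (eps F) y) (dpsi y)))) _.
rewrite mulr0 addr0 mulrA eps2; ring.
Qed.

End GaussBonnet.

(** * Derivatives and continuity of vector-valued maps *)

Section PointCalculus.
Variable R : realType.
Implicit Types (f h : R -> pt R) (u v : pt R) (x s : R).

Lemma der_cross f h x u v : der_pt f x u -> der_pt h x v ->
  der_pt (fun y => cross (f y) (h y)) x (ptadd (cross u (h x)) (cross (f x) v)).
Proof.
by move=> [f1 f2 f3] [h1 h2 h3]; split; rewrite /cross/ptadd/=; dereq; ring.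
Qed.

Lemma ptadd_cross_self u v : ptadd (cross u u) v = v.
Proof. by apply: pt_eq; rewrite /cross/ptadd/=; ring. Qed.

Lemma der_ptscale f x u (c : R) : der_pt f x u ->
  der_pt (fun y => ptscale c (f y)) x (ptscale c u).
Proof. by move=> [f1 f2 f3]; split; rewrite /ptscale/=; dereq; ring. Qed.

Lemma der_mink_cst f h x u v c : (forall y, mink (f y) (h y) = c) ->
  der_pt f x u -> der_pt h x v -> mink u (h x) + mink (f x) v = 0.
Proof.
by move=> fh fu hv; apply: der_uniq (der_mink fu hv) _; apply: der_ext (der_cst c x).
Qed.

Lemma der_pt_per f f' T : (forall x, der_pt f x (f' x)) ->
  (forall x, f (x + T) = f x) -> forall x, f' (x + T) = f' x.
Proof.
move=> df fT x; have [a1 a2 a3] := df (x + T); have [b1 b2 b3] := df x.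
by apply: pt_eq; [apply: der_uniq b1|apply: der_uniq b2|apply: der_uniq b3];
  [apply: der_ext (der_shift a1)|apply: der_ext (der_shift a2)|apply: der_ext (der_shift a3)]
  => y; rewrite fT.
Qed.

Definition cont_pt (T : topologicalType) (f : T -> pt R) (z : T) : Prop :=
  [/\ continuous_at z (fun y => (f y).1.1),
  continuous_at z (fun y => (f y).1.2) & continuous_at z (fun y => (f y).2)].

Lemma der_cont_pt f x u : der_pt f x u -> cont_pt f x.
Proof. by move=> [f1 f2 f3]; split; apply: der_cont; eassumption. Qed.

Lemma cont_cross (T : topologicalType) (f h : T -> pt R) (z : T) :
  cont_pt f z -> cont_pt h z -> cont_pt (fun y => cross (f y) (h y)) z.
Proof.
by move=> [f1 f2 f3] [h1 h2 h3]; split; apply: contD; try apply: contN; exact: contM.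
Qed.

Lemma cont_mink (T : topologicalType) (f h : T -> pt R) (z : T) :
  cont_pt f z -> cont_pt h z -> continuous_at z (fun y => mink (f y) (h y)).
Proof.
move=> [f1 f2 f3] [h1 h2 h3]; apply: contD; last by apply: contN; exact: contM.
by apply: contD; exact: contM.
Qed.

Lemma cont_pt_comp (T : topologicalType) (u : T -> R) (f : R -> pt R) (z : T) :
  continuous_at z u -> cont_pt f (u z) -> cont_pt (fun y => f (u y)) z.
Proof.
by move=> uz [f1 f2 f3]; split;
  [exact: (cont_comp (f := fun y => (f y).1.1))
  |exact: (cont_comp (f := fun y => (f y).1.2))
  |exact: (cont_comp (f := fun y => (f y).2))].
Qed.

End PointCalculus.

(** * The Frenet frame of an arclength curve *)

Section FrenetOfCurve.
Variables (R : realType) (gam : R -> pt R) (P km : R).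
Hypothesis gamP : arclength_closed_curve gam P.
Hypothesis km_le : forall x, km <= gcurv gam x.
Hypothesis km1 : 1 < km.
Implicit Types x y : R.

Let P0 : 0 < P. Proof. by case: gamP => -[]. Qed.
Let smo : smooth_curve gam. Proof. by case: gamP => -[]. Qed.

Let der1n (f : R -> R) (m : nat) x : smooth f ->
  is_derive x 1 (derive1n m f) (derive1n m.+1 f x).
Proof.
by move=> sf; split; [exact: sf|rewrite derive1nS derive1E].
Qed.

Let dn m x : der_pt (iter m (@cderiv R) gam) x (iter m.+1 (@cderiv R) gam x).
Proof.
have e i y : iter i (@cderiv R) gam y = (derive1n i (fun y => (gam y).1.1) y,
    derive1n i (fun y => (gam y).1.2) y, derive1n i (fun y => (gam y).2) y).
  elim: i y => [|i IH] y; first by rewrite /derive1n /=; case: (gam y) => [[]].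
  by rewrite iterS (funext IH) /cderiv !derive1nS.
by case: smo => s1 [s2 s3]; rewrite e (funext (e m)); split; exact: der1n.
Qed.

Let d1 x : der_pt gam x (cderiv gam x) := dn 0 x.
Let d2 x : der_pt (cderiv gam) x (cderiv (cderiv gam) x) := dn 1 x.
Let acc := cderiv (cderiv gam).

Let gg x : mink (gam x) (gam x) = -1.
Proof. by case: gamP => _ h _ _ _; case: (h x). Qed.

Let tt x : mink (cderiv gam x) (cderiv gam x) = 1.
Proof. by case: gamP. Qed.

Let gt x : mink (gam x) (cderiv gam x) = 0.
Proof.
by have := der_mink_cst gg (d1 x) (d1 x); rewrite (minkC (cderiv gam x)); lra.
Qed.

Let ta x : mink (cderiv gam x) (acc x) = 0.
Proof.
by have := der_mink_cst tt (d2 x) (d2 x); rewrite -/acc (minkC (acc x)); lra.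
Qed.

Let ga x : mink (gam x) (acc x) = -1.
Proof.
by have := der_mink_cst gt (d1 x) (d2 x); rewrite tt -/acc; lra.
Qed.

Let nu0 x := cross (gam x) (cderiv gam x).
Let ka x := mink (acc x) (nu0 x).

Let accE x : acc x = ptadd (gam x) (ptscale (ka x) (nu0 x)).
Proof.
apply: mink_ext => v.
have := cross_completeness (gam x) (cderiv gam x) (acc x) v.
rewrite gg tt gt (minkC (acc x) (gam x)) ga (minkC (acc x) (cderiv gam x)) ta minkDl minkZl.
rewrite /ka /nu0 (minkC v (gam x)) (minkC v (cross _ _)) expr0n/=; lra.
Qed.

Let gcurvE x : gcurv gam x = `|ka x|.
Proof.
rewrite /gcurv -/acc -sqrtr_sqr; congr Num.sqrt.
have nn : mink (nu0 x) (nu0 x) = 1.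
  by rewrite /nu0 mink_cross gg tt gt; ring.
have -> : ptadd (acc x) (ptscale (-1) (gam x)) = ptscale (ka x) (nu0 x).
  apply: mink_ext => v; rewrite minkDl minkZl accE minkDl; ring.
by rewrite minkZl minkZr nn; ring.
Qed.

Let kac : continuous ka.
Proof.
move=> x; apply: cont_mink; first exact: der_cont_pt (dn 2 x).
by apply: cont_cross; [exact: der_cont_pt (d1 x)|exact: der_cont_pt (d2 x)].
Qed.

Let ka1 x : 1 < `|ka x|.
Proof. by rewrite -gcurvE; exact: lt_le_trans km1 (km_le x). Qed.

(** The signed curvature is continuous with absolute value above 1, so it never vanishes and keeps
    its sign; that sign becomes [eps]. *)
Let ka_sign : exists e : R, e * e = 1 /\ forall x, e * ka x = gcurv gam x.
Proof.
have nz x : ka x <> 0 by move=> e; have := ka1 x; rewrite e normr0 ltr10.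
have cst (c : R) : continuous (fun x => c * ka x).
  by move=> x; apply: contM; [exact: cont_cst|exact: kac].
have same x y : 0 < ka x -> 0 < ka y.
  move=> kx; rewrite ltNge; apply/negP => ky.
  have [xy|yx] := leP x y.
    have [|c _ c0] := @IVT_cont R (fun x => -1 * ka x) x y 0 xy (cst (-1)); first by lra.
    by apply: (nz c); lra.
  have [|c _ c0] := @IVT_cont R ka y x 0 (ltW yx) kac; first by rewrite ky ltW.
  exact: nz c0.
have [k0|k0] := ltP 0 (ka 0).
  exists 1; split; first by ring.
  by move=> x; rewrite mul1r gcurvE gtr0_norm//; exact: same k0.
exists (-1); split; first by ring.
move=> x; rewrite mulN1r gcurvE ler0_norm// leNgt; apply/negP => /(same _ 0).
by rewrite ltNge k0.
Qed.

Let gper x : gam (x + P) = gam x. Proof. by case: gamP. Qed.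

Let tper : forall x, cderiv gam (x + P) = cderiv gam x := der_pt_per d1 gper.
Let aper : forall x, acc (x + P) = acc x := der_pt_per d2 tper.

Let simple x y : x < y -> y < x + P -> gam x = gam y -> False.
Proof.
move=> xy yP e; case: gamP => _ _ _ inj _.
have [i xi] := per_red x P0; have [j yj] := per_red y P0.
have h : x + i%:~R * P = y + j%:~R * P.
  by apply: inj => //; rewrite !(per_int gper).
have h2 : y - x = (i - j)%:~R * P by rewrite intrB; lra.
have m0 : 0 < (i - j)%:~R * P by lra.
have m1 : (i - j)%:~R * P < 1 * P by lra.
move: m0 m1; rewrite pmulr_lgt0// ltr_pM2r// ltr0z -[1]/(1%:~R) ltr_int => m0 m1.
by have := lt_le_trans m1 m0; rewrite ltxx.
Qed.

Lemma frenet_of_curve : exists F : frenet P,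
  [/\ cu F = gam, tg F = cderiv gam & kk F = gcurv gam].
Proof.
have [e [ee eK]] := ka_sign.
pose nuf x := ptscale e (nu0 x).
have dnu x : der_pt nuf x (ptscale (- gcurv gam x) (cderiv gam x)).
  have -> : ptscale (- gcurv gam x) (cderiv gam x)
    = ptscale e (cross (gam x) (acc x)).
    have -> : cross (gam x) (acc x) = ptscale (ka x) (cross (gam x) (nu0 x)).
      by rewrite accE /cross/ptadd/ptscale/=; congr (_, _, _); ring.
    rewrite /nu0 cross_cross gg gt -eK.
    by apply: mink_ext => v; rewrite ?(minkZl, minkDl); ring.
  have -> : cross (gam x) (acc x) = ptadd (cross (cderiv gam x) (cderiv gam x)) (cross (gam x) (acc x)).
    by rewrite ptadd_cross_self.
  by apply: der_ptscale; apply: der_cross; [exact: d1|exact: d2].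
have kc : continuous (gcurv gam).
  move=> x; have -> : gcurv gam = (fun x => e * ka x) by apply/funext => y; rewrite eK.
  by apply: contM; [exact: cont_cst|exact: kac].
have kP x : gcurv gam (x + P) = gcurv gam x.
  by rewrite -!eK /ka /nu0 aper gper tper.
have dt x : der_pt (cderiv gam) x (ptadd (gam x) (ptscale (gcurv gam x) (nuf x))).
  have := d2 x; rewrite -/acc accE.
  congr der_pt; apply: mink_ext => v; rewrite ?(minkZl, minkDl) -eK.
  by transitivity (mink (gam x) v + e * e * ka x * mink (nu0 x) v); [rewrite ee; ring|ring].
have g3 x : 0 < (gam x).2 by case: gamP => _ h _ _ _; case: (h x).
have k1 x : 1 < gcurv gam x by exact: lt_le_trans km1 (km_le x).
by exists (@Frenet R P gam (cderiv gam) nuf (gcurv gam) e P0 d1 dt dnu ee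
  (fun x => erefl) gg tt gt g3 k1 kc gper tper kP simple).
Qed.

End FrenetOfCurve.

(** * Chords and the billiard map *)

Section OpenIntervals.
Variable R : realType.
Implicit Types (f df : R -> R) (a b x y : R).

Lemma der_within f df a b : (forall x, a <= x <= b -> is_derive x 1 f (df x)) ->
  {within `[a, b], continuous f}.
Proof.
move=> fd; apply: derivable_within_continuous => z; rewrite in_itv/= => zab.
by case: (fd z zab).
Qed.

Lemma der_lt_oo f df a b : (forall x, a < x < b -> is_derive x 1 f (df x)) ->
  (forall x, a < x < b -> 0 < df x) ->
  forall x y, a < x -> x < y -> y < b -> f x < f y.
Proof.
move=> fd f0 x y ax xy yb; rewrite -subr_gt0.
have sub z : x <= z <= y -> a < z < b.
  by move=> /andP[xz zy]; rewrite (lt_le_trans ax xz) (le_lt_trans zy yb).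
have [||c] := @MVT R f df x y xy.
- by move=> z; rewrite in_itv/= => /andP[xz zy]; apply/fd/sub; rewrite !ltW.
- by apply: der_within => z /sub; exact: fd.
rewrite in_itv/= => /andP[xc cy] ->.
by rewrite mulr_gt0 ?subr_gt0// f0// sub// !ltW.
Qed.

Lemma cont_pair (T : topologicalType) (u v : T -> R) (z : T) (h : R * R -> R) :
  continuous_at z u -> continuous_at z v -> continuous_at (u z, v z) h ->
  continuous_at z (fun w => h (u w, v w)).
Proof.
move=> uz vz hz; apply: (cont_comp (u := fun w => (u w, v w)) (f := h)) => //.
exact: (cvg_pair uz vz).
Qed.

End OpenIntervals.

Section Chords.
Variables (R : realType) (P : R) (F : frenet P).
Local Notation g := (cu F).
Local Notation t := (tg F).
Local Notation n := (nu F).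
Local Notation k := (kk F).
Local Notation ch := (ch F).
Local Notation cp := (cp F).
Local Notation cq := (cq F).
Implicit Types (x y s : R).
Let P0 : 0 < P := P_gt0 F.

Definition apart x y := g x <> g y.

Lemma apartC x y : apart x y -> apart y x.
Proof. by move=> h e; apply: h. Qed.

Lemma apart_itv x y : x < y < x + P -> apart x y.
Proof. by move=> /andP[xy yP] e; exact: (cu_simple xy yP e). Qed.

Lemma apart_red x y : apart x y -> exists2 s, 0 < s < P & g y = g (x + s).
Proof.
move=> xy; have [i /andP[i0 iP]] := per_red (y - x) P0.
exists (y - x + i%:~R * P); last first.
  have -> : x + (y - x + i%:~R * P) = y + i%:~R * P by ring.
  by rewrite (per_int (cu_per F)).
rewrite iP andbT lt_neqAle i0 andbT; apply/eqP => e; apply: xy.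
have -> : x = y + i%:~R * P by lra.
by rewrite (per_int (cu_per F)).
Qed.

Lemma horo_apart x y : apart x y -> ch x y - 1 < cq x y.
Proof.
move=> /apart_red[s sP e]; have := horo_support F x sP.
by rewrite /ch /cq e.
Qed.

Lemma cq_gt0 x y : apart x y -> 0 < cq x y.
Proof. by move=> /horo_apart; have := ch_ge1 F x y; lra. Qed.

Lemma ch_gt1 x y : apart x y -> 1 < ch x y.
Proof.
move=> xy; have := cpcq F x y; have := cq_gt0 xy; have := ch_ge1 F x y.
rewrite le_eqVlt => /predU1P[<-|//] q0.
by have := exprn_gt0 2 q0; have := sqr_ge0 (cp x y); rewrite expr1n; lra.
Qed.

Definition sh x y := Num.sqrt (ch x y ^+ 2 - 1).

Lemma ch2_gt1 x y : apart x y -> 0 < ch x y ^+ 2 - 1.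
Proof. by move=> /ch_gt1 c1; rewrite subr_gt0 exprn_egt1. Qed.

Lemma sh_gt0 x y : apart x y -> 0 < sh x y.
Proof. by move=> xy; rewrite sqrtr_gt0 ch2_gt1. Qed.

Lemma sh_neq0 x y : apart x y -> sh x y != 0.
Proof. by move=> /sh_gt0; case: ltgtP. Qed.

Lemma sh2 x y : sh x y ^+ 2 = ch x y ^+ 2 - 1.
Proof.
rewrite sqr_sqrtr// -cpcq; apply: addr_ge0; exact: sqr_ge0.
Qed.

Lemma shC x y : sh x y = sh y x.
Proof. by rewrite /sh chC. Qed.

Lemma cpcq_sh x y : cp x y ^+ 2 + cq x y ^+ 2 = sh x y ^+ 2.
Proof. by rewrite cpcq sh2. Qed.

Lemma cos_bound x y : apart x y -> -1 < cp x y / sh x y < 1.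
Proof.
move=> xy; have s0 := sh_gt0 xy.
rewrite ltr_pdivlMr// ltr_pdivrMr// mulN1r mul1r -ltr_norml.
rewrite -(@ltr_pXn2r _ 2) ?nnegrE ?(ltW s0)// real_normK ?num_real//.
by rewrite -cpcq_sh ltrDl exprn_gt0// cq_gt0.
Qed.

Definition Phi x y := acos (cp x y / sh x y).

Lemma cos_Phi x y : apart x y -> cos (Phi x y) = cp x y / sh x y.
Proof.
by move=> /cos_bound/andP[h1 h2]; rewrite acosK// in_itv/= !ltW.
Qed.

Lemma sin_Phi x y : apart x y -> sin (Phi x y) = cq x y / sh x y.
Proof.
move=> xy; have /andP[h1 h2] := cos_bound xy.
rewrite sin_acos ?(ltW h1) ?(ltW h2)//.
have s0 := sh_gt0 xy; have q0 := cq_gt0 xy; have sn := sh_neq0 xy.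
have -> : 1 - (cp x y / sh x y) ^+ 2 = (cq x y / sh x y) ^+ 2.
  apply/eqP; rewrite subr_eq addrC !expr_div_n -mulrDl cpcq_sh divff//.
  by rewrite expf_neq0.
by rewrite sqrtr_sqr gtr0_norm// divr_gt0.
Qed.

Lemma Phi_itv x y : apart x y -> 0 < Phi x y < pi.
Proof.
move=> /cos_bound/andP[h1 h2].
by rewrite acos_gt0 ?h2 ?andbT ?acos_ltpi ?h1 ?andTb// ltW.
Qed.

Lemma Phi_perl x y : Phi (x + P) y = Phi x y.
Proof. by rewrite /Phi /sh /ch /cp cu_per tg_per. Qed.

Lemma Phi_perr x y : Phi x (y + P) = Phi x y.
Proof. by rewrite /Phi /sh /ch /cp cu_per. Qed.

(** The components of [t y] along [t x] and [n x] solve a linear system with coefficients [cp] and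
    [cq]. One equation is the orthogonality of [t y] and [g y] in the frame at [x], the other a
    cross product identity; the determinant is [sh ^+ 2]. *)
Lemma tgtg_chord x y : mink (t y) (t x) * sh x y ^+ 2 =
  - ch x y * cp x y * cp y x - cq x y * cq y x.
Proof.
have e1 := completeness F x (g y) (t y); rewrite cutg in e1.
have e2 := mink_cross (g y) (t y) (t x) (n x).
have e3 : cross (t x) (n x) = ptscale (- eps F) (g x).
  have -> : cross (t x) (n x) = ptscale (eps F) (cross (t x) (cross (g x) (t x))).
    by rewrite nuE /cross/ptscale/=; congr (_, _, _); ring.
  rewrite cross_cross tgtg (minkC (t x)) cutg.
  by apply: mink_ext => v; rewrite ?(minkZl, minkDl); ring.
rewrite e3 minkZr in e2.
have e4 : cq y x = eps F * mink (cross (g y) (t y)) (g x).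
  by rewrite /cq nuE minkZr (minkC (g x)).
rewrite -cpcq_sh.
have {}e1 : cp x y * mink (t y) (t x) + cq x y * mink (t y) (n x) = - ch x y * cp y x.
  by move: e1; rewrite /cp /cq /ch (minkC (g x) (t y)) (minkC (g x) (g y)); lra.
have {}e2 : cp x y * mink (t y) (n x) - cq x y * mink (t y) (t x) = cq y x.
  by rewrite e4 /cp /cq; lra.
transitivity (cp x y * (cp x y * mink (t y) (t x) + cq x y * mink (t y) (n x))
   - cq x y * (cp x y * mink (t y) (n x) - cq x y * mink (t y) (t x))); first by ring.
by rewrite e1 e2; ring.
Qed.

Lemma der_cp x y : is_derive y 1 (cp x) (mink (t y) (t x)).
Proof. by apply: der_minkl; exact: der_cu. Qed.

Lemma der_cq x y : is_derive y 1 (cq x) (mink (t y) (n x)).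
Proof. by apply: der_minkl; exact: der_cu. Qed.

(* Density of the invariant measure [sin phi dphi dx] in the coordinates [(x, y)]. *)
Definition dens x y := cq x y * cq y x / sh x y ^+ 3.

Lemma densC x y : dens x y = dens y x.
Proof. by rewrite /dens shC mulrC (mulrC (cq x y)) mulrC. Qed.

Lemma dens_gt0 x y : apart x y -> 0 < dens x y.
Proof.
move=> xy; rewrite divr_gt0// ?exprn_gt0 ?sh_gt0//.
by rewrite mulr_gt0// cq_gt0//; exact: apartC.
Qed.

Lemma dens_per x y : dens (x + P) y = dens x y.
Proof. by rewrite /dens /sh /ch /cq cu_per nu_per. Qed.

Lemma dens_perr x y : dens x (y + P) = dens x y.
Proof. by rewrite densC dens_per densC. Qed.

(* With l the length of the chord, this is d^2 l / dx^2. *)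
Definition Lxx x y := cq x y / sh x y * (ch x y / sh x y * (cq x y / sh x y) - k x).

Section Along.
Variables (u v : R -> R) (r xi eta : R).
Hypotheses (du : is_derive r 1 u xi) (dv : is_derive r 1 v eta).

Local Notation x := (u r).
Local Notation y := (v r).

Lemma der_ch : is_derive r 1 (fun r => ch (u r) (v r))
  (- (cp x y * xi + cp y x * eta)).
Proof.
apply: der_eq (derN (der_mink (der_pt_comp (der_cu F _) du) (der_pt_comp (der_cu F _) dv))) _.
by rewrite minkZl minkZr /cp (minkC (t x)); ring.
Qed.

(** The cosine of the chord angle is minus the derivative of the chord length in its first end
    point, so its differential consists of second derivatives of the length: [Lxx] and the mixed
    one, [dens]. *)
Lemma der_cos_chord : apart x y ->
  is_derive r 1 (fun r => cp (u r) (v r) / sh (u r) (v r))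
    (- (xi * Lxx x y + eta * dens x y)).
Proof.
move=> a; have sn := sh_neq0 a.
have dsh : is_derive r 1 (fun r => sh (u r) (v r))
    (- ch x y * (cp x y * xi + cp y x * eta) / sh x y).
  have d2 : is_derive r 1 (fun r => ch (u r) (v r) ^+ 2 - 1)
    (- 2 * ch x y * (cp x y * xi + cp y x * eta)).
    by apply: der_eq (derD (derX 2 der_ch) (der_cst _ _)) _; rewrite /=; ring.
  apply: der_eq (@der_sqrt R (fun r => ch (u r) (v r) ^+ 2 - 1) r _ (ch2_gt1 a) d2) _.
  by rewrite -/(sh x y); field.
have dcp : is_derive r 1 (fun r => cp (u r) (v r))
    (eta * mink (t y) (t x) + xi * (- ch x y + k x * cq x y)).
  apply: der_eq (der_mink (der_pt_comp (der_cu F _) dv) (der_pt_comp (der_tg F _) du)) _.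
  by rewrite minkZl minkZr minkDr minkZr /ch /cq (minkC (g x)); ring.
apply: der_eq (derM dcp (derV (f := fun r => sh (u r) (v r)) sn dsh)) _.
have T : mink (t y) (t x) = (- ch x y * cp x y * cp y x
    - cq x y * cq y x) / sh x y ^+ 2.
  by rewrite -tgtg_chord mulfK// expf_neq0.
have N : cp x y ^+ 2 = sh x y ^+ 2 - cq x y ^+ 2.
  by rewrite -cpcq_sh; ring.
by rewrite T /Lxx /dens; field: N.
Qed.

End Along.

Lemma der_Phi x y : apart x y -> is_derive y 1 (Phi x) (cq y x / sh x y ^+ 2).
Proof.
move=> xy; have sn := sh_neq0 xy; have bd := cos_bound xy.
have s0 := sh_gt0 xy; have q0 := cq_gt0 xy.
apply: der_eq (@der_comp R acos (fun y => cp x y / sh x y) y _ _ (is_derive1_acos bd) (der_cos_chord (der_cst x y) (der_id y) xy)) _.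
have -> : Num.sqrt (1 - (cp x y / sh x y) ^+ 2) = cq x y / sh x y.
  rewrite -(sin_Phi xy) sin_acos//.
  by case/andP: bd => h1 h2; rewrite !ltW.
by rewrite mul0r add0r mul1r /dens; field; rewrite sn gt_eqF.
Qed.

Lemma sin_der_Phi x y : apart x y -> sin (Phi x y) * (cq y x / sh x y ^+ 2) = dens x y.
Proof. by move=> xy; rewrite sin_Phi// /dens; field; exact: sh_neq0. Qed.

Lemma Phi_lt x y y' : x < y -> y < y' -> y' < x + P -> Phi x y < Phi x y'.
Proof.
apply: der_lt_oo => z /apart_itv xz; first exact: der_Phi.
by rewrite divr_gt0 ?exprn_gt0 ?sh_gt0 ?cq_gt0//; exact: apartC.
Qed.

(** The sign [c] selects the side of [x]. At length zero the tangential component has derivative 1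
    and the normal one derivative 0, so short chords are nearly tangent. *)
Lemma chord_small x (e c : R) : 0 < e -> c ^+ 2 = 1 ->
  exists2 d, 0 < d & forall h, 0 < h < d ->
  0 < c * cp x (x + c * h) /\ cq x (x + c * h) < e * (c * cp x (x + c * h)).
Proof.
move=> e0 c2; pose A h := mink (t (x + c * h)) (t x).
pose B h := e * A h - c * mink (t (x + c * h)) (n x).
have dl (h : R) : is_derive h 1 (fun h => x + c * h) c by dereq; ring.
have dA (h : R) : is_derive h 1 (fun h => c * cp x (x + c * h)) (A h).
  have d := @der_comp R (cp x) (fun h => x + c * h) h _ _ (der_cp x _) (dl h).
  by dereq; rewrite mulr0 addr0 mulrC -mulrA -expr2 c2 mulr1.
have dB (h : R) : is_derive h 1 (fun h => e * (c * cp x (x + c * h)) - cq x (x + c * h)) (B h).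
  have d := @der_comp R (cq x) (fun h => x + c * h) h _ _ (der_cq x _) (dl h); have d' := dA h.
  by dereq; rewrite /B; ring.
have dt (h : R) := @der_pt_comp R t (fun h => x + c * h) h _ _ (der_tg F _) (dl h).
have Ac : continuous A by move=> h; exact: der_cont (der_minkl (t x) (dt h)).
have nc : continuous (fun h => mink (t (x + c * h)) (n x)).
  by move=> h; exact: der_cont (der_minkl (n x) (dt h)).
have Bc : continuous B by rewrite /B; cont.
have A0 : A 0 = 1 by rewrite /A mulr0 addr0 tgtg.
have B0 : B 0 = e by rewrite /B A0 mulr0 addr0 tgnu; ring.
have [|d1 d10 h1] := pos_near Ac (x := 0); first by rewrite A0.
have [|d2 d20 h2] := pos_near Bc (x := 0); first by rewrite B0.
exists (Num.min d1 d2) => [|h]; rewrite lt_min ?d10// => /andP[h0 /andP[hd1 hd2]].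
have near c1 d : 0 < c1 < h -> h < d -> `|c1 - 0| < d.
  by move=> /andP[k1 k2] k3; rewrite subr0 gtr0_norm// (lt_trans k2).
have [c1 c1h e1] := MVT_der h0 dA; have [c2' c2h e2] := MVT_der h0 dB.
move: e1 e2; rewrite mulr0 addr0 cpxx cqxx !mulr0 !subr0 => e1 e2.
have m1 := mulr_gt0 (h1 _ (near _ _ c1h hd1)) h0.
have m2 := mulr_gt0 (h2 _ (near _ _ c2h hd2)) h0.
by split; lra.
Qed.

Lemma cos_near1 (p q s e : R) : 0 < e -> 0 < p -> 0 < q -> 0 < s ->
  p ^+ 2 + q ^+ 2 = s ^+ 2 -> q < e * p -> 1 - e < p / s.
Proof.
move=> e0 p0 q0 s0 pqs qp; rewrite ltr_pdivlMr//.
have sle : s < (1 + e) * p.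
  rewrite -(@ltr_pXn2r _ 2)// ?nnegrE ?(ltW s0)//; last by rewrite mulr_ge0//; lra.
  have : (p + q) ^+ 2 < ((1 + e) * p) ^+ 2 by rewrite ltr_pXn2r// ?nnegrE; lra.
  by rewrite -pqs; have := mulr_gt0 p0 q0; rewrite sqrrD mulr2n; lra.
have [e1|e1] := leP 1 e.
  by apply: le_lt_trans p0; rewrite mulr_le0_ge0//; lra.
have : (1 - e) * s < (1 - e) * ((1 + e) * p) by rewrite ltr_pM2l//; lra.
by have := mulr_gt0 (exprn_gt0 2 e0) p0; rewrite expr2; lra.
Qed.

(** The angle is below [eta] just after [x] ([c = 1]) and above [pi - eta] just before [x + P]
    ([c = -1]). These are the end values for the intermediate value theorem in [hit_ex]; [d < P / 2]
    keeps the two parameters in order. *)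
Lemma Phi_end x (eta c : R) : 0 < eta < pi -> c ^+ 2 = 1 -> exists2 d, 0 < d < P / 2 &
  cos eta < c * cos (Phi x (x + c * d)).
Proof.
move=> /andP[eta0 etap] c2; have Pp := P0.
have ce : cos eta < 1.
  by rewrite -(cos0 R) ltr_cos// ?in_itv/= ?lexx ?pi_ge0// ?(ltW eta0) ?(ltW etap).
have [|d d0 hd] := @chord_small x (1 - cos eta) c _ c2; first lra.
have [||h [h0 hd2 hP]] := @pos_lower_bound R (d / 2) (P / 4); [lra|lra|exists h; first lra].
have [|p0 qp] := hd h; first lra.
have a : apart x (x + c * h).
  by move=> e; move: p0; rewrite /cp -e cutg mulr0 ltxx.
have pq : (c * cp x (x + c * h)) ^+ 2 + cq x (x + c * h) ^+ 2 = sh x (x + c * h) ^+ 2.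
  by rewrite exprMn c2 mul1r cpcq_sh.
have e0 : 0 < 1 - cos eta by lra.
have := cos_near1 e0 p0 (cq_gt0 a) (sh_gt0 a) pq qp.
by rewrite subKr cos_Phi// mulrA.
Qed.

Lemma hit_ex x (phi : R) : 0 < phi < pi ->
  exists s, 0 < s < P /\ Phi x (x + s) = phi.
Proof.
move=> pp; have [|d1 d1P h1] := @Phi_end x phi 1 pp; first by rewrite expr1n.
have [||d2 d2P h2] := @Phi_end x (pi - phi) (-1); first lra; first by rewrite sqrrN expr1n.
have le : x + d1 <= x + P - d2 by lra.
have a1 : apart x (x + d1) by apply: apart_itv; lra.
have a2 : apart x (x + P - d2) by apply: apart_itv; lra.
have i1 := Phi_itv a1; have i2 := Phi_itv a2.
have l1 : Phi x (x + d1) < phi.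
  by move: h1; rewrite !mul1r ltr_cos// in_itv/= ?(andP pp) ?ltW//; lra.
have l2 : phi < Phi x (x + P - d2).
  move: h2; rewrite cosB cospi sinpi !mulN1r -Phi_perr (addrAC x) => h2.
  by rewrite -ltr_cos ?in_itv/=; lra.
have [||c] := @IVT R (Phi x) (x + d1) (x + P - d2) phi le.
- apply: (@der_within _ _ (fun y => cq y x / sh x y ^+ 2)) => z zb.
  by apply: der_Phi; apply: apart_itv; lra.
- by rewrite ge_min le_max (ltW l1) (ltW l2) orbT.
rewrite in_itv/= => cb ce; exists (c - x); split; first lra.
by rewrite addrC subrK.
Qed.

(** The next bounce, lifted to the interval from [x] to [x + P], so that it depends continuously on
    [x]. By [hit_ex] the default 0 never occurs for angles in the open interval from 0 to pi. *)
Definition hit x phi := x + xget 0 [set s | 0 < s < P /\ Phi x (x + s) = phi].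

Lemma hitP x phi : 0 < phi < pi -> x < hit x phi < x + P /\ Phi x (hit x phi) = phi.
Proof.
move=> /(hit_ex x)[s sP]; rewrite /hit.
case: xgetP => [z -> [zP ze]|/(_ s)]; last by case.
by split => //; rewrite ltrDl ltrD2l.
Qed.

Lemma apart_hit x phi : 0 < phi < pi -> apart x (hit x phi).
Proof. by move=> /(hitP x)[h _]; exact: apart_itv. Qed.

Lemma hit_uniq x y phi : x < y < x + P -> Phi x y = phi -> hit x phi = y.
Proof.
move=> /andP[xy yP] e.
have ip : 0 < phi < pi by rewrite -e; apply/Phi_itv/apart_itv/andP.
have [/andP[h1 h2] h3] := hitP x ip.
case: (ltgtP (hit x phi) y) => // h.
  by have := Phi_lt h1 h yP; rewrite h3 e ltxx.
by have := Phi_lt xy h h2; rewrite h3 e ltxx.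
Qed.

Lemma hit_per x phi : 0 < phi < pi -> hit (x + P) phi = hit x phi + P.
Proof.
move=> ip; have [/andP[h1 h2] h3] := hitP x ip.
by apply: hit_uniq; rewrite ?Phi_perl ?Phi_perr// !ltrD2r h1.
Qed.

Lemma cont_cu (T : topologicalType) (u : T -> R) (z : T) :
  continuous_at z u -> cont_pt (fun w => g (u w)) z.
Proof. by move=> uz; apply: cont_pt_comp => //; exact: der_cont_pt (der_cu F _). Qed.

Lemma cont_tg (T : topologicalType) (u : T -> R) (z : T) :
  continuous_at z u -> cont_pt (fun w => t (u w)) z.
Proof. by move=> uz; apply: cont_pt_comp => //; exact: der_cont_pt (der_tg F _). Qed.

Lemma cont_nu (T : topologicalType) (u : T -> R) (z : T) :
  continuous_at z u -> cont_pt (fun w => n (u w)) z.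
Proof. by move=> uz; apply: cont_pt_comp => //; exact: der_cont_pt (der_nu F _). Qed.

Lemma cont_ch (T : topologicalType) (u v : T -> R) (z : T) :
  continuous_at z u -> continuous_at z v ->
  continuous_at z (fun w => ch (u w) (v w)).
Proof. by move=> uz vz; apply: contN; apply: cont_mink; exact: cont_cu. Qed.

Lemma cont_cp (T : topologicalType) (u v : T -> R) (z : T) :
  continuous_at z u -> continuous_at z v ->
  continuous_at z (fun w => cp (u w) (v w)).
Proof. by move=> uz vz; apply: cont_mink; [exact: cont_cu|exact: cont_tg]. Qed.

Lemma cont_cq (T : topologicalType) (u v : T -> R) (z : T) :
  continuous_at z u -> continuous_at z v ->
  continuous_at z (fun w => cq (u w) (v w)).
Proof. by move=> uz vz; apply: cont_mink; [exact: cont_cu|exact: cont_nu]. Qed.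

Lemma cont_sh (T : topologicalType) (u v : T -> R) (z : T) :
  continuous_at z u -> continuous_at z v ->
  continuous_at z (fun w => sh (u w) (v w)).
Proof.
move=> uz vz; have c := cont_ch uz vz; rewrite /sh; cont.
Qed.

Lemma cont_dens (T : topologicalType) (u v : T -> R) (z : T) :
  continuous_at z u -> continuous_at z v -> apart (u z) (v z) ->
  continuous_at z (fun w => dens (u w) (v w)).
Proof.
move=> uz vz a; have c := cont_sh uz vz; have sn : sh (u z) (v z) != 0 by exact: sh_neq0.
apply: contM; first by apply: contM; exact: cont_cq.
by apply: contV; [rewrite expf_neq0|apply: contM => //; exact: contM].
Qed.

Lemma cont_Phi (T : topologicalType) (u v : T -> R) (z : T) :
  continuous_at z u -> continuous_at z v -> apart (u z) (v z) ->
  continuous_at z (fun w => Phi (u w) (v w)).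
Proof.
move=> uz vz a.
apply: (cont_comp (u := fun w => cp (u w) (v w) / sh (u w) (v w)) (f := acos)).
  apply: contM; first exact: cont_cp.
  by apply: contV; [exact: sh_neq0|exact: cont_sh].
by apply: continuous_acos; exact: cos_bound.
Qed.

(** The angle towards a fixed end point is continuous, so the strict inequalities at [y0 - d] and
    [y0 + d] persist for nearby base points and angles; monotonicity of [Phi] then traps [hit]
    between the two. *)
Lemma cont_hit (z : R * R) : 0 < z.2 < pi ->
  continuous_at z (fun w => hit w.1 w.2).
Proof.
move=> zp; have [/andP[h1 h2] h3] := hitP z.1 zp.
set y0 := hit z.1 z.2 in h1 h2 h3.
apply/cvgrPdist_lt => e e0.
(* Half the distances to [z.1] and [z.1 + P]: both test points then stay within one period of every
   nearby base point. *)
have [||d' [d'0 d1 d2]] := @pos_lower_bound R ((y0 - z.1) / 2) ((z.1 + P - y0) / 2); [lra|lra|].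
have [||d [d0 de dd]] := @pos_lower_bound R (e / 2) d'; [lra|lra|].
have dif (c : R) : z.1 < c < z.1 + P ->
   continuous_at z (fun y : R * R => Phi y.1 c - y.2).
  move=> cz; apply: contD; last by apply: contN; exact: cont_snd.
  by apply: cont_Phi; [exact: cont_fst|exact: cont_cst|exact: apart_itv].
have lo : Phi z.1 (y0 - d) - z.2 < 0.
  by rewrite subr_lt0 -h3; apply: Phi_lt; lra.
have hi : 0 < Phi z.1 (y0 + d) - z.2.
  by rewrite subr_gt0 -h3; apply: Phi_lt; lra.
have cl : z.1 < y0 - d < z.1 + P by lra.
have cu' : z.1 < y0 + d < z.1 + P by lra.
near=> y.
have yp : 0 < y.2 < pi.
  by apply/andP; split; near: y; [apply: (cvgr_gt _ (cont_snd (z := z)))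
    |apply: (cvgr_lt _ (cont_snd (z := z)))]; case/andP: zp.
have y1 : y.1 < y0 - d by near: y; apply: (cvgr_lt _ (cont_fst (z := z))); lra.
have y2 : y0 + d - P < y.1 by near: y; apply: (cvgr_gt _ (cont_fst (z := z))); lra.
have lo' : Phi y.1 (y0 - d) - y.2 < 0 by near: y; exact: (cvgr_lt _ (dif _ cl)).
have hi' : 0 < Phi y.1 (y0 + d) - y.2 by near: y; exact: (cvgr_gt _ (dif _ cu')).
have [/andP[k1 k2] k3] := hitP y.1 yp.
have lo'0 : Phi y.1 (y0 - d) < y.2 by rewrite -subr_lt0.
have hi'0 : y.2 < Phi y.1 (y0 + d) by rewrite -subr_gt0.
have b1 : y0 - d < hit y.1 y.2.
  rewrite ltNge; apply/negP; rewrite le_eqVlt => /predU1P[e1|e1].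
    by move: lo'; rewrite -e1 k3 subrr ltxx.
  have : y0 - d < y.1 + P by move: (y2) (d0); clear; lra.
  by move=> /(Phi_lt k1 e1); rewrite k3 => /lt_trans /(_ lo'0); rewrite ltxx.
have b2 : hit y.1 y.2 < y0 + d.
  rewrite ltNge; apply/negP; rewrite le_eqVlt => /predU1P[e1|e1].
    by move: hi'; rewrite e1 k3 subrr ltxx.
  have : y.1 < y0 + d by move: (y1) (d0); clear; lra.
  by move=> /Phi_lt /(_ e1 k2); rewrite k3 => /lt_trans /(_ hi'0); rewrite ltxx.
rewrite -/y0 ltr_norml; move: (b1) (b2) (de) (e0); clear; lra.
Unshelve. all: by end_near. Qed.

End Chords.

(** * Integration *)

Section Integration.
Variable R : realType.
Notation mu := (@lebesgue_measure R).
Implicit Types (a b x y : R).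

(** An open set is the countable union of the rational boxes it contains; [C] is such a box, or
    empty when the box is not contained in [U]. *)
Lemma open_measurable2 (U : set (R * R)) : open U -> measurable U.
Proof.
move=> oU.
pose B (p q r s : rat) : set (R * R) :=
  [set z | ratr p < z.1 < ratr q /\ ratr r < z.2 < ratr s].
pose C (p q r s : rat) : set (R * R) := if `[< B p q r s `<=` U >] then B p q r s else set0.
have mC p q r s : measurable (C p q r s).
  rewrite /C; case: ifP => // _.
  have -> : B p q r s = `]ratr p, ratr q[%classic `*` `]ratr r, ratr s[%classic.
    by apply/seteqP; split => z; rewrite /B /= !in_itv/=.
  by apply: measurableX.
suff -> : U = \bigcup_p \bigcup_q \bigcup_r \bigcup_s C p q r s.
  by do 4 (apply: bigcupT_measurable_rat => ?).
apply/seteqP; split => z; last first.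
  case=> p _ [q _] [r _] [s _]; rewrite /C.
  by case: ifPn => // /asboolP; apply.
move=> Uz; have := oU z Uz.
case=> -[V W] /= [/nbhs_ballP[e1 /= e10 b1] /nbhs_ballP[e2 /= e20 b2] VW].
have [|p] := @rat_in_itvoo R (z.1 - e1) z.1; first lra.
have [|q] := @rat_in_itvoo R z.1 (z.1 + e1); first lra.
have [|r] := @rat_in_itvoo R (z.2 - e2) z.2; first lra.
have [|s] := @rat_in_itvoo R z.2 (z.2 + e2); first lra.
rewrite !in_itv/= => /andP[s1 s2] /andP[r1 r2] /andP[q1 q2] /andP[p1 p2].
exists p => //; exists q => //; exists r => //; exists s => //.
rewrite /C; case: ifPn => [_|/asboolP]; first by split; apply/andP.
case=> -[u v] [/= /andP[u1 u2] /andP[v1 v2]]; apply: VW; split => /=.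
  apply: b1; rewrite /ball/= ltr_norml; apply/andP; split; lra.
apply: b2; rewrite /ball/= ltr_norml; apply/andP; split; lra.
Qed.

Lemma continuous_measurable2 (U : set (R * R)) (f : R * R -> R) : open U ->
  (forall z, U z -> continuous_at z f) -> measurable_fun U f.
Proof.
move=> oU fc; have mU := open_measurable2 oU.
apply: (measurability _ (measurable_realfun.RGenOInfty.measurableE R)) => _ [_ [x ->] <-].
apply: open_measurable2.
rewrite openE => z [Uz]; rewrite /= in_itv/= andbT => fz.
have h2 := oU z Uz.
have h1 : \forall t \near z, x < f t by exact: (cvgr_gt _ (fc z Uz) _ fz).
 near=> y; split; first by near: y.
by rewrite /= in_itv/= andbT; near: y.
Unshelve. all: by end_near. Qed.

Lemma open_strip a b : open [set z : R * R | a < z.2 < b].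
Proof.
have -> : [set z : R * R | a < z.2 < b] = snd @^-1` `]a, b[%classic.
  by apply/seteqP; split => z; rewrite /= in_itv.
by apply: open_comp; [move=> z _; exact: cvg_snd|exact: interval_open].
Qed.

Lemma fubini_prod (D1 D2 : set R) (h : R -> R -> R) :
  measurable D1 -> measurable D2 ->
  measurable_fun (D1 `*` D2) (fun z : R * R => h z.1 z.2) ->
  (forall x y, D1 x -> D2 y -> 0 <= h x y) ->
  (\int[(mu \x mu)%E]_(z in D1 `*` D2) (h z.1 z.2)%:E =
     \int[mu]_(x in D1) \int[mu]_(y in D2) (h x y)%:E)%E /\
  (\int[(mu \x mu)%E]_(z in D1 `*` D2) (h z.1 z.2)%:E =
     \int[mu]_(y in D2) \int[mu]_(x in D1) (h x y)%:E)%E.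
Proof.
move=> m1 m2 mh h0; have mD : measurable (D1 `*` D2) by exact: measurableX.
pose f : R * R -> \bar R := (fun z : R * R => (h z.1 z.2)%:E) \_ (D1 `*` D2).
have mf : measurable_fun setT f by apply/(measurable_restrictT _ mD)/measurable_EFinP.
have f0 z : (0 <= f z)%E.
  by rewrite /f patchE; case: ifPn => // /set_mem[? ?]; rewrite lee_fin h0.
have fE x y : f (x, y) = if (x \in D1) && (y \in D2) then (h x y)%:E else 0%E.
  by rewrite /f patchE in_setX.
rewrite integral_mkcond -/f; split.
  rewrite (@fubini_tonelli1 _ _ _ _ R (@lebesgue_measure R) (@lebesgue_measure R) f mf f0) [RHS]integral_mkcond; apply: eq_integral => x _.
  rewrite patchE /fubini_F; case: ifPn => xD; last first.
    by rewrite integral0_eq// => y _; rewrite fE (negPf xD).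
  by rewrite [RHS]integral_mkcond; apply: eq_integral => y _; rewrite fE xD patchE.
rewrite (@fubini_tonelli2 _ _ _ _ R (@lebesgue_measure R) (@lebesgue_measure R) f mf f0) [RHS]integral_mkcond; apply: eq_integral => y _.
rewrite patchE /fubini_G; case: ifPn => yD; last first.
  by rewrite integral0_eq// => x _; rewrite fE (negPf yD) andbF.
by rewrite [RHS]integral_mkcond; apply: eq_integral => x _; rewrite fE yD andbT patchE.
Qed.

Lemma strip_fubini (h : R -> R -> R) (c b : R) :
  (forall x s, 0 < s < b -> continuous_at (x, s) (fun z : R * R => h z.1 z.2)) ->
  (forall x s, 0 < s < b -> 0 <= h x s) ->
  (\int[(mu \x mu)%E]_(z in `[0%R, c[ `*` `]0%R, b[) (h z.1 z.2)%:E =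
     \int[mu]_(x in `[0%R, c[) \int[mu]_(s in `]0%R, b[) (h x s)%:E)%E /\
  (\int[(mu \x mu)%E]_(z in `[0%R, c[ `*` `]0%R, b[) (h z.1 z.2)%:E =
     \int[mu]_(s in `]0%R, b[) \int[mu]_(x in `[0%R, c[) (h x s)%:E)%E.
Proof.
move=> hc h0; apply: fubini_prod => //; last first.
  by move=> x s _; rewrite /= in_itv/=; exact: h0.
apply: (@measurable_funS _ _ _ _ [set z : R * R | 0 < z.2 < b]).
- by apply: open_measurable2; exact: open_strip.
- by move=> z [_]; rewrite /= in_itv.
- by apply: continuous_measurable2 => [|[x s] /= sb]; [exact: open_strip|exact: hc].
Qed.

Lemma FTC_der (f F : R -> R) a b (l r : bool) : a < b -> continuous f ->
  (forall x, is_derive x 1 F (f x)) ->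
  (\int[mu]_(x in [set` Interval (BSide l a) (BSide r b)]) (f x)%:E = (F b - F a)%:E)%E.
Proof.
move=> ab fc dF; rewrite integral_itv_bndoo; last first.
  by apply/measurable_EFinP; apply: measurable_funTS; exact: continuous_measurable_fun.
rewrite -(@integral_itv_bndoo _ a b _ true false); last first.
  by apply/measurable_EFinP; apply: measurable_funTS; exact: continuous_measurable_fun.
rewrite (@continuous_FTC2 _ f F a b ab) ?EFinB//.
- exact: cont_within.
- have Fc := der_contT dF; split.
  + by move=> x _; case: (dF x).
  + by apply: cvg_at_right_filter; exact: Fc.
  + by apply: cvg_at_left_filter; exact: Fc.
- by move=> x _; rewrite derive1E; case: (dF x).
Qed.

Lemma integral_periodic_shift (f : R -> R) P s : 0 < P -> continuous f ->
  (forall x, f (x + P) = f x) ->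
  (\int[mu]_(x in `[0%R, P[) (f (x + s))%:E = \int[mu]_(x in `[0%R, P[) (f x)%:E)%E.
Proof.
move=> P0 fc fP; have [F dF] := primitive fc.
have fsc : continuous (fun x => f (x + s)).
  by cont.
rewrite (FTC_der _ _ P0 fc dF) (FTC_der _ _ P0 fsc (fun x => der_shift (dF _))).
by rewrite add0r (addrC P) (der_per_shift dF fP).
Qed.

End Integration.

(** * Change of variables on open intervals *)

Section Substitution.
Variable R : realType.
Notation mu := (@lebesgue_measure R).
Implicit Types (a b c d x y : R).

(** The integral of a nonnegative function is a supremum over the simple functions below it, so
    monotonicity holds for arbitrary sets, in particular for the complement of the m-set and for the
    enclosed region. *)
Lemma integral_mono_set (d : measure_display) (T : measurableType d)
  (m : {measure set T -> \bar R}) (D1 D2 : set T) (f : T -> \bar R) :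
  (forall t, D2 t -> (0 <= f t)%E) -> D1 `<=` D2 ->
  (\int[m]_(t in D1) f t <= \int[m]_(t in D2) f t)%E.
Proof.
move=> f0 D12; rewrite !ge0_integralE//; last by move=> x /D12; exact: f0.
apply: le_ereal_sup => _ /= [h hf <-]; exists h => // x.
apply: le_trans (hf x) _; rewrite !patchE.
case: ifPn => [/set_mem/D12 D2x|_]; first by rewrite mem_set.
by case: ifPn => // /set_mem; exact: f0.
Qed.

Lemma open_exhaustion a b : a < b -> exists u v : nat -> R,
  [/\ (forall i, a < u i), (forall i, v i < b), (forall i, u i <= v i),
      (forall i j, (i <= j)%N -> u j <= u i /\ v i <= v j) &
      (forall x, a < x < b -> exists i, u i <= x <= v i)].
Proof.
move=> ab; pose e (i : nat) := (b - a) / 2 / i.+1%:R.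
have e0 i : 0 < e i by rewrite divr_gt0// ?ltr0n//; lra.
have ei i j : (i <= j)%N -> e j <= e i.
  move=> ij; rewrite ler_pM2l; last lra.
  by rewrite lef_pV2 ?posrE ?ltr0n// ler_nat.
have e1 i : e i <= (b - a) / 2.
  by rewrite /e ler_pdivrMr ?ltr0n// ler_peMr ?ler1n//; lra.
exists (fun i => a + e i), (fun i => b - e i); split.
- by move=> i; have := e0 i; lra.
- by move=> i; have := e0 i; lra.
- by move=> i; have := e1 i; lra.
- by move=> i j /ei; lra.
move=> x /andP[ax xb].
have [||m [m0 m1 m2]] := @pos_lower_bound R (x - a) (b - x); [lra|lra|].
have [i hi] : exists i : nat, (b - a) / 2 / m < i%:R.
  exists (Num.truncn ((b - a) / 2 / m)).+1.
  by have /andP[_] := truncn_itv (ltW (divr_gt0 (ltac:(lra) : 0 < (b - a) / 2) m0)).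
exists i.
have em : e i <= m.
  rewrite /e ler_pdivrMr ?ltr0n//; move: hi; rewrite ltr_pdivrMr// -natr1 => hi.
  have -> : m * i.+1%:R = i%:R * m + m by rewrite -natr1; ring.
  by move: (hi) (m0); lra.
by apply/andP; split; lra.
Qed.

(** Reduces an integrand that is controlled only inside the interval to compact subintervals, where
    substitution applies. *)
Lemma integral_oo_sup (f : R -> R) a b : a < b ->
  (forall x, a < x < b -> continuous_at x f) -> (forall x, a < x < b -> 0 <= f x) ->
  (\int[mu]_(x in `]a, b[) (f x)%:E =
   ereal_sup [set I | exists u v : R,
     [/\ (a < u)%R, (u <= v)%R, (v < b)%R & I = \int[mu]_(x in `[u, v]) (f x)%:E]])%E.
Proof.
move=> ab fc f0; have [u [v [ua vb uv mono exh]]] := open_exhaustion ab.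
apply/eqP; rewrite eq_le; apply/andP; split; last first.
  apply: ge_ereal_sup => _ [p [q [ap pq qb ->]]]; apply: integral_mono_set.
    by move=> x; rewrite /= in_itv/= => xab; rewrite lee_fin f0.
  by move=> x; rewrite /= !in_itv/= => /andP[h1 h2]; rewrite (lt_le_trans ap) ?(le_lt_trans h2).
have sub i : `[u i, v i] `<=` `]a, b[.
  by move=> x; rewrite /= !in_itv/= => /andP[h1 h2]; rewrite (lt_le_trans (ua i)) ?(le_lt_trans h2).
have SE : `]a, b[%classic = \bigcup_i `[u i, v i]%classic.
  apply/seteqP; split => x; last by case=> i _; exact: sub.
  by rewrite /= in_itv/= => /exh[i xi]; exists i => //=; rewrite in_itv.
rewrite SE.
have mf : measurable_fun `]a, b[ f.
  apply: open_continuous_measurable_fun; first exact: interval_open.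
  by move=> y; rewrite inE/= in_itv/= => /fc.
have C : (\int[mu]_(x in `[u i, v i]) (f x)%:E)%E @[i --> \oo] -->
    (\int[mu]_(x in \bigcup_i `[u i, v i]%classic) (f x)%:E)%E.
  apply: ge0_nondecreasing_set_cvg_integral => //.
  - move=> i j ij; apply/subsetPset => x; rewrite /= !in_itv/= => /andP[h1 h2].
    by have [m1 m2] := mono _ _ ij; rewrite (le_trans m1 h1) (le_trans h2 m2).
  - by move=> i; apply/measurable_EFinP; apply: measurable_funS (sub i) mf.
  - by move=> i x /sub; rewrite /= in_itv/= => /f0; rewrite lee_fin.
rewrite -(cvg_lim (@ereal_hausdorff R) C); apply: lime_le; first exact: cvgP C.
by apply: nearW => i; apply: ereal_sup_ubound; exists (u i), (v i).
Qed.

(** [Ph] carries the compact subintervals of one open interval onto those of the other, so the two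
    suprema of [integral_oo_sup] range over the same values. The chord angle needs this form because
    its derivative is available only strictly between [x] and [x + P]. *)
Lemma subst_oo (Ph dPh G : R -> R) a b c d : a < b -> c < d ->
  (forall s, a < s < b -> is_derive s 1 Ph (dPh s)) ->
  (forall s, a < s < b -> 0 < dPh s) ->
  (forall s, a < s < b -> continuous_at s dPh) ->
  (forall s, a < s < b -> c < Ph s < d) ->
  (forall y, c < y < d -> exists2 s, a < s < b & Ph s = y) ->
  (forall y, c < y < d -> continuous_at y G) ->
  (forall y, c < y < d -> 0 <= G y) ->
  (\int[mu]_(y in `]c, d[) (G y)%:E = \int[mu]_(s in `]a, b[) (G (Ph s) * dPh s)%:E)%E.
Proof.
move=> ab cd dP dP0 dPc Pcd Psur Gc G0.
have Plt := der_lt_oo dP dP0.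
have Ple x y : a < x -> x <= y -> y < b -> Ph x <= Ph y.
  by move=> ax; rewrite le_eqVlt => /predU1P[->//|xy yb]; apply/ltW/Plt.
have D1 s : a < s < b -> derive1 Ph s = dPh s.
  by move=> /dP[_ <-]; rewrite derive1E.
have nearab s : a < s < b -> \forall z \near s, a < z < b.
  move=> /andP[as_ sb]; near=> z; apply/andP; split; near: z; [exact: lt_nbhsr|exact: lt_nbhsl].
have D2 s : a < s < b -> continuous_at s (derive1 Ph).
  move=> sab; rewrite /continuous_at D1//.
  apply: cvg_trans (dPc _ sab); apply: near_eq_cvg.
  by near=> z; rewrite D1//; near: z; exact: nearab.
have E u v : a < u -> u <= v -> v < b -> (\int[mu]_(y in `[Ph u, Ph v]) (G y)%:E =
    \int[mu]_(s in `[u, v]) (G (Ph s) * dPh s)%:E)%E.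
  move=> au uv vb; have uab : a < u < b by rewrite au (le_lt_trans uv).
  have vab : a < v < b by rewrite vb (lt_le_trans au).
  have inab s : u <= s <= v -> a < s < b.
    by move=> /andP[h1 h2]; rewrite (lt_le_trans au h1) (le_lt_trans h2 vb).
  rewrite (@integration_by_substitution_increasing R Ph G u v uv).
  - apply: eq_integral => s /set_mem/=; rewrite in_itv/= => /inab sab.
    by rewrite /GRing.mul/= D1.
  - move=> x y; rewrite !in_itv/= => /andP[x1 x2] /andP[y1 y2] xy.
    by apply: Plt => //; [exact: lt_le_trans x1|exact: le_lt_trans y2 _].
  - by move=> s; rewrite in_itv/= => /andP[s1 s2]; apply/D2/inab; rewrite !ltW.
  - by apply: cvgP; apply: cvg_at_right_filter; exact: D2.
  - by apply: cvgP; apply: cvg_at_left_filter; exact: D2.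
  - split.
    + move=> s; rewrite in_itv/= => /andP[s1 s2].
      by have [] := dP s _; first by apply: inab; rewrite !ltW.
    + by apply: cvg_at_right_filter; exact: (der_cont (dP _ uab)).
    + by apply: cvg_at_left_filter; exact: (der_cont (dP _ vab)).
  - apply: continuous_in_subspaceT => y; rewrite inE/= in_itv/= => /andP[h1 h2].
    apply: Gc; have /andP[k1 _] := Pcd _ uab; have /andP[_ k2] := Pcd _ vab.
    by rewrite (lt_le_trans k1 h1) (le_lt_trans h2 k2).
rewrite (integral_oo_sup cd Gc G0) (@integral_oo_sup (fun s => G (Ph s) * dPh s) a b ab).
- congr ereal_sup; apply/seteqP; split => I [u [v [h1 h2 h3 ->]]].
    have [|u' /andP[a1 a2] eu] := Psur u; first by rewrite h1 (le_lt_trans h2).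
    have [|v' /andP[b1 b2] ev] := Psur v; first by rewrite h3 (lt_le_trans h1).
    have uv' : u' <= v'.
      by rewrite leNgt; apply/negP => /(Plt _ _ b1)/(_ a2); rewrite eu ev ltNge h2.
    by exists u', v'; rewrite -E// eu ev.
  have /andP[a1 _] : c < Ph u < d by apply: Pcd; rewrite h1 (le_lt_trans h2).
  have /andP[_ b2] : c < Ph v < d by apply: Pcd; rewrite h3 (lt_le_trans h1).
  by exists (Ph u), (Ph v); rewrite E// Ple.
- move=> s sab; apply: contM; last exact: dPc.
  by apply: cont_comp; [exact: der_cont (dP s sab)|apply: Gc; exact: Pcd].
- by move=> s sab; rewrite mulr_ge0 ?(ltW (dP0 s sab))//; apply: G0; exact: Pcd.
Unshelve. all: by end_near. Qed.

Lemma refl_oo (G : R -> R) b : 0 < b ->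
  (forall y, 0 < y < b -> continuous_at y G) ->
  (forall y, 0 < y < b -> 0 <= G y) ->
  (\int[mu]_(y in `]0%R, b[) (G (b - y))%:E = \int[mu]_(y in `]0%R, b[) (G y)%:E)%E.
Proof.
move=> b0 Gc G0.
have dB (x : R) : is_derive x 1 (fun y => b - y) (-1 : R) by dereq; ring.
have Dopp : derive1 (fun y => b - y) = cst (-1 : R).
  by apply/funext => z; rewrite derive1E; case: (dB z).
have E u v : 0 < u -> u <= v -> v < b -> (\int[mu]_(y in `[u, v]) (G (b - y))%:E =
    \int[mu]_(y in `[(b - v)%R, (b - u)%R]) (G y)%:E)%E.
  move=> u0 uv vb; rewrite (@integration_by_substitution_decreasing R (fun y => b - y) G u v uv).
  - apply: eq_integral => s _; rewrite Dopp /GRing.mul/= /GRing.opp/=.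
    by congr EFin; rewrite opprK mulr1.
  - by move=> x y _ _ xy; lra.
  - by rewrite Dopp => ? _; exact: cont_cst.
  - by rewrite Dopp; exact: is_cvg_cst.
  - by rewrite Dopp; exact: is_cvg_cst.
  - split.
    + by move=> s _; case: (dB s).
    + by apply: cvg_at_right_filter; exact: (der_cont (dB _)).
    + by apply: cvg_at_left_filter; exact: (der_cont (dB _)).
  - apply: continuous_in_subspaceT => y; rewrite inE/= in_itv/= => h.
    by apply: Gc; lra.
rewrite (integral_oo_sup b0 Gc G0) (@integral_oo_sup (fun y => G (b - y)) 0 b b0).
- congr ereal_sup; apply/seteqP; split => I [u [v [h1 h2 h3 ->]]].
    by exists (b - v), (b - u); split; [lra|lra|lra|exact: E].
  exists (b - v), (b - u); split; [lra|lra|lra|rewrite E; [|lra|lra|lra]].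
  by rewrite !subKr.
- by move=> y yb; apply: (cont_comp (u := fun y => b - y)); [cont|apply: Gc; lra].
- by move=> y yb; apply: G0; lra.
Qed.

End Substitution.

(** * Invariance of the phase measure *)

Section Invariance.
Variables (R : realType) (P : R) (F : frenet P).
Notation mu := (@lebesgue_measure R).
Implicit Types (H : R -> R -> R) (x y s phi : R).
Let P0 : 0 < P := P_gt0 F.

(** Functions on the phase cylinder, lifted in [x]; continuity is asked only in the open strip
    because the billiard map is not defined on its boundary. *)
Definition admissible H : Prop := [/\
  (forall x phi, 0 < phi < pi -> H (x + P) phi = H x phi),
  (forall x phi, 0 < phi < pi -> continuous_at (x, phi) (fun z : R * R => H z.1 z.2)) &
  (forall x phi, 0 < phi < pi -> 0 <= H x phi)].

Definition phase_int H : \bar R :=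
  (\int[mu]_(x in `[0%R, P[) \int[mu]_(phi in `]0%R, pi[) (H x phi * sin phi)%:E)%E.

Let apart_strip x s : 0 < s < P -> apart F x (x + s).
Proof. by move=> sP; apply: apart_itv; rewrite ltrDl ltrD2l. Qed.

Let cont_curry H (T : topologicalType) (u v : T -> R) (z : T) :
  admissible H -> 0 < v z < pi -> continuous_at z u -> continuous_at z v ->
  continuous_at z (fun w => H (u w) (v w)).
Proof.
move=> [_ Hc _] vz uc vc.
by apply: (@cont_pair R T u v z (fun w => H w.1 w.2)) => //; exact: Hc.
Qed.

Let cont_slice H x y : admissible H -> 0 < y < pi ->
  continuous_at y (fun phi => H x phi * sin phi).
Proof.
move=> adH yp; apply: contM; last exact: continuous_sin.
by apply: (@cont_curry H R (fun=> x) (fun w => w)) => //; cont.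
Qed.

Lemma angle_subst H x : admissible H ->
  (\int[mu]_(phi in `]0%R, pi[) (H x phi * sin phi)%:E =
   \int[mu]_(s in `]0%R, P[) (H x (Phi F x (x + s)) * dens F x (x + s))%:E)%E.
Proof.
move=> adH; have [_ Hc H0] := adH.
have shf (s : R) : is_derive s 1 (fun s => x + s) (1:R) by dereq; ring.
have shc (s : R) : continuous_at s (fun s => x + s) by exact: der_cont (shf s).
etransitivity; first apply: (@subst_oo R (fun s => Phi F x (x + s))
   (fun s => cq F (x + s) x / (sh F x (x + s) * sh F x (x + s)))
   (fun phi => H x phi * sin phi) 0 P 0 pi).
- exact: P0.
- exact: pi_gt0.
- move=> s sP; have := der_comp (der_Phi (@apart_strip x s sP)) (shf s).
  by rewrite mulr1 expr2.
- move=> s sP; have a := @apart_strip x s sP.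
  by rewrite divr_gt0 ?mulr_gt0 ?sh_gt0 ?cq_gt0//; exact: apartC.
- move=> s sP; have a := @apart_strip x s sP.
  have c : continuous_at s (fun=> x) by cont.
  have cx := cont_cq (F := F) (shc s) c; have sx := cont_sh (F := F) c (shc s); rewrite /= in cx sx.
  by cont; rewrite mulf_neq0// sh_neq0.
- by move=> s sP; apply: Phi_itv; exact: (@apart_strip _ _ sP).
- by move=> y /(hit_ex F x)[s [sP e]]; exists s.
- by move=> y yp; exact: (@cont_slice H x y adH yp).
- by move=> y yp; rewrite mulr_ge0 ?H0// ltW ?sin_gt0_pi.
- apply: eq_integral => s /set_mem/=; rewrite in_itv/= => sP; congr EFin.
  by rewrite -mulrA -expr2 sin_der_Phi//; exact: (@apart_strip _ _ sP).
Qed.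

(** The billiard map is factored as reversal of the chord followed by the mirror [phi -> pi - phi].
    The reversal preserves the measure because [dens] is symmetric, the mirror because the sine
    is. *)
Definition swap_phase H x phi := H (hit F x phi) (Phi F (hit F x phi) x).
Definition mirror_phase H x phi := H x (pi - phi).

Lemma admissible_swap H : admissible H -> admissible (swap_phase H).
Proof.
move=> adH; have [HP Hc H0] := adH; split.
- move=> x phi pp; have a := apartC (@apart_hit R P F x phi pp).
  by rewrite /swap_phase hit_per// Phi_perl Phi_perr HP//; exact: Phi_itv.
- move=> x phi pp; have a := apartC (@apart_hit R P F x phi pp).
  have hc : continuous_at (x, phi) (fun z : R * R => hit F z.1 z.2) by exact: cont_hit.
  apply: (@cont_curry H _ (fun z : R * R => hit F z.1 z.2)
    (fun z : R * R => Phi F (hit F z.1 z.2) z.1)) => //; first exact: Phi_itv.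
  by apply: cont_Phi => //; exact: cont_fst.
- by move=> x phi pp; apply: H0; apply: Phi_itv; apply: apartC; exact: (@apart_hit R P F x phi pp).
Qed.

Lemma admissible_mirror H : admissible H -> admissible (mirror_phase H).
Proof.
move=> adH; have [HP Hc H0] := adH; split.
- by move=> x phi pp; apply: HP; lra.
- move=> x phi pp.
  apply: (@cont_curry H _ (fun z : R * R => z.1) (fun z : R * R => pi - z.2)) => //=; first by lra.
    by cont.
  by cont.
- by move=> x phi pp; apply: H0; lra.
Qed.

Lemma phase_int_mirror H : admissible H -> phase_int (mirror_phase H) = phase_int H.
Proof.
move=> adH; have [_ Hc H0] := adH.
apply: eq_integral => x _.
rewrite -(@refl_oo R (fun phi => H x phi * sin phi) pi (pi_gt0 R)).
- apply: eq_integral => phi _; congr EFin; rewrite /mirror_phase; congr (_ * _).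
  by rewrite sinB sinpi cospi; ring.
- by move=> y yp; exact: (@cont_slice H x y adH yp).
- by move=> y yp; rewrite mulr_ge0 ?H0// ltW ?sin_gt0_pi.
Qed.

(** In the coordinates [(x, s)] with end points [x] and [x + s], exchanging the end points is the
    translation of [x] by [s], for each fixed [s], followed by [s -> P - s]. Both preserve Lebesgue
    measure, and Tonelli permits fixing [s] first. *)
Lemma phase_int_swap H : admissible H -> phase_int (swap_phase H) = phase_int H.
Proof.
move=> adH; have [HP Hc H0] := adH.
pose G x y := H x (Phi F x y) * dens F x y.
have Gc (T : topologicalType) (u v : T -> R) z : apart F (u z) (v z) ->
    continuous_at z u -> continuous_at z v -> continuous_at z (fun w => G (u w) (v w)).
  move=> a uc vc; apply: contM; last exact: cont_dens.
  by apply: cont_curry => //; [exact: Phi_itv|exact: cont_Phi].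
have G0 x y : apart F x y -> 0 <= G x y.
  by move=> a; apply: mulr_ge0; [apply: H0; exact: Phi_itv|apply/ltW/dens_gt0].
have GP x y : G x (y + P) = G x y by rewrite /G Phi_perr dens_perr.
have aps x s : 0 < s < P -> apart F x (x + (P - s)) by move=> sP; apply: apart_strip; lra.
transitivity (\int[mu]_(x in `[0%R, P[) \int[mu]_(s in `]0%R, P[) (G (x + s)%R x)%:E)%E.
  apply: eq_integral => x _; rewrite (angle_subst x (admissible_swap adH)).
  apply: eq_integral => s /set_mem/=; rewrite in_itv/= => sP; congr EFin.
  by rewrite /swap_phase (@hit_uniq R P F x (x + s))// ?ltrDl ?ltrD2l// /G densC.
have [x s sP|x s sP|<- ->] := @strip_fubini R (fun x s => G (x + s) x) P P.
- by apply: Gc; [apply: apartC; exact: apart_strip|cont|cont].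
- by apply: G0; apply: apartC; exact: apart_strip.
(* The chord from [x + s] back to [x] is, up to one period, the chord from [x + s] forward by
   [P - s]. *)
transitivity (\int[mu]_(s in `]0%R, P[) \int[mu]_(x in `[0%R, P[) (G x (x + (P - s)))%:E)%E.
  apply: eq_integral => s /set_mem/=; rewrite in_itv/= => sP.
  rewrite -(@integral_periodic_shift R (fun x => G x (x + (P - s))) P s P0).
  - apply: eq_integral => x _; congr EFin.
    by rewrite (_ : x + s + (P - s) = x + P) ?GP//; ring.
  - by move=> x; apply: Gc; [exact: aps|cont|cont].
  - move=> x; rewrite (_ : x + P + (P - s) = x + (P - s) + P); last by ring.
    by rewrite GP /G Phi_perl dens_per HP//; apply: Phi_itv; exact: aps.
have [x s sP|x s sP|e1 e2] := @strip_fubini R (fun x s => G x (x + (P - s))) P P.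
- by apply: Gc; [exact: aps|cont|cont].
- by apply: G0; exact: aps.
rewrite -e2 e1; apply: eq_integral => x _; rewrite (angle_subst x adH).
apply: (@refl_oo R (fun s => G x (x + s)) P P0) => y yP; last by apply: G0; exact: apart_strip.
by apply: Gc; [exact: apart_strip|cont|apply: contD; cont].
Qed.

Definition billiard_pull H := swap_phase (mirror_phase H).

Lemma admissible_pull H : admissible H -> admissible (billiard_pull H).
Proof. by move=> ?; apply: admissible_swap; exact: admissible_mirror. Qed.

Lemma phase_int_pull H : admissible H -> phase_int (billiard_pull H) = phase_int H.
Proof.
by move=> adH; rewrite phase_int_swap ?phase_int_mirror//; exact: admissible_mirror.
Qed.

Lemma phase_spaceE : phase_space P = `[0, P[%classic `*` `]0, pi[%classic.
Proof. by apply/seteqP; split => z; rewrite /phase_space /= !in_itv/=. Qed.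

Lemma phase_intE H : admissible H -> phase_int H =
  (\int[(mu \x mu)%E]_(z in phase_space P) (H z.1 z.2 * sin z.2)%:E)%E.
Proof.
move=> [_ Hc H0]; rewrite phase_spaceE.
have [||-> //] := @strip_fubini R (fun x phi => H x phi * sin phi) P pi.
- by move=> x s sp; apply: contM; [exact: Hc|cont].
- by move=> x s sp; apply: mulr_ge0; [exact: H0|apply/ltW/sin_gt0_pi].
Qed.

Lemma measurable_phase : measurable (phase_space P : set (R * R)).
Proof. by rewrite phase_spaceE; exact: measurableX. Qed.

Lemma measurable_admissible H : admissible H ->
  measurable_fun (phase_space P) (fun z : R * R => H z.1 z.2 * sin z.2).
Proof.
move=> [_ Hc _]; apply: (@measurable_funS _ _ _ _ [set z : R * R | 0 < z.2 < pi]).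
- by apply: open_measurable2; exact: open_strip.
- by move=> z [].
- apply: continuous_measurable2; first exact: open_strip.
  by move=> [x s] /= sp; apply: contM; [exact: Hc|cont].
Qed.

Lemma admissibleD H1 H2 : admissible H1 -> admissible H2 ->
  admissible (fun x phi => H1 x phi + H2 x phi).
Proof.
move=> [p1 c1 g1] [p2 c2 g2].
split => [x phi pp|x phi pp|x phi pp]; first by rewrite p1// p2.
  by apply: contD; [exact: c1|exact: c2].
by rewrite addr_ge0// ?g1// g2.
Qed.

Lemma phase_intD H1 H2 : admissible H1 -> admissible H2 ->
  phase_int (fun x phi => H1 x phi + H2 x phi) = (phase_int H1 + phase_int H2)%E.
Proof.
move=> ad1 ad2; have g0 H z : admissible H -> phase_space P z -> (0 <= (H z.1 z.2 * sin z.2)%:E)%E.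
  by move=> [_ _ H0] [_ zp]; rewrite lee_fin mulr_ge0 ?H0// ltW// sin_gt0_pi.
rewrite (phase_intE (admissibleD ad1 ad2)) !phase_intE// -ge0_integralD//.
- by apply: eq_integral => z _; rewrite mulrDl EFinD.
- exact: measurable_phase.
- by move=> z; exact: g0.
- by apply/measurable_EFinP; exact: measurable_admissible.
- by move=> z; exact: g0.
- by apply/measurable_EFinP; exact: measurable_admissible.
Qed.

Lemma admissible_cst (c : R) : 0 <= c -> admissible (fun _ _ => c).
Proof. by move=> c0; split => // x phi _; exact: cont_cst. Qed.

Lemma admissible_iter H j : admissible H -> admissible (iter j billiard_pull H).
Proof. by move=> adH; elim: j => //= j; exact: admissible_pull. Qed.

Lemma phase_int_iter H j : admissible H -> phase_int (iter j billiard_pull H) = phase_int H.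
Proof.
move=> adH; elim: j => [//|j IH]; rewrite -[RHS]IH.
exact: (phase_int_pull (admissible_iter j adH)).
Qed.

Definition orbit_sum H (K : nat) x phi := \sum_(j < K) iter j billiard_pull H x phi.

Lemma orbit_sum0 H : orbit_sum H 0 = (fun _ _ => 0).
Proof. by apply/funext => x; apply/funext => phi; rewrite /orbit_sum big_ord0. Qed.

Lemma orbit_sumS H K :
  orbit_sum H K.+1 = (fun x phi => orbit_sum H K x phi + iter K billiard_pull H x phi).
Proof. by apply/funext => x; apply/funext => phi; rewrite /orbit_sum big_ord_recr. Qed.

Lemma admissible_orbit_sum H K : admissible H -> admissible (orbit_sum H K).
Proof.
move=> adH; elim: K => [|K IH]; first by rewrite orbit_sum0; exact: admissible_cst.
by rewrite orbit_sumS; apply: admissibleD => //; exact: admissible_iter.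
Qed.

Lemma phase_int_orbit_sum H K (c : R) : admissible H -> phase_int H = c%:E ->
  phase_int (orbit_sum H K) = (K%:R * c)%:E.
Proof.
move=> adH Hc; elim: K => [|K IH].
  rewrite orbit_sum0 mul0r /phase_int integral0_eq// => x _; rewrite integral0_eq// => phi _.
  by rewrite mul0r.
rewrite orbit_sumS phase_intD.
- by rewrite IH phase_int_iter// Hc -EFinD -natr1 mulrDl mul1r.
- exact: admissible_orbit_sum.
- exact: admissible_iter.
Qed.

End Invariance.

(** * A primitive of sin phi ln (a + b cos phi + c sin phi) *)

Section LogIntegral.
Variable R : realType.

Variables a b c : R.
Hypotheses (a0 : 0 < a) (abc : a ^+ 2 - b ^+ 2 - c ^+ 2 = 1).

Let D (phi : R) := a + b * cos phi + c * sin phi.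

(** With [D'] the derivative of [D], the normalisation gives [2 * a * D = 1 + D ^+ 2 + D' ^+ 2]. *)
Lemma direction_lb phi : 1 <= 2 * a * D phi.
Proof.
have h := cos2Dsin2 phi; rewrite /D.
have -> : 2 * a * (a + b * cos phi + c * sin phi) =
  1 + (a + (b * cos phi + c * sin phi)) ^+ 2 + (b * sin phi - c * cos phi) ^+ 2
  + (a ^+ 2 - b ^+ 2 - c ^+ 2 - 1) - (b ^+ 2 + c ^+ 2) * (cos phi ^+ 2 + sin phi ^+ 2 - 1) by ring.
rewrite abc h; have := sqr_ge0 (a + (b * cos phi + c * sin phi)).
by have := sqr_ge0 (b * sin phi - c * cos phi); lra.
Qed.

Lemma direction_gt0 phi : 0 < D phi.
Proof.
have := direction_lb phi; rewrite ltNge; apply: contraTN => h.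
rewrite -ltNge; apply: le_lt_trans ltr01.
by apply: mulr_ge0_le0 => //; move: a0; lra.
Qed.

Lemma direction_ub phi : D phi <= 2 * a.
Proof.
have h := cos2Dsin2 phi.
have e : (b * cos phi + c * sin phi) ^+ 2 <= a ^+ 2.
  have -> : a ^+ 2 = (b * cos phi + c * sin phi) ^+ 2 + (b * sin phi - c * cos phi) ^+ 2
    + 1 + (a ^+ 2 - b ^+ 2 - c ^+ 2 - 1) - (b ^+ 2 + c ^+ 2) * (cos phi ^+ 2 + sin phi ^+ 2 - 1) by ring.
  by rewrite abc h; have := sqr_ge0 (b * sin phi - c * cos phi); lra.
rewrite leNgt; apply/negP; rewrite /D => lt.
have : a < b * cos phi + c * sin phi by move: lt; lra.
by move: e a0; nra.
Qed.

(** Integration by parts leaves [cos * D1 / D], where [D1] is the derivative of [D]. Writing [cos]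
    as a combination of [D - a] and [D1], and [D1 ^+ 2] as a quadratic in [D], reduces this to
    elementary terms and [1 / D]. The latter has the primitive [phi + 2 * atan (D1 / (D + 1))],
    which is smooth on the whole circle, unlike the one through tan (phi / 2). *)
Lemma sin_ln_primitive : exists W : R -> R,
  (forall phi : R, is_derive phi 1 W (sin phi * ln (a + b * cos phi + c * sin phi))) /\
  W (pi *+ 2) - W 0 = 2 * pi * c / (1 + a).
Proof.
have a1 : 1 + a != 0 by rewrite gt_eqF//; move: a0; lra.
have e : b ^+ 2 + c ^+ 2 = (a - 1) * (1 + a) by move: abc; lra.
(* The formula for [W] divides by [b ^+ 2 + c ^+ 2]. If this vanishes then [a = 1] and the logarithm
   is identically 0. *)
have [r0|r0] := eqVneq (b ^+ 2 + c ^+ 2) 0.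
  have z : (b == 0) && (c == 0).
    by move/eqP: r0; rewrite paddr_eq0 ?sqr_ge0// !sqrf_eq0.
  move/andP: z => [/eqP b0 /eqP c0].
  have a1' : a = 1.
    by apply/eqP; move/eqP: r0; rewrite e mulf_eq0 (negPf a1) orbF subr_eq0.
  exists (fun=> 0); split => [phi|]; last by rewrite c0; ring.
  by rewrite a1' b0 c0 !mul0r !addr0 ln1 mulr0; exact: der_cst.
pose D1 (phi : R) := c * cos phi - b * sin phi.
have dD (phi : R) : is_derive phi 1 D (D1 phi) by rewrite /D /D1; dereq; ring.
have dD1 (phi : R) : is_derive phi 1 D1 (a - D phi) by rewrite /D /D1; dereq; ring.
have cs (phi : R) : sin phi ^+ 2 = 1 - cos phi ^+ 2.
  by have := cos2Dsin2 phi; lra.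
have D1sq (phi : R) : D1 phi ^+ 2 = -1 + 2 * a * D phi - D phi ^+ 2.
  have -> : -1 = - (a ^+ 2 - b ^+ 2 - c ^+ 2) by rewrite abc.
  rewrite /D1 /D; ring: (cs phi).
have Dn0 (phi : R) : D phi != 0 by rewrite gt_eqF// direction_gt0.
have D10 (phi : R) : D phi + 1 != 0 by rewrite gt_eqF//; have := direction_gt0 phi; lra.
have dln (phi : R) : is_derive phi 1 (fun phi => ln (D phi)) (D1 phi / D phi).
  by apply: der_eq (der_ln (direction_gt0 phi) (dD phi)) _; rewrite mulrC.
have da (phi : R) : is_derive phi 1 (fun phi => atan (D1 phi / (D phi + 1))) (((D phi)^-1 - 1) / 2).
  have dS : is_derive phi 1 (fun phi => D phi + 1) (D1 phi) by dereq; ring.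
  have dV := @derV R (fun phi => D phi + 1) phi _ (D10 phi) dS.
  apply: der_eq (der_atan (derM (dD1 phi) dV)) _.
  have h : 1 + (D1 phi / (D phi + 1)) ^+ 2 = 2 * D phi * (1 + a) / (D phi + 1) ^+ 2.
    by rewrite expr_div_n D1sq; field; exact: D10.
  rewrite h mulrDr.
  have -> : D1 phi * (- D1 phi / (D phi + 1) ^+ 2) = - D1 phi ^+ 2 / (D phi + 1) ^+ 2.
    by rewrite expr2; ring.
  rewrite D1sq; field; rewrite a1 D10 Dn0; exact: isT.
pose W (phi : R) := - cos phi * ln (D phi) + (b ^+ 2 + c ^+ 2)^-1 *
  (b * D phi - a * b * ln (D phi) + c * (- (phi + 2 * atan (D1 phi / (D phi + 1)))
   + 2 * a * phi - (a * phi + b * sin phi - c * cos phi))).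
exists W; split.
  move=> phi; rewrite /W; dereq.
  have h : cos phi * (b ^+ 2 + c ^+ 2) = b * (D phi - a) + c * D1 phi.
    by rewrite /D /D1; ring.
  have h2 : cos phi = (b * (D phi - a) + c * D1 phi) / (b ^+ 2 + c ^+ 2).
    by rewrite -h mulfK.
  rewrite -/(D phi).
  transitivity (sin phi * ln (D phi) - cos phi * D1 phi / D phi + (b ^+ 2 + c ^+ 2)^-1 *
    (b * D1 phi - a * b * D1 phi / D phi + c * (- (D phi)^-1 + 2 * a - (a + b * cos phi + c * sin phi)))).
    by field; rewrite r0 Dn0; exact: isT.
  rewrite -/(D phi).
  rewrite h2.
  have -> : (b * (D phi - a) + c * D1 phi) / (b ^+ 2 + c ^+ 2) * D1 phi / D phi =
     (b * (D phi - a) * D1 phi + c * (D1 phi ^+ 2)) / (b ^+ 2 + c ^+ 2) / D phi by ring.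
  by rewrite D1sq; field; rewrite r0 Dn0; exact: isT.
have am : a - 1 != 0 by apply: contraNneq r0; rewrite e => ->; rewrite mul0r.
rewrite /W /D /D1 !cos2pi !sin2pi !sin0 !cos0 e mulr2n; field; rewrite am a1; exact: isT.
Qed.

End LogIntegral.

(** * Santalo's formula *)

Section Santalo.
Variables (R : realType) (P : R) (F : frenet P).
Local Notation g := (cu F).
Local Notation t := (tg F).
Local Notation n := (nu F).
Implicit Types (x y phi : R).
Let P0 : 0 < P := P_gt0 F.

Lemma phase_int_le H1 H2 : admissible P H1 -> admissible P H2 ->
  (forall x phi, 0 < phi < pi -> H1 x phi <= H2 x phi) ->
  (phase_int P H1 <= phase_int P H2)%E.
Proof.
move=> ad1 ad2 le12; rewrite !phase_intE//.
have [_ _ g1] := ad1; have [_ _ g2] := ad2.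
have sn (z : R * R) : phase_space P z -> 0 <= sin z.2.
  by move=> [_ zp]; apply/ltW/sin_gt0_pi.
apply: ge0_le_integral.
- exact: measurable_phase.
- by move=> z zp; rewrite lee_fin mulr_ge0 ?sn//; apply: g1; case: zp.
- by apply/measurable_EFinP; exact: (measurable_admissible ad1).
- by apply/measurable_EFinP; exact: (measurable_admissible ad2).
- by move=> z zp; rewrite lee_fin ler_wpM2r ?sn//; apply: le12; case: zp.
Qed.

Lemma integral_cst_sin (c : R) :
  (\int[@lebesgue_measure R]_(phi in `]0%R, pi[) (c * sin phi)%:E = (2 * c)%:E)%E.
Proof.
etransitivity; first apply: (@FTC_der R (fun phi => c * sin phi) (fun phi => - c * cos phi)
  0 pi false true (pi_gt0 R)).
- by cont.
- by move=> phi; dereq; ring.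
- by rewrite /= cospi cos0; congr EFin; ring.
Qed.

Lemma phase_int_base (d E : R -> R) : continuous d ->
  (forall x, is_derive x 1 E (d x)) ->
  phase_int P (fun x _ => d x) = (2 * (E P - E 0))%:E.
Proof.
move=> dc dE; rewrite /phase_int.
under eq_integral do rewrite integral_cst_sin.
etransitivity; first apply: (@FTC_der R (fun x => 2 * d x) (fun x => 2 * E x) 0 P true true P0).
- by cont.
- by rewrite /=; congr EFin; ring.
Qed.

Lemma phase_int_cst (c : R) : phase_int P (fun _ _ => c) = (2 * c * P)%:E.
Proof.
etransitivity; first apply: (@phase_int_base (fun=> c) (fun x => c * x)).
- by cont.
- by move=> x; dereq; ring.
- by congr EFin; ring.
Qed.

Lemma phase_int_ge0 H : admissible P H -> (0 <= phase_int P H)%E.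
Proof.
move=> [_ _ H0]; apply: integral_ge0 => x _; apply: integral_ge0 => phi.
rewrite /= in_itv/= => pp; rewrite lee_fin; apply: mulr_ge0; first exact: H0.
by apply/ltW/sin_gt0_pi.
Qed.

Lemma phase_int_fin H (c : R) : admissible P H ->
  (forall x phi, 0 < phi < pi -> H x phi <= c) -> exists r, phase_int P H = r%:E.
Proof.
move=> adH Hc; have [_ _ H0] := adH.
have c0 : 0 <= c.
  have pp : 0 < (pi / 2 : R) < pi by have := pi_gt0 R; lra.
  by apply: le_trans (H0 0 _ pp) (Hc 0 _ pp).
have := phase_int_le adH (admissible_cst P c0) Hc; rewrite phase_int_cst => le.
exists (fine (phase_int P H)); rewrite fineK//.
rewrite (ge0_fin_numE (phase_int_ge0 adH)).
by apply: le_lt_trans le _; rewrite ltry.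
Qed.

Definition chord_len x y := arcosh (ch F x y).

Lemma height_expand x y : (g y).2 = ch F x y * (g x).2 + cp F x y * (t x).2 + cq F x y * (n x).2.
Proof.
have := completeness F x (g y) (0, 0, 1).
have e (v : pt R) : mink v (0, 0, 1) = - v.2 by rewrite /mink/=; ring.
have e' (v : pt R) : mink (0, 0, 1) v = - v.2 by rewrite minkC e.
by rewrite e !e' /ch /cp /cq (minkC (g x)); lra.
Qed.

Lemma height_norm x : (g x).2 ^+ 2 - (t x).2 ^+ 2 - (n x).2 ^+ 2 = 1.
Proof.
have := completeness F x (0, 0, 1) (0, 0, 1).
have e' (v : pt R) : mink (0, 0, 1) v = - v.2 by rewrite /mink/=; ring.
by rewrite !e' /= !expr2; lra.
Qed.

(** Third coordinate of the null vector [g x + u], with [u] the unit direction at angle [phi]; this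
    vector represents the end point at infinity of the ray. *)
Definition out_height x phi := (g x).2 + (t x).2 * cos phi + (n x).2 * sin phi.

Lemma out_heightDpi x phi : out_height x (phi + pi) =
  (g x).2 - (t x).2 * cos phi - (n x).2 * sin phi.
Proof. by rewrite /out_height sinDpi cosDpi; ring. Qed.

Lemma out_height_gt0 x phi : 0 < out_height x phi.
Proof. exact: direction_gt0 (cu_gt0 F x) (height_norm x) phi. Qed.

(* For the chord of length l from p = g x to q = g y, with u and u' its unit
   directions at p and q pointing into the chord, q - u' = e^l (p + u); this is
   the third coordinate. *)
Lemma chord_len_height x y : apart F x y ->
  ln (out_height y (Phi F y x + pi)) = chord_len x y + ln (out_height x (Phi F x y)).
Proof.
move=> a; have a' := apartC a; have s0 := sh_gt0 a; have sn := sh_neq0 a.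
have c1 := ch_gt1 a.
rewrite /chord_len /arcosh -/(sh F x y) -lnM ?posrE ?out_height_gt0//; last by lra.
congr ln; rewrite out_heightDpi /out_height !cos_Phi// !sin_Phi//.
have h1 := height_expand x y; have h2 := height_expand y x.
have s2 := sh2 F x y.
rewrite (shC F y x) in h2 *; rewrite (chC F y x) in h2.
have -> : (g y).2 - (t y).2 * (cp F y x / sh F x y) - (n y).2 * (cq F y x / sh F x y)
  = (g y).2 - (cp F y x * (t y).2 + cq F y x * (n y).2) / sh F x y by ring.
have -> : (g x).2 + (t x).2 * (cp F x y / sh F x y) + (n x).2 * (cq F x y / sh F x y)
  = (g x).2 + (cp F x y * (t x).2 + cq F x y * (n x).2) / sh F x y by ring.
have -> : cp F y x * (t y).2 + cq F y x * (n y).2 = (g x).2 - ch F x y * (g y).2 by lra.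
have -> : cp F x y * (t x).2 + cq F x y * (n x).2 = (g y).2 - ch F x y * (g x).2 by lra.
have -> : (ch F x y + sh F x y) * ((g x).2 + ((g y).2 - ch F x y * (g x).2) / sh F x y) =
  ((sh F x y ^+ 2 - ch F x y ^+ 2) * (g x).2 + (ch F x y + sh F x y) * (g y).2) / sh F x y.
  by field.
by rewrite s2; field.
Qed.

Lemma height_bound : exists2 C, 0 <= C & forall x phi, - C <= ln (out_height x phi) <= C.
Proof.
have hc : continuous (fun x => (g x).2).
  by move=> x; have [_ _ d] := der_cu F x; exact: der_cont d.
have [|c _ cm] := per_max P0 hc; first by move=> x; rewrite cu_per.
have h1 x : 1 <= (g x).2.
  have := height_norm x; have := cu_gt0 F x; have := sqr_ge0 (t x).2.
  have := sqr_ge0 (n x).2; nra.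
have m1 := h1 c; exists (ln (2 * (g c).2)); first by rewrite ln_ge0//; lra.
move=> x phi; have mx := cm x; have hx := h1 x; have D0 := out_height_gt0 x phi.
have Dl : 1 <= 2 * (g x).2 * out_height x phi := direction_lb (height_norm x) phi.
have Du : out_height x phi <= 2 * (g x).2 := direction_ub (cu_gt0 F x) (height_norm x) phi.
rewrite -lnV ?posrE; last by lra.
rewrite !ler_ln ?posrE ?invr_gt0//; try lra.
apply/andP; split; last by lra.
rewrite -[leLHS]mul1r ler_pdivrMr; last by lra.
by rewrite mulrC; apply: le_trans Dl _; rewrite ler_pM2r//; lra.
Qed.

Lemma cont_out_height (T : topologicalType) (u v : T -> R) (z : T) :
  continuous_at z u -> continuous_at z v ->
  continuous_at z (fun w => ln (out_height (u w) (v w))).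
Proof.
move=> uc vc; apply: cont_ln; first exact: out_height_gt0.
have hc (f : R -> pt R) f' : der_pt f (u z) f' -> continuous_at z (fun w => (f (u w)).2).
  by move=> [_ _ d]; apply: (cont_comp (f := fun x => (f x).2)) => //; exact: der_cont d.
have c1 := hc _ _ (der_cu F _); have c2 := hc _ _ (der_tg F _); have c3 := hc _ _ (der_nu F _).
by rewrite /out_height; cont.
Qed.

Lemma chord_len_per x y : chord_len (x + P) (y + P) = chord_len x y.
Proof. by rewrite /chord_len /ch !cu_per. Qed.

Lemma chord_len_gt0 x y : apart F x y -> 0 < chord_len x y.
Proof.
move=> a; rewrite ln_gt0// -/(sh F x y).
by have := ch_gt1 a; have := sh_gt0 a; lra.
Qed.

Lemma admissible_chord_len : admissible P (fun x phi => chord_len x (hit F x phi)).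
Proof.
split => x phi pp.
- by rewrite hit_per// chord_len_per.
- have a := @apart_hit R P F x phi pp.
  have hc : continuous_at (x, phi) (fun z : R * R => hit F z.1 z.2) by exact: cont_hit.
  apply: cont_ln => /=; first by have := ch_gt1 a; have := sh_gt0 a; rewrite /sh; lra.
  by apply: contD; [apply: cont_ch|apply: cont_sh] => //; exact: cont_fst.
- by apply/ltW/chord_len_gt0; exact: (@apart_hit R P F x phi pp).
Qed.

Lemma chord_len_bound : exists2 C, 0 <= C & forall x y, apart F x y -> chord_len x y <= C.
Proof.
have [C C0 h] := height_bound; exists (2 * C); first lra.
move=> x y a; have := chord_len_height a.
by have := h y (Phi F y x + pi); have := h x (Phi F x y); lra.
Qed.

(** By [chord_len_height] the chord length is [f2] at the reversed chord minus [f1]. As reversal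
    preserves the measure, its integral is that of [f2 - f1], which involves one end point only;
    [f1] and [f2] together cover a full turn of directions, so [sin_ln_primitive] gives
    [- 2 * pi * d x] on each fibre, and [gauss_bonnet_polar] integrates [d]. *)
Lemma phase_int_chord_len (K : R -> R) : (forall x, is_derive x 1 K (kk F x)) ->
  phase_int P (fun x phi => chord_len x (hit F x phi)) = (2 * pi * (K P - K 0 - 2 * pi))%:E.
Proof.
move=> dK; have [C C0 hC] := height_bound.
pose f1 x phi := ln (out_height x phi) + C.
pose f2 x phi := f1 x (phi + pi).
have f1c (T : topologicalType) (u v : T -> R) z : continuous_at z u -> continuous_at z v ->
    continuous_at z (fun w => f1 (u w) (v w)).
  by move=> uc vc; apply: contD; [exact: cont_out_height|exact: cont_cst].
have f1P x phi : f1 (x + P) phi = f1 x phi by rewrite /f1 /out_height cu_per tg_per nu_per.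
have f10 x phi : 0 <= f1 x phi by rewrite /f1; have := hC x phi; lra.
have ad1 : admissible P f1.
  by split => [x phi _|x phi _|x phi _] //; apply: f1c; [exact: cont_fst|exact: cont_snd].
have ad2 : admissible P f2.
  split => [x phi _|x phi _|x phi _]; [exact: f1P| |exact: f10].
  by apply: f1c; [exact: cont_fst|cont].
have e1 : phase_int P (swap_phase F f2) =
    phase_int P (fun x phi => chord_len x (hit F x phi) + f1 x phi).
  apply: eq_integral => x _; apply: eq_integral => phi /set_mem/=; rewrite in_itv/= => pp.
  have a := @apart_hit R P F x phi pp; have [_ hp] := hitP F x pp.
  congr EFin; congr (_ * _); rewrite /swap_phase /f2 /f1 (chord_len_height a) hp; ring.
pose d x := (n x).2 / (1 + (g x).2).
have dpos x : 0 < 1 + (g x).2 by have := cu_gt0 F x; lra.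
have dc : continuous d.
  move=> x; have [_ _ d1] := der_nu F x; have [_ _ d2] := der_cu F x.
  apply: contM; first exact: der_cont d1.
  apply: contV; first by rewrite gt_eqF.
  by apply: contD; [exact: cont_cst|exact: der_cont d2].
have dper x : d (x + P) = d x by rewrite /d nu_per cu_per.
have [c _ cm] := per_max P0 dc dper.
(* Makes [M - pi * d x] nonnegative, as admissibility requires. *)
pose M := pi * `|d c|.
have pp0 := pi_gt0 R.
have dM x : pi * d x <= M /\ 0 <= M.
  have n1 : 0 <= pi * `|d c| by rewrite mulr_ge0// ltW.
  have hx : pi * d x <= pi * `|d c|.
    by rewrite ler_pM2l//; apply: le_trans (cm x) (ler_norm _).
  by split.
have M0 : 0 <= M by have [] := dM 0.
have adM : admissible P (fun _ _ => M) by exact: admissible_cst.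
have add : admissible P (fun x _ => M - pi * d x).
  split => x phi pp; first by rewrite dper.
    by cont.
  by have [] := dM x; lra.
(* A constant has integral twice its value against the sine, so [pi * d x] here accounts for the
   period [2 * pi * d x] of [W]. *)
have e2 : phase_int P (fun x phi => f2 x phi + M) =
          phase_int P (fun x phi => f1 x phi + (M - pi * d x)).
  apply: eq_integral => x _.
  have [W [dW W2pi]] := sin_ln_primitive (cu_gt0 F x) (height_norm x).
  have cf (h : R -> R) (c' : R) : continuous h -> continuous (fun phi => (h phi + c') * sin phi).
    by cont.
  etransitivity; first apply: (@FTC_der R (fun phi => (f2 x phi + M) * sin phi)
     (fun phi => - W (phi + pi) - (C + M) * cos phi) 0 pi false true pp0).
  - by apply: cf => phi; apply: f1c; cont.
  - move=> phi; have d' := der_shift (dW (phi + pi)); dereq.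
    by rewrite -/(out_height x (phi + pi)) sinDpi /f2 /f1; ring.
  symmetry; etransitivity; first apply: (@FTC_der R
      (fun phi => (f1 x phi + (M - pi * d x)) * sin phi)
      (fun phi => W phi - (C + (M - pi * d x)) * cos phi) 0 pi false true pp0).
  - by apply: cf => phi; apply: f1c; cont.
  - by move=> phi; have d' := dW phi; dereq; rewrite /f1 /out_height; ring.
  rewrite /= !cospi !cos0 add0r -mulr2n; congr EFin.
  have -> : W (pi *+ 2) = W 0 + 2 * pi * d x by rewrite mulrA -W2pi; ring.
  ring.
have [E dE] := primitive dc.
have GB : (K P + E P) - (K 0 + E 0) = 2 * pi.
  have := @gauss_bonnet_polar R P F (fun x => K x + E x) _ 0.
  by rewrite add0r; apply => x; dereq; rewrite /d; ring.
have e3 : phase_int P (fun x _ => M - pi * d x) = (2 * (M * P - pi * (E P - E 0)))%:E.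
  etransitivity; first apply: (@phase_int_base (fun x => M - pi * d x) (fun x => M * x - pi * E x)).
  - by cont.
  - by move=> x; dereq; ring.
  - by congr EFin; ring.
have [|r J1] := phase_int_fin (c := 2 * C) ad1.
  by move=> x phi _; rewrite /f1; have := hC x phi; lra.
have := e2; rewrite (phase_intD ad2 adM) (phase_intD ad1 add) phase_int_cst e3 J1.
rewrite -(phase_int_swap F ad2) e1 (phase_intD admissible_chord_len ad1) J1.
case: (phase_int P (fun x phi => chord_len x (hit F x phi))) => [l||]//=.
rewrite -!EFinD => -[h]; congr EFin.
have GB' : E P - E 0 = 2 * pi - (K P - K 0) by lra.
by rewrite GB' in h; lra.
Qed.

End Santalo.

(** * The curvature term and its integral *)

Section CurvatureTerm.
Variables (R : realType) (P : R) (F : frenet P).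
Local Notation k := (kk F).
Implicit Types (x y phi t : R).
Let P0 : 0 < P := P_gt0 F.

Lemma artanhE t : -1 < t < 1 -> 2 * artanh t = ln (1 + t) - ln (1 - t).
Proof.
move=> /andP[t1 t2]; rewrite /artanh ln_div ?posrE; try lra.
Qed.

Lemma artanh_ge0 t : 0 <= t < 1 -> 0 <= artanh t.
Proof.
move=> /andP[t1 t2]; rewrite /artanh mulr_ge0 ?invr_ge0// ln_ge0//.
by rewrite ler_pdivlMr; lra.
Qed.

Lemma artanh_le (t s : R) : 0 <= t -> t <= s -> s < 1 -> artanh t <= artanh s.
Proof.
move=> t0 ts s1; rewrite /artanh ler_pM2l ?invr_gt0// ler_ln ?posrE ?divr_gt0//; try lra.
by apply: ler_pM; rewrite ?invr_ge0 ?lef_pV2 ?posrE; lra.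
Qed.

(** The sum a + b of the focal distances in the symmetric solution a = b of the mirror equation,
    where coth a = k / sin phi. *)
Definition curv_term x phi := 2 * artanh (sin phi / k x).

Lemma sin_curv x phi : 0 < phi < pi -> 0 < sin phi / k x < 1.
Proof.
move=> pp; have s0 := sin_gt0_pi pp; have k1 := kk_gt1 F x; have s1 := sin_le1 phi.
by rewrite divr_gt0/= ?ltr_pdivrMr; lra.
Qed.

Lemma curv_term_bounds (km : R) x phi : 1 < km -> (forall x, km <= k x) ->
  0 < phi < pi -> 0 <= curv_term x phi <= 2 * artanh km^-1.
Proof.
move=> km1 kmk pp; have /andP[h1 h2] := sin_curv x pp.
have hm : sin phi / k x <= km^-1.
  have s0 := sin_gt0_pi pp; have s1 := sin_le1 phi; have := kmk x => kx.
  rewrite ler_pdivrMr; last lra.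
  have : 1 <= km^-1 * k x by rewrite mulrC ler_pdivlMr; lra.
  lra.
have km_lt : km^-1 < 1 by rewrite invf_lt1; lra.
rewrite /curv_term mulr_ge0//=; last by apply: artanh_ge0; rewrite (ltW h1).
by rewrite ler_pM2l//; apply: artanh_le => //; exact: ltW.
Qed.

Lemma admissible_curv_term : admissible P curv_term.
Proof.
split => x phi pp.
- by rewrite /curv_term kk_per.
- have /andP[h1 h2] := sin_curv x pp; have k1 := kk_gt1 F x.
  apply: contM; first exact: cont_cst.
  apply: contM; first exact: cont_cst.
  have c : continuous_at (x, phi) (fun w : R * R => sin w.2 / k w.1).
    by have kc := @kk_cont R P F; cont; rewrite /= gt_eqF//; lra.
  apply: cont_ln => /=; first by rewrite divr_gt0//; lra.
  apply: contM; first by apply: contD => //; exact: cont_cst.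
  apply: contV; first by rewrite /= gt_eqF//; lra.
  by apply: contD; [exact: cont_cst|exact: contN].
- have /andP[h1 h2] := sin_curv x pp.
  by rewrite /curv_term mulr_ge0//; apply: artanh_ge0; rewrite (ltW h1).
Qed.

(** With [r = sqrt (k ^+ 2 - 1)], the factors [1 + sin phi / k] and [1 - sin phi / k] are
    proportional to [D phi] and [D (phi + pi)] for the coefficients [(k / r, 0, 1 / r)]. The
    integral is therefore the period of [W], namely 2 pi / (k + r) = 2 pi (k - r). *)
Lemma phase_int_curv_term (K Q : R -> R) : (forall x, is_derive x 1 K (k x)) ->
  (forall x, is_derive x 1 Q (Num.sqrt (k x ^+ 2 - 1))) ->
  phase_int P curv_term = (2 * pi * ((K P - K 0) - (Q P - Q 0)))%:E.
Proof.
move=> dK dQ; have pp0 := pi_gt0 R.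
have Qc : continuous (fun x => Num.sqrt (k x ^+ 2 - 1)).
  by have kc := @kk_cont R P F; cont.
transitivity (phase_int P (fun x _ => pi * (k x - Num.sqrt (k x ^+ 2 - 1)))); last first.
  etransitivity; first apply: (@phase_int_base R P F (fun x => pi * (k x - Num.sqrt (k x ^+ 2 - 1))) (fun x => pi * (K x - Q x))).
  - by have kc := @kk_cont R P F; cont.
  - by rewrite /=; congr EFin; ring.
apply: eq_integral => x _; have k1 := kk_gt1 F x.
set r := Num.sqrt (k x ^+ 2 - 1).
have r0 : 0 < r by rewrite sqrtr_gt0 subr_gt0 exprn_egt1.
have r2 : r ^+ 2 = k x ^+ 2 - 1 by rewrite sqr_sqrtr// subr_ge0 ltW// exprn_egt1.
have rn : r != 0 by rewrite gt_eqF.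
have a0 : 0 < k x / r by rewrite divr_gt0//; lra.
have nrm : (k x / r) ^+ 2 - 0 ^+ 2 - (r^-1) ^+ 2 = 1.
  have -> : (k x / r) ^+ 2 - 0 ^+ 2 - (r^-1) ^+ 2 = (k x ^+ 2 - 1) / r ^+ 2 by field.
  by rewrite -r2 divff// expf_neq0.
have [W [dW W2pi]] := sin_ln_primitive a0 nrm.
pose L (phi : R) := sin phi * ln (k x / r + 0 * cos phi + r^-1 * sin phi).
have E (phi : R) : curv_term x phi * sin phi = L phi + L (phi + pi).
  have h1 := sin_le1 phi; have h2 := sin_geN1 phi.
  have b : -1 < sin phi / k x < 1.
    by rewrite ltr_pdivlMr ?ltr_pdivrMr; lra.
  rewrite /curv_term artanhE// /L sinDpi.
  have -> : k x / r + 0 * cos phi + r^-1 * sin phi = k x / r * (1 + sin phi / k x).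
    by field; rewrite rn gt_eqF//; lra.
  have -> : k x / r + 0 * cos (phi + pi) + r^-1 * - sin phi = k x / r * (1 - sin phi / k x).
    by field; rewrite rn gt_eqF//; lra.
  by move: b => /andP[b1 b2]; rewrite !(@lnM R (k x / r)) ?posrE//; try lra; ring.
have Lc : continuous L.
  by rewrite /L; cont; exact: (direction_gt0 a0 nrm).
transitivity ((W (pi + pi) + W pi) - (W (0 + pi) + W 0))%:E.
  apply: (@FTC_der R _ (fun phi => W (phi + pi) + W phi) 0 pi false true pp0).
    move=> phi; rewrite (_ : (fun phi => curv_term x phi * sin phi) = (fun phi => L phi + L (phi + pi)));
      last exact/funext.
    by cont.
  by move=> phi; have d1 := der_shift (dW (phi + pi)); have d2 := dW phi; rewrite E /L; dereq; ring.
rewrite integral_cst_sin add0r -mulr2n; congr EFin.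
have -> : W (pi *+ 2) + W pi - (W pi + W 0) = 2 * pi * r^-1 / (1 + k x / r).
  by rewrite -W2pi; ring.
have kr : 0 < k x + r by lra.
have -> : 2 * pi * r^-1 / (1 + k x / r) = 2 * pi / (k x + r).
  by field; rewrite rn addrC !gt_eqF//; lra.
have -> : 2 * (pi * (k x - r)) = 2 * pi * ((k x ^+ 2 - r ^+ 2) / (k x + r)).
  by field; rewrite gt_eqF.
by rewrite r2; field; rewrite gt_eqF.
Qed.

Lemma mean_curv_gt1 (K : R -> R) : (forall x, is_derive x 1 K (k x)) -> P < K P - K 0.
Proof.
move=> dK; have [c _ ->] := MVT_der P0 dK.
by rewrite subr0 ltr_pMl//; exact: kk_gt1.
Qed.

(* Jensen's inequality, through the tangent line at the mean of k. *)
Lemma integral_sqrt_le (K Q : R -> R) : (forall x, is_derive x 1 K (k x)) ->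
  (forall x, is_derive x 1 Q (Num.sqrt (k x ^+ 2 - 1))) ->
  Q P - Q 0 <= Num.sqrt ((K P - K 0) ^+ 2 - P ^+ 2).
Proof.
move=> dK dQ; have m1 := mean_curv_gt1 dK; set I := K P - K 0 in m1 *.
have S0 : 0 < I ^+ 2 - P ^+ 2.
  have -> : I ^+ 2 - P ^+ 2 = (I - P) * (I + P) by ring.
  by have Pp := P0; rewrite mulr_gt0//; lra.
set S := Num.sqrt _; have Sp : 0 < S by rewrite sqrtr_gt0.
have S2 : S ^+ 2 = I ^+ 2 - P ^+ 2 by rewrite sqr_sqrtr// ltW.
(* After squaring, the two sides differ by [(k x * P - I) ^+ 2]. *)
have tang x : Num.sqrt (k x ^+ 2 - 1) <= (k x * I - P) / S.
  have k1 := kk_gt1 F x; rewrite ler_pdivlMr//.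
  have h0 : 0 <= k x * I - P by have Pp := P0; nra.
  rewrite -(ler_pXn2r (n := 2)) ?nnegrE ?mulr_ge0 ?sqrtr_ge0 ?(ltW Sp)//.
  rewrite exprMn S2 sqr_sqrtr; last by rewrite subr_ge0 ltW// exprn_egt1.
  have := sqr_ge0 (k x * P - I); lra.
have [c _ e] := @MVT_der R (fun x => (K x * I - P * x) / S - Q x)
   (fun x => (k x * I - P) / S - Num.sqrt (k x ^+ 2 - 1)) 0 P P0 (fun x => ltac:(dereq; ring)).
have : 0 <= (k c * I - P) / S - Num.sqrt (k c ^+ 2 - 1) by have := tang c; lra.
move=> h; have : 0 <= ((k c * I - P) / S - Num.sqrt (k c ^+ 2 - 1)) * (P - 0).
  by rewrite mulr_ge0// subr0 ltW.
rewrite -e => le.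
have -> : S = (I * I - P * P) / S by apply: (mulIf (lt0r_neq0 Sp)); rewrite divfK ?gt_eqF// -!expr2.
move: le; rewrite -/I; have -> : (K P * I - P * P) / S - Q P - ((K 0 * I - P * 0) / S - Q 0) =
  (I * I - P * P) / S - (Q P - Q 0) by rewrite /I; ring.
lra.
Qed.

End CurvatureTerm.

(** * Jacobi fields along m-configurations *)

Section Arcoth.
Variable R : realType.
Implicit Types (C S w a b k : R).

Lemma artanh_coth C S : 0 < S -> 1 < C -> S ^+ 2 = C ^+ 2 - 1 ->
  artanh (C / S)^-1 = ln (C + S).
Proof.
move=> S0 C1 e; have d : (C + S) * (C - S) = 1.
  by transitivity (C ^+ 2 - S ^+ 2); [ring|rewrite e; ring].
have s1 : 0 < C + S by lra.
have s2 : 0 < C - S by rewrite -(pmulr_rgt0 _ s1) d.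
rewrite /artanh invf_div.
have -> : (1 + S / C) / (1 - S / C) = (C + S) ^+ 2 * ((C + S) * (C - S))^-1.
  by field; rewrite !gt_eqF//; lra.
by rewrite d invr1 mulr1 lnXn// mulr2n; field.
Qed.

(* The hyperbolic triangle of a chord: the focal distances behind and ahead of
   a caustic point add up to the length of the chord. *)
Lemma artanh_split C S w : 0 < S -> 1 < C -> S ^+ 2 = C ^+ 2 - 1 -> 0 < w ->
  artanh (C / S + w / S)^-1 + artanh (C / S + (w * S)^-1)^-1 = ln (C + S).
Proof.
move=> S0 C1 e w0; have d : (C + S) * (C - S) = 1.
  by transitivity (C ^+ 2 - S ^+ 2); [ring|rewrite e; ring].
set E := C + S in d *; have E0 : 0 < E by rewrite /E; lra.
have CE : C - S = E^-1 by apply: (mulfI (lt0r_neq0 E0)); rewrite d divff// gt_eqF.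
have -> : (C / S + w / S)^-1 = S / (C + w).
  by field; rewrite !gt_eqF//; lra.
have Cw : 0 < C * w + 1 by rewrite addr_gt0// mulr_gt0//; lra.
have -> : (C / S + (w * S)^-1)^-1 = S * w / (C * w + 1).
  by field; rewrite !gt_eqF.
have Ew : 0 < E + w by lra.
have Ew1 : 0 < E * w + 1 by rewrite addr_gt0// mulr_gt0.
have SE : S = (E - E^-1) / 2 by rewrite -CE /E; field.
have CE2 : C = (E + E^-1) / 2 by rewrite -CE /E; field.
have Ei : 0 < E^-1 by rewrite invr_gt0.
have En : E != 0 by rewrite gt_eqF.
have m2 : (1 + S / (C + w)) / (1 - S / (C + w)) = (E + w) / (E^-1 + w).
  rewrite -CE /E; field; rewrite !gt_eqF//; try lra.
have m3 : (1 + S * w / (C * w + 1)) / (1 - S * w / (C * w + 1)) = (E * w + 1) / (E^-1 * w + 1).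
  rewrite -CE /E; field; rewrite !gt_eqF//; have := mulr_gt0 Ei w0; rewrite -CE; try lra.
have p1 : 0 < E^-1 * w + 1 by rewrite addr_gt0// mulr_gt0.
have p2 : 0 < E^-1 + w by lra.
rewrite /artanh m2 m3 -mulrDr -lnM ?posrE ?divr_gt0//.
have -> : (E + w) / (E^-1 + w) * ((E * w + 1) / (E^-1 * w + 1)) = E ^+ 2.
  field; rewrite En !gt_eqF//; try lra.
by rewrite lnXn// mulr2n; field.
Qed.

(* This is the convexity of coth: [a] and [b] are values of coth. *)
Lemma artanh_mirror a b k : 1 < a -> 1 < b -> a + b = 2 * k ->
  2 * artanh k^-1 <= artanh a^-1 + artanh b^-1.
Proof.
move=> a1 b1 e; have k1 : 1 < k by lra.
have r (c : R) : 1 < c -> (1 + c^-1) / (1 - c^-1) = (c + 1) / (c - 1).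
  by move=> c1; field; rewrite !gt_eqF//; lra.
have r0 (c : R) : 1 < c -> 0 < (c + 1) / (c - 1) by move=> c1; rewrite divr_gt0//; lra.
rewrite /artanh !r// -mulrDr -lnM ?posrE ?r0// mulrCA ler_pM2l ?invr_gt0//.
rewrite -[2]/(2%:R) mulr_natl -lnXn ?r0//.
rewrite ler_ln ?posrE; [|by apply: exprn_gt0; exact: r0|by apply: mulr_gt0; exact: r0].
have -> : (a + 1) / (a - 1) * ((b + 1) / (b - 1)) = (a + 1) * (b + 1) / ((a - 1) * (b - 1)).
  by field; rewrite !gt_eqF//; lra.
have ab : a * b <= k ^+ 2.
  have -> : k = (a + b) / 2 by lra.
  by have := sqr_ge0 (a - b); lra.
have h : (a - 1) * (b - 1) = a * b - 2 * k + 1 by rewrite -e; ring.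
have h' : (a + 1) * (b + 1) = a * b + 2 * k + 1 by rewrite -e; ring.
have h0 : 0 < (a - 1) * (b - 1) by rewrite mulr_gt0//; lra.
rewrite expr_div_n ler_pdivlMr// mulrAC ler_pdivrMr ?exprn_gt0//; last by lra.
have kab : k * (a * b) <= k * k ^+ 2 by rewrite ler_pM2l//; lra.
by rewrite h h'; move: kab; lra.
Qed.

End Arcoth.

(** * Discrete Jacobi fields and focal distances *)

Section JacobiField.
Variable R : realType.
Variables X Y Z : nat -> R.
Hypothesis Z0 : forall n, 0 < Z n.

(** Two consecutive values of the solution, with initial values 0 and 1, of the Euler equation of
    the quadratic form [second_var]. *)
Fixpoint jacobi2 (n : nat) : R * R :=
  if n is m.+1 then
    let: (u, v) := jacobi2 m in (v, - ((Y m + X m.+1) * v + Z m * u) / Z m.+1)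
  else (0, 1).

Definition jacobi n := (jacobi2 n).1.

Lemma jacobi0 : jacobi 0 = 0. Proof. by []. Qed.
Lemma jacobi1 : jacobi 1 = 1. Proof. by []. Qed.

Lemma jacobi_rec n : Z n * jacobi n + (Y n + X n.+1) * jacobi n.+1 + Z n.+1 * jacobi n.+2 = 0.
Proof.
rewrite /jacobi /=; case: (jacobi2 n) => u v /=.
by field; rewrite gt_eqF.
Qed.

Definition trunc m n := if (n <= m)%N then jacobi n else 0.

Definition second_var (xi : nat -> R) m :=
  \sum_(i < m) (xi i ^+ 2 * X i + 2 * xi i * xi i.+1 * Z i + xi i.+1 ^+ 2 * Y i).

(** Summation by parts: the Euler equation removes all interior terms, and cutting the field off
    after [m] leaves one boundary term. *)
Lemma second_var_trunc m : second_var (trunc m) m.+1 = - (jacobi m * jacobi m.+1 * Z m).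
Proof.
have h : second_var jacobi m + jacobi m ^+ 2 * X m + jacobi m * jacobi m.+1 * Z m = 0.
  elim: m => [|m IH]; first by rewrite /second_var big_ord0 jacobi0; ring.
  rewrite /second_var big_ord_recr/= -/(second_var jacobi m).
  transitivity (jacobi m.+1 * (Z m * jacobi m + (Y m + X m.+1) * jacobi m.+1 + Z m.+1 * jacobi m.+2) +
   (second_var jacobi m + jacobi m ^+ 2 * X m + jacobi m * jacobi m.+1 * Z m)); first by ring.
  by rewrite IH jacobi_rec; ring.
rewrite /second_var big_ord_recr/= /trunc leqnn ltnn.
rewrite (eq_bigr (fun i : 'I_m => jacobi i ^+ 2 * X i + 2 * jacobi i * jacobi i.+1 * Z i + jacobi i.+1 ^+ 2 * Y i)).
  by rewrite -/(second_var jacobi m); lra.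
by move=> i _; rewrite ltn_ord (ltnW (ltn_ord i)).
Qed.

(** Testing negative definiteness on the truncated field makes consecutive values have the same
    sign. *)
Lemma jacobi_gt0 : (forall m, (0 < m)%N -> second_var (trunc m) m.+1 < 0) ->
  forall n, 0 < jacobi n.+1.
Proof.
move=> neg; elim=> [|n IH]; first by rewrite jacobi1.
have := neg n.+1 isT; rewrite second_var_trunc oppr_lt0 pmulr_lgt0//.
by rewrite pmulr_rgt0.
Qed.

End JacobiField.

Section FocalSum.
Variable R : realType.
Variables C S s k : nat -> R.
Hypotheses (S0 : forall n, 0 < S n) (C1 : forall n, 1 < C n)
  (CS : forall n, S n ^+ 2 = C n ^+ 2 - 1) (s0 : forall n, 0 < s n).
Let X n := s n * (C n / S n * s n - k n).
Let Y n := s n.+1 * (C n / S n * s n.+1 - k n.+1).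
Let Z n := s n * s n.+1 / S n.
Let J := jacobi X Y Z.
Hypothesis Jpos : forall n, 0 < J n.+1.

(** By [artanh_mirror] and [artanh_split] each summand is at most b_n - b_(n+1), so the sum
    telescopes to b_1 - b_(K+1). Here b_1 is the length of chord 0, because the field vanishes at
    bounce 0. *)
Lemma focal_sum K :
  \sum_(n < K) (2 * artanh (s n.+1 / k n.+1) - ln (C n.+1 + S n.+1)) <= ln (C 0%N + S 0%N).
Proof.
pose u n := s n * J n.
have up n : 0 < u n.+1 by rewrite mulr_gt0.
have u0 : u 0%N = 0 by rewrite /u /J jacobi0 mulr0.
have un n : 0 <= u n by case: n => [|n]; [rewrite u0|rewrite ltW].
(* [u n] is the width of the field transverse to the trajectory, and [beta n] is coth b_(n+1), for
   the focal distance behind bounce [n + 1] along chord [n]. *)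
pose beta n := C n / S n + u n / (u n.+1 * S n).
have CS1 n : 1 < C n / S n.
  rewrite ltr_pdivlMr// mul1r -(ltr_pXn2r (n := 2)) ?nnegrE ?CS//; try lra.
    by rewrite ltW.
  by have := C1 n; lra.
have beta1 n : 1 < beta n.
  by apply: lt_le_trans (CS1 n) _; rewrite lerDl divr_ge0// mulr_ge0// ltW.
(* The induction needs the term b_(K+1), which is nonnegative and dropped at the end. *)
suff h : \sum_(n < K) (2 * artanh (s n.+1 / k n.+1) - ln (C n.+1 + S n.+1))
    <= ln (C 0%N + S 0%N) - artanh (beta K)^-1.
  apply: le_trans h _; rewrite gerBl; apply: artanh_ge0.
  by have := beta1 K => b; rewrite invr_ge0 invf_lt1 ?b ?andbT; lra.
elim: K => [|K IH].
  by rewrite big_ord0 /beta u0 mul0r addr0 artanh_coth// subrr.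
rewrite big_ord_recr/=.
pose w := u K.+2 / u K.+1.
have w0 : 0 < w by rewrite divr_gt0.
have split_eq := artanh_split (S0 K.+1) (C1 K.+1) (CS K.+1) w0.
have bE : beta K.+1 = C K.+1 / S K.+1 + (w * S K.+1)^-1.
  by rewrite /beta /w; congr (_ + _); field; rewrite !gt_eqF.
rewrite -bE in split_eq.
set al := C K.+1 / S K.+1 + w / S K.+1 in split_eq.
have al1 : 1 < al by apply: lt_le_trans (CS1 K.+1) _; rewrite lerDl divr_ge0 ?ltW.
have mir : al + beta K = 2 * (k K.+1 / s K.+1).
  have := jacobi_rec X Y (fun n => divr_gt0 (mulr_gt0 (s0 n) (s0 n.+1)) (S0 n)) K.
  rewrite -/Z -/J /al /beta /w /u /Z /X /Y => rec.
  have n1 := lt0r_neq0 (s0 K); have n2 := lt0r_neq0 (s0 K.+1); have n3 := lt0r_neq0 (s0 K.+2).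
  have n4 := lt0r_neq0 (S0 K); have n5 := lt0r_neq0 (S0 K.+1).
  have n6 := lt0r_neq0 (Jpos K).
  apply/eqP; rewrite -subr_eq0; apply/eqP.
  have sJ : s K.+1 * (s K.+1 * J K.+1) != 0 by rewrite !mulf_neq0.
  apply: (mulfI sJ); rewrite mulr0 -[RHS]rec.
  by field; rewrite n4 n5 n6 n2; exact: isT.
have := artanh_mirror al1 (beta1 K) mir; rewrite invf_div.
by move: IH split_eq; clear; lra.
Qed.

End FocalSum.

(** * Second variation of the chord length *)

Section SecondVariation.
Variables (R : realType) (P : R) (F : frenet P).
Implicit Types (x y t xi eta : R).

Definition dlen x y xi eta := - (cp F x y / sh F x y * xi + cp F y x / sh F x y * eta).

Lemma der_arcosh (c : R) : 1 < c -> is_derive c 1 (@arcosh R) (Num.sqrt (c ^+ 2 - 1))^-1.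
Proof.
move=> c1; have h : 0 < c ^+ 2 - 1 by rewrite subr_gt0 exprn_egt1.
have s0 : 0 < Num.sqrt (c ^+ 2 - 1) by rewrite sqrtr_gt0.
have d2 : is_derive c 1 (fun c => c ^+ 2 - 1) (2 * c) by dereq; ring.
have ds := @der_sqrt R (fun c => c ^+ 2 - 1) c _ h d2.
have p : 0 < c + Num.sqrt (c ^+ 2 - 1) by lra.
apply: der_eq (@der_ln R (fun c => c + Num.sqrt (c ^+ 2 - 1)) c _ p (derD (der_id c) ds)) _.
by field; rewrite !gt_eqF.
Qed.

Lemma der_chord_len (u v : R -> R) t xi eta : is_derive t 1 u xi -> is_derive t 1 v eta ->
  apart F (u t) (v t) ->
  is_derive t 1 (fun t => chord_len F (u t) (v t)) (dlen (u t) (v t) xi eta).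
Proof.
move=> du dv a.
apply: der_eq (@der_comp R (@arcosh R) (fun t => ch F (u t) (v t)) t _ _ (der_arcosh (ch_gt1 a)) (der_ch F du dv)) _.
by rewrite /dlen -/(sh F (u t) (v t)); field; exact: sh_neq0.
Qed.

Lemma der_dlen (u v : R -> R) t xi eta : is_derive t 1 u xi -> is_derive t 1 v eta ->
  apart F (u t) (v t) -> is_derive t 1 (fun t => dlen (u t) (v t) xi eta)
    (xi ^+ 2 * Lxx F (u t) (v t) + 2 * xi * eta * dens F (u t) (v t) + eta ^+ 2 * Lxx F (v t) (u t)).
Proof.
move=> du dv a; rewrite /dlen.
have d1 := der_cos_chord du dv a.
have d2 : is_derive t 1 (fun t => cp F (v t) (u t) / sh F (u t) (v t))
    (- (eta * Lxx F (v t) (u t) + xi * dens F (v t) (u t))).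
  by apply: der_ext (der_cos_chord dv du (apartC a)) => z; rewrite (shC F (v z)).
apply: der_eq (derN (derD (derM d1 (der_cst xi t)) (derM d2 (der_cst eta t)))) _.
by rewrite (densC F (v t)); ring.
Qed.

Lemma der_line x xi t : is_derive t 1 (fun t => x + t * xi) xi.
Proof. by dereq; ring. Qed.

Lemma apart_near x y xi eta : apart F x y ->
  \forall t \near (0 : R), apart F (x + t * xi) (y + t * eta).
Proof.
move=> a.
have c : {for 0, continuous (fun t : R => ch F (x + t * xi) (y + t * eta))}.
  exact: der_cont (der_ch F (der_line x xi 0) (der_line y eta 0)).
have c1 : 1 < ch F (x + 0 * xi) (y + 0 * eta) by rewrite !mul0r !addr0 ch_gt1.
have near1 : \forall t \near (0 : R), 1 < ch F (x + t * xi) (y + t * eta).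
  exact: (cvgr_gt _ c).
near=> t; have : 1 < ch F (x + t * xi) (y + t * eta) by near: t.
by move=> h e; move: h; rewrite /ch e cucu; lra.
Unshelve. all: by end_near.
Qed.

Lemma der_sum (m : nat) (f : nat -> R -> R) (d : nat -> R) t :
  (forall i, (i < m)%N -> is_derive t 1 (f i) (d i)) ->
  is_derive t 1 (fun t => \sum_(i < m) f i t) (\sum_(i < m) d i).
Proof.
elim: m => [|m IH] h.
  rewrite big_ord0; apply: der_ext (der_cst 0 t) => z; by rewrite big_ord0.
rewrite big_ord_recr/=.
apply: (@der_ext R (fun t => \sum_(i < m) f i t + f m t)).
  by move=> z; rewrite big_ord_recr.
apply: derD; last exact: h.
by apply: IH => i im; apply: h; exact: ltnW.
Qed.

(** Only small [t] matter for the derivative at 0, and for these the finitely many perturbed chords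
    keep distinct end points, so the first variation formula holds near 0 and can be differentiated
    again. *)
Lemma second_derivative_sum (m : nat) (x xi : nat -> R) :
  (forall i, apart F (x i) (x i.+1)) ->
  derive1n 2 (fun t => \sum_(i < m) chord_len F (x i + t * xi i) (x i.+1 + t * xi i.+1)) 0 =
  second_var (fun i => Lxx F (x i) (x i.+1)) (fun i => Lxx F (x i.+1) (x i))
    (fun i => dens F (x i) (x i.+1)) xi m.
Proof.
move=> a; set f := fun t => _.
pose D t := \sum_(i < m) dlen (x i + t * xi i) (x i.+1 + t * xi i.+1) (xi i) (xi i.+1).
have nr : \forall t \near (0 : R), forall i, (i < m)%N ->
    apart F (x i + t * xi i) (x i.+1 + t * xi i.+1).
  elim: m {f D} => [|m IH]; first by near=> t.
  near=> t => i; rewrite ltnS leq_eqVlt => /predU1P[->|im].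
    by near: t; exact: apart_near.
  by move: i im; near: t.
have fD : \forall t \near (0 : R), D t = derive1 f t.
  near=> t; rewrite derive1E; symmetry; apply: (@derive_val _ _ _ _ _ f); rewrite /f /D.
  apply: (@der_sum m (fun i t => chord_len F (x i + t * xi i) (x i.+1 + t * xi i.+1))
     (fun i => dlen (x i + t * xi i) (x i.+1 + t * xi i.+1) (xi i) (xi i.+1))) => i im.
  by apply: der_chord_len; [exact: der_line|exact: der_line|move: i im; near: t].
rewrite /derive1n /= derive1E; apply: (@derive_val _ _ _ _ _ (derive1 f)).
apply: der_near fD _.
rewrite /D /second_var.
apply: der_eq (@der_sum m (fun i t => dlen (x i + t * xi i) (x i.+1 + t * xi i.+1) (xi i) (xi i.+1))
  (fun i => xi i ^+ 2 * Lxx F (x i) (x i.+1) + 2 * xi i * xi i.+1 * dens F (x i) (x i.+1) + xi i.+1 ^+ 2 * Lxx F (x i.+1) (x i)) 0 _) _.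
  move=> i im; apply: der_eq (der_dlen (der_line _ _ _) (der_line _ _ _) _) _; rewrite !mul0r !addr0//.
by [].
Unshelve. all: by end_near.
Qed.

End SecondVariation.

(** * Orbit sums along m-configurations *)

Section MConfigurations.
Variables (R : realType) (P : R) (F : frenet P).
Local Notation g := (cu F).
Local Notation tt := (tg F).
Local Notation k := (kk F).
Implicit Types (x y phi : R).
Let P0 : 0 < P := P_gt0 F.

Lemma cderiv_cu x : cderiv g x = tt x.
Proof.
have [d1 d2 d3] := der_cu F x.
by apply: pt_eq; rewrite /cderiv/= derive1E; exact: derive_val.
Qed.

Lemma cosangE x y : cosang g x y = cp F x y / sh F x y.
Proof.
rewrite /cosang cderiv_cu /gdir minkZr minkDr minkZr (minkC (tt x) (g x)) cutg mulr0 addr0.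
by rewrite mulrC /cp /sh /ch sqrrN (minkC (tt x)).
Qed.

Lemma PhiN x y z : cp F x y / sh F x y = - (cp F x z / sh F x z) ->
  apart F x y -> apart F x z -> Phi F x y = pi - Phi F x z.
Proof.
move=> e a b; have [p1 p2] := (Phi_itv a, Phi_itv b).
have c : cos (Phi F x y) = cos (pi - Phi F x z).
  by rewrite cosB cospi sinpi cos_Phi// e cos_Phi//; ring.
have i1 : Phi F x y \in `[0, pi] by rewrite in_itv/= !ltW//; move: p1 => /andP[].
have i2 : pi - Phi F x z \in `[0, pi] by rewrite in_itv/=; move: p2 => /andP[h1 h2]; lra.
by rewrite -(cosK i1) c cosK.
Qed.

(** The points of a configuration are arbitrary lifts, so the next one agrees with [hit] only up to
    a multiple of the period. *)
Lemma apart_shift x y : apart F x y -> exists i : int, hit F x (Phi F x y) = y + i%:~R * P.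
Proof.
move=> a; have [i /andP[i0 iP]] := per_red (y - x) P0; exists i.
have e : g (y + i%:~R * P) = g y by exact: (per_int (cu_per F)).
have P_e : Phi F x (y + i%:~R * P) = Phi F x y by rewrite /Phi /sh /ch /cp e.
apply: hit_uniq => //; apply/andP; split; last lra.
have : x <= y + i%:~R * P by lra.
by rewrite le_eqVlt => /predU1P[h|//]; case: a; rewrite -e -h.
Qed.

Section Config.
Variable xs : int -> R.
Hypothesis bc : billiard_config g xs.

Lemma config_apart m : apart F (xs m) (xs (m + 1)).
Proof. exact: bc.1. Qed.

Lemma config_refl m : Phi F (xs (m + 1)) (xs (m + 1 + 1)) = pi - Phi F (xs (m + 1)) (xs m).
Proof.
apply: PhiN; [|exact: config_apart|apply: apartC; exact: config_apart].
by have := bc.2 (m + 1); rewrite !cosangE addrK.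
Qed.

Lemma iter_pull H j m : admissible P H ->
  iter j (billiard_pull F) H (xs m) (Phi F (xs m) (xs (m + 1))) =
  H (xs (m + j%:Z)) (Phi F (xs (m + j%:Z)) (xs (m + j%:Z + 1))).
Proof.
move=> adH; elim: j m => [|j IH] m; first by rewrite addr0.
have adj := admissible_iter F j adH.
rewrite iterS; set G := iter j _ H in IH adj *.
have a := @config_apart m; have [i hi] := apart_shift a.
rewrite /billiard_pull /swap_phase /mirror_phase hi.
have -> : Phi F (xs (m + 1) + i%:~R * P) (xs m) = Phi F (xs (m + 1)) (xs m).
  by rewrite (per_int (f := fun x => Phi F x (xs m)))// => x; exact: Phi_perl.
have pp : 0 < pi - Phi F (xs (m + 1)) (xs m) < pi.
  by have /andP[] := Phi_itv (apartC a); lra.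
have Gp x : G (x + P) (pi - Phi F (xs (m + 1)) (xs m)) = G x (pi - Phi F (xs (m + 1)) (xs m)).
  by case: adj => + _ _; apply.
rewrite (per_int (f := fun x => G x (pi - Phi F (xs (m + 1)) (xs m))))//.
by rewrite -config_refl IH -addrA -intS.
Qed.

Hypothesis mc : m_config g xs.
(** The Jacobi field is started one bounce early, at -1, so that it is positive from bounce 0 on and
    the focal sum begins there; the bound becomes the length of the chord arriving at bounce 0. *)
Let x (j : nat) := xs (-1 + j%:Z).

Let xS j : xs (-1 + j%:Z + 1) = x j.+1.
Proof. by rewrite /x; congr xs; lia. Qed.

Let ax j : apart F (x j) (x j.+1).
Proof. by rewrite -xS; exact: config_apart. Qed.

Let rx j : Phi F (x j.+1) (x j.+2) = pi - Phi F (x j.+1) (x j).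
Proof.
have -> : x j.+2 = xs (-1 + j%:Z + 1 + 1) by rewrite /x; congr xs; lia.
by rewrite -xS; exact: config_refl.
Qed.

Let X j := Lxx F (x j) (x j.+1).
Let Y j := Lxx F (x j.+1) (x j).
Let Z j := dens F (x j) (x j.+1).

Let neg m : (0 < m)%N -> second_var X Y Z (trunc X Y Z m) m.+1 < 0.
Proof.
move=> m0.
(* The truncated field, moved back by one index and extended by 0. It vanishes at bounce -1 because
   [jacobi] starts with 0, and from bounce [m] on by truncation. *)
pose xi (i : int) := match i + 1 with Posz j => trunc X Y Z m j | Negz _ => 0 end.
have xiE (j : nat) : xi (-1 + j%:Z) = trunc X Y Z m j.
  by rewrite /xi addrAC addNr add0r.
have xiE' (j : nat) : xi (-1 + j%:Z + 1) = trunc X Y Z m j.+1.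
  by rewrite -xiE; congr xi; rewrite -addrA intS (addrC 1).
have := mc (M := -1) (k := m.+1) (xi := xi).
have -> : (fun t : R => action g (fun n : int => xs n + t * xi n) (-1) m.+1) =
  (fun t => \sum_(i < m.+1) chord_len F (x i + t * trunc X Y Z m i) (x i.+1 + t * trunc X Y Z m i.+1)).
  apply/funext => t; apply: eq_bigr => i _.
  by rewrite xiE xiE' xS.
rewrite second_derivative_sum//; apply.
- move=> i i1; rewrite /xi; have : i + 1 <= 0 by lia.
  by case: (i + 1) => [[|j]|j].
- move=> i i1; rewrite /xi; have : m.+1%:Z <= i + 1 by lia.
  by case: (i + 1) => // j; rewrite lez_nat /trunc => h; rewrite leqNgt h.
- exists (-1 + 1%N%:Z); rewrite xiE /trunc m0 jacobi1; apply/eqP; exact: oner_neq0.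
Qed.

Lemma m_config_sum K :
  \sum_(n < K) (curv_term F (xs n%:Z) (Phi F (xs n%:Z) (xs (n%:Z + 1)))
     - chord_len F (xs n%:Z) (xs (n%:Z + 1))) <= chord_len F (xs (-1)) (xs 0).
Proof.
have xE (j : nat) : xs j%:Z = x j.+1 by rewrite /x intS addrA addNr add0r.
have xE' (j : nat) : xs (j%:Z + 1) = x j.+2 by rewrite -xE intS addrC.
rewrite (xE 0%N); have -> : xs (-1) = x 0%N by rewrite /x addr0.
under eq_bigr do rewrite xE xE'.
pose C j := ch F (x j) (x j.+1).
pose S j := sh F (x j) (x j.+1).
pose s j := sin (Phi F (x j) (x j.+1)).
pose kx j := k (x j).
have s0 j : 0 < s j by apply: sin_gt0_pi; exact: Phi_itv.
have s1 j : s j = cq F (x j) (x j.+1) / S j by rewrite /s sin_Phi.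
(* By the reflection law the sine at bounce [j + 1] can also be read off the arriving chord. *)
have s2 j : s j.+1 = cq F (x j.+1) (x j) / S j.
  rewrite /s rx sinB sinpi cospi sin_Phi//; last exact: apartC.
  by rewrite /S (shC F (x j.+1)); ring.
have Sn j : S j != 0 by exact: sh_neq0.
apply: (@focal_sum R C S s kx).
- by move=> j; exact: sh_gt0.
- by move=> j; exact: ch_gt1.
- by move=> j; exact: sh2.
- exact: s0.
- move=> j; have h := jacobi_gt0 _ neg j.
  have XE : X = (fun n => s n * (C n / S n * s n - kx n)).
    by apply/funext => n; rewrite !s1.
  have YE : Y = (fun n => s n.+1 * (C n / S n * s n.+1 - kx n.+1)).
    by apply/funext => n; rewrite !s2 /Y /Lxx (chC F (x n.+1)) (shC F (x n.+1)).
  have ZE : Z = (fun n => s n * s n.+1 / S n).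
    by apply/funext => n; rewrite s1 s2 /Z /dens -/(S n); field.
  by rewrite -XE -YE -ZE; apply: h => n; exact: dens_gt0.
Qed.

End Config.

(** Of the [K + 1] copies of [C], [K] come from the constant added to each summand and one bounds
    the chord before the starting point. *)
Lemma m_set_orbit_sum (C : R) K (z : R * R) :
  admissible P (fun x phi => curv_term F x phi - chord_len F x (hit F x phi) + C) ->
  (forall x y, apart F x y -> chord_len F x y <= C) ->
  m_set g P z ->
  orbit_sum F (fun x phi => curv_term F x phi - chord_len F x (hit F x phi) + C) K z.1 z.2 <= K.+1%:R * C.
Proof.
move=> adH HC [[_ zp] [xs [bc mc e0 e1]]].
have -> : z.2 = Phi F (xs 0) (xs (0 + 1)).
  rewrite add0r; rewrite cosangE in e1.
  by rewrite /Phi -e1 cosK// in_itv/= !ltW//; move: zp => /andP[].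
rewrite -e0 /orbit_sum.
under eq_bigr do rewrite iter_pull// add0r.
have -> : \sum_(i < K) (curv_term F (xs i%:Z) (Phi F (xs i%:Z) (xs (i%:Z + 1))) -
    chord_len F (xs i%:Z) (hit F (xs i%:Z) (Phi F (xs i%:Z) (xs (i%:Z + 1)))) + C) =
  \sum_(i < K) (curv_term F (xs i%:Z) (Phi F (xs i%:Z) (xs (i%:Z + 1))) -
    chord_len F (xs i%:Z) (xs (i%:Z + 1))) + C *+ K.
  rewrite big_split/= sumr_const card_ord; congr (_ + _).
  apply: eq_bigr => i _; congr (_ - _).
  have [j ->] := apart_shift (@config_apart xs bc i%:Z).
  by rewrite /chord_len /ch (per_int (cu_per F)).
have := m_config_sum bc mc K.
have := HC _ _ (@config_apart xs bc (-1)); rewrite addNr.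
by rewrite -natr1 mulrDl mul1r mulr_natl; lra.
Qed.

End MConfigurations.

(** * The enclosed area *)

Section EnclosedArea.
Variables (R : realType) (P : R) (F : frenet P).
Notation mu := (@lebesgue_measure R).
Local Notation g := (cu F).
Local Notation tt := (tg F).
Local Notation nn := (nu F).
Local Notation k := (kk F).
Let P0 : 0 < P := P_gt0 F.

Variables (a b : R) (th : R -> R).
Let X (s : R) := (g (a + s)).1.1.
Let V (s : R) := (g (a + s)).1.2.
Let W (s : R) := (g (a + s)).2.
Let X' (s : R) := (tt (a + s)).1.1.
Let V' (s : R) := (tt (a + s)).1.2.
Let W' (s : R) := (tt (a + s)).2.
Hypotheses (bP : 0 < b < P) (X'up : forall s : R, 0 < s < b -> 0 < X' s)
  (X'dn : forall s : R, b < s < P -> X' s < 0)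
  (dth : forall s : R, is_derive s 1 th
     (k (a + s) + X s * (nn (a + s)).1.1 / (1 + X s ^+ 2)))
  (thP : th P = th 0 + 2 * pi).

Let dX (s : R) : is_derive s 1 X (X' s).
Proof. by have [] := der_pt_shift (der_cu F (a + s)). Qed.
Let dV (s : R) : is_derive s 1 V (V' s).
Proof. by have [] := der_pt_shift (der_cu F (a + s)). Qed.
Let dW (s : R) : is_derive s 1 W (W' s).
Proof. by have [] := der_pt_shift (der_cu F (a + s)). Qed.

Let XP : X P = X 0. Proof. by rewrite /X cu_per addr0. Qed.
Let VP : V P = V 0. Proof. by rewrite /V cu_per addr0. Qed.
Let WP : W P = W 0. Proof. by rewrite /W cu_per addr0. Qed.

Let W2 s : W s ^+ 2 = 1 + X s ^+ 2 + V s ^+ 2.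
Proof. by have := cucu F (a + s); rewrite /mink -/(X s) -/(V s) -/(W s); lra. Qed.
Let Wgt0 s : 0 < W s. Proof. exact: cu_gt0. Qed.
Let Wsqrt s : Num.sqrt (1 + X s ^+ 2 + V s ^+ 2) = W s.
Proof. by rewrite -W2 sqrtr_sqr gtr0_norm. Qed.

Let VW s : 0 < W s - V s /\ 0 < V s + W s.
Proof.
have := W2 s; have := Wgt0 s; have := sqr_ge0 (X s) => h1 h2 h3.
by split; rewrite ltNge; apply/negP => h4; nra.
Qed.

(** For a fixed first coordinate u, ln (v + sqrt (1 + u^2 + v^2)) is the primitive in v of the area
    density; on the curve the root is [W]. *)
Let tau s := ln (V s + W s).

Let dtau (s : R) : is_derive s 1 tau ((V' s + W' s) / (V s + W s)).
Proof.
have [_ h] := VW s.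
by apply: der_eq (@der_ln R (fun s => V s + W s) s _ h (derD (dV s) (dW s))) _; rewrite mulrC.
Qed.

Let normal_cross s : V s * W' s - W s * V' s = eps F * (nn (a + s)).1.1.
Proof.
by rewrite nuE /ptscale /cross/= mulrA eps2 mul1r.
Qed.

(* With t = tau - ln (1 + X^2) / 2, t' = - eps n_1 / (1 + X^2); integrating X t'
   by parts turns the area integral into the Gauss-Bonnet integrand. *)
Let tauX_closed (I : R -> R) (K : R -> R) : (forall s : R, is_derive s 1 I (tau s * X' s)) ->
  (forall x : R, is_derive x 1 K (k x)) ->
  I P - I 0 = eps F * (2 * pi - (K P - K 0)).
Proof.
move=> dI dK.
have Xp x : 0 < 1 + x ^+ 2 :> R by rewrite ltr_pwDl// sqr_ge0.
have lnd (x : R) : is_derive x 1 (fun x => 2^-1 * ln (1 + x ^+ 2)) (x / (1 + x ^+ 2)).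
  have d1 : is_derive x 1 (fun x => 1 + x ^+ 2) (2 * x) by dereq; ring.
  have d2 := @der_ln R (fun x => 1 + x ^+ 2) x _ (Xp x) d1.
  by dereq; field; rewrite gt_eqF.
have [h dh] := primitive (der_contT lnd).
pose t s := tau s - 2^-1 * ln (1 + X s ^+ 2).
have dt (s : R) : is_derive s 1 t (- (eps F * (nn (a + s)).1.1) / (1 + X s ^+ 2)).
  have d2 := @der_comp R (fun x => 2^-1 * ln (1 + x ^+ 2)) X s _ _ (lnd (X s)) (dX s).
  apply: der_eq (derD (dtau s) (derN d2)) _.
  have [h1 h2] := VW s.
  have e : 1 + X s ^+ 2 = (W s - V s) * (V s + W s) by have := W2 s; lra.
  have e' : X s * X' s = W s * W' s - V s * V' s.
    by have := cutg F (a + s); rewrite /mink -/(X s) -/(V s) -/(W s) -/(X' s) -/(V' s) -/(W' s); lra.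
  rewrite -normal_cross mulrAC e' e; field; rewrite !gt_eqF//.
have d1 (s : R) : is_derive s 1 (fun s => I s - X s * t s - h (X s))
    (eps F * (X s * (nn (a + s)).1.1 / (1 + X s ^+ 2))).
  have d3 := @der_comp R h X s _ _ (dh (X s)) (dX s).
  apply: der_eq (derD (derD (dI s) (derN (derM (dX s) (dt s)))) (derN d3)) _.
  by rewrite /t; field; rewrite gt_eqF.
have dKa (s : R) := der_shiftl (dK (a + s)).
have d2 (s : R) : is_derive s 1 (fun s => eps F * (th s - K (a + s)))
    (eps F * (X s * (nn (a + s)).1.1 / (1 + X s ^+ 2))).
  by have d3 := dth s; have d4 := dKa s; dereq; ring.
have := der_eq_cst d1 d2 0 P.
have -> : t P = t 0 by rewrite /t /tau VP WP XP.
rewrite XP thP.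
have KP := der_per_shift dK (kk_per F) a.
by rewrite -KP addr0; lra.
Qed.

(** Inverse of the first coordinate on the arc from [p] to [q], where [e] is the end of the arc at
    the leftmost point. Beyond [X 0] and [X b] the sections of the two arcs are constant and name
    the same point of the curve. *)
Let section_of (sg : R -> R) (p q e : R) : Prop := [/\ continuous sg,
  (forall s, p <= s <= q -> sg (X s) = s),
  (forall u, u <= X 0 -> sg u = e) /\ (forall u, X b <= u -> sg u = b),
  (forall u, X 0 <= u <= X b -> p <= sg u <= q /\ X (sg u) = u) &
  (forall u : R, X 0 < u < X b -> is_derive u 1 sg (X' (sg u))^-1)].

Let arcs : exists s1 s2 : R -> R, section_of s1 0 b 0 /\ section_of s2 b P P.
Proof.
have /andP[b0 b1] := bP.
have [s1 h1] := arc_inverse b0 dX X'up.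
have dR (s : R) : is_derive s 1 (fun s => X (P - s)) (- X' (P - s)).
  have sh1 : is_derive s 1 (fun s => P - s) (- 1 : R) by dereq; ring.
  by apply: der_eq (@der_comp R X (fun s => P - s) s _ _ (dX (P - s)) sh1) _; rewrite mulrN1.
have [||r [rc r1 [r2 r3] r4 r5]] := @arc_inverse R (fun s => X (P - s)) (fun s => - X' (P - s)) 0 (P - b) _ dR.
- by rewrite subr_gt0.
- by move=> s sb; rewrite oppr_gt0; apply: X'dn; lra.
have e0 : X (P - 0) = X 0 by rewrite subr0.
have e1 : X (P - (P - b)) = X b by congr X; ring.
rewrite e0 e1 in r2 r3 r4 r5.
exists s1, (fun u => P - r u); split => //; split.
- by cont.
- by move=> s sb; have := r1 (P - s); rewrite (_ : P - (P - s) = s); [move=> ->; lra|ring].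
- by split => u hu; [rewrite r2// subr0|rewrite r3//; ring].
- by move=> u hu; have [h2 h3] := r4 u hu; split => //; lra.
- move=> u hu; have d := r5 u hu; dereq.
  by rewrite sub0r invrN opprK.
Qed.

Section Region.
Variables s1 s2 : R -> R.
Hypotheses (A1 : section_of s1 0 b 0) (A2 : section_of s2 b P P).
Let c1 : continuous s1. Proof. by case: A1. Qed.
Let c2 : continuous s2. Proof. by case: A2. Qed.
Let i1 u : X 0 <= u <= X b -> 0 <= s1 u <= b /\ X (s1 u) = u.
Proof. by case: A1 => _ _ _ + _; apply. Qed.
Let i2 u : X 0 <= u <= X b -> b <= s2 u <= P /\ X (s2 u) = u.
Proof. by case: A2 => _ _ _ + _; apply. Qed.
Let lo u : u <= X 0 -> s1 u = 0 /\ s2 u = P.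
Proof. by case: A1 A2 => _ _ [l1 _] _ _ [_ _ [l2 _] _ _] h; rewrite l1// l2. Qed.
Let hi u : X b <= u -> s1 u = b /\ s2 u = b.
Proof. by case: A1 A2 => _ _ [_ l1] _ _ [_ _ [_ l2] _ _] h; rewrite l1// l2. Qed.

Let between (p q v : R) : p <= q -> ((v - p) * (v - q) < 0) = (p < v < q).
Proof.
move=> pq; apply/idP/idP => [|h]; last by rewrite pmulr_rlt0; lra.
by apply: contraTT; rewrite negb_and -!leNgt => /orP[h|h]; [rewrite -mulrNN|]; rewrite mulr_ge0//; lra.
Qed.

(** Negative exactly when [z.2] lies strictly between the two arcs, whichever of them is the upper
    one; left and right of the curve it is a square, so [E] has no points there. *)
Let gap (z : R * R) := (z.2 - V (s1 z.1)) * (z.2 - V (s2 z.1)).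
Let E := [set z | gap z < 0].

Let Vc1 : continuous (fun u => V (s1 u)).
Proof. by have Vc := der_contT dV; cont. Qed.

Let Vc2 : continuous (fun u => V (s2 u)).
Proof. by have Vc := der_contT dV; cont. Qed.

Let gap_cont : continuous gap.
Proof.
move=> z; apply: contM; (apply: contD; first exact: cont_snd); apply: contN.
  by apply: (cont_comp (f := fun u => V (s1 u))); [exact: cont_fst|exact: Vc1].
by apply: (cont_comp (f := fun u => V (s2 u))); [exact: cont_fst|exact: Vc2].
Qed.

Let openE : open E.
Proof.
rewrite (_ : E = gap @^-1` [set x | x < 0])//; apply: open_comp; last exact: open_lt.
by move=> z _; exact: gap_cont.
Qed.

Let E_itv z : E z -> X 0 < z.1 < X b.
Proof.
rewrite /E/=; have [h|h] := leP z.1 (X 0).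
  by rewrite /gap; have [-> ->] := lo h; rewrite VP -expr2 ltNge sqr_ge0.
have [h'|h'] := leP (X b) z.1; last by [].
by rewrite /gap; have [-> ->] := hi h'; rewrite -expr2 ltNge sqr_ge0.
Qed.

Let image_arcs x : exists s, [/\ 0 <= s < P, g x = g (a + s) &
  V s = V (s1 (X s)) \/ V s = V (s2 (X s))].
Proof.
have [i /andP[h1 h2]] := per_red (x - a) P0; exists (x - a + i%:~R * P).
split; first by rewrite h1.
  have -> : a + (x - a + i%:~R * P) = x + i%:~R * P by ring.
  by rewrite (per_int (cu_per F)).
set s := (x - a + _) in h1 h2 *; have [sb|sb] := leP s b.
  by left; case: A1 => _ -> //; rewrite h1.
by right; case: A2 => _ -> //; rewrite !ltW.
Qed.

Let E_image z : E z -> ~ curve_image2 g z.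
Proof.
move=> Ez [x zx]; have [s [sP e h]] := image_arcs x; move: Ez; rewrite /E/= /gap.
have -> : z.1 = X s by rewrite zx e.
have -> : z.2 = V s by rewrite zx e.
by case: h => <-; rewrite subrr ?mul0r ?mulr0 ltxx.
Qed.

Let boundedE : bounded2 E.
Proof.
have Vab : continuous (fun s => `|V s|).
  by move=> s; apply: (cont_comp (f := Num.norm) (u := V)); [exact: der_cont (dV s)|exact: norm_continuous].
have [|c _ cm] := per_max P0 Vab.
  by move=> s; rewrite /V addrA cu_per.
exists (`|X 0| + `|X b| + `|V c|) => z Ez; have /andP[h1 h2] := E_itv Ez.
have n1 := normr_ge0 (X 0); have n2 := normr_ge0 (X b); have n3 := normr_ge0 (V c).
split.
  have := ler_norm (X b); have := ler_norm (- X 0); rewrite normrN => k1 k2.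
  by rewrite ler_norml; apply/andP; split; lra.
have m1 := cm (s1 z.1); have m2 := cm (s2 z.1).
rewrite ler_norml in m1; rewrite ler_norml in m2.
suff : - `|V c| <= z.2 <= `|V c| by rewrite ler_norml => /andP[? ?]; apply/andP; split; lra.
move: Ez m1 m2; rewrite /E/= /gap.
by case: (leP (V (s1 z.1)) (V (s2 z.1))) => [h|/ltW h]; [|rewrite mulrC]; rewrite between//; lra.
Qed.

Let closedE : closed [set z : R * R | X 0 <= z.1 <= X b /\ gap z <= 0].
Proof.
have -> : [set z : R * R | X 0 <= z.1 <= X b /\ gap z <= 0] =
   (fst @^-1` `[X 0, X b]%classic) `&` (gap @^-1` [set x | x <= 0]).
  by apply/seteqP; split => z; rewrite /= in_itv.
apply: closedI; apply: closed_comp.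
- by move=> z _; exact: cont_fst.
- exact: interval_closed.
- by move=> z _; exact: gap_cont.
- exact: closed_le.
Qed.

(* E is relatively open and closed in the complement of the curve. *)
Let E_enclosed : E `<=` enclosed_region g.
Proof.
move=> z Ez; have nz := E_image Ez; split => //.
set C := connected_component _ z.
(* In the complement of the curve, [E] is also the trace of the closed set of [closedE]: where [gap]
   vanishes the point lies on one of the arcs. The component then lies in the bounded set [E]. *)
have CE : C `&` E = C.
  have cc : connected C by exact: component_connected.
  apply: cc.
  - by exists z; split => //; exact: connected_component_refl.
  - by exists E.
  - exists [set z : R * R | X 0 <= z.1 <= X b /\ gap z <= 0]; first exact: closedE.
    apply/seteqP; split => w [Cw].
      move=> Ew; split => //; have /andP[h1 h2] := E_itv Ew.
      by split; [rewrite !ltW|exact: ltW].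
    move=> [wi wg]; split => //; rewrite /E/= lt_neqAle wg andbT.
    apply/eqP => ge; have nw : ~ curve_image2 g w.
      exact: (@connected_component_sub _ (~` curve_image2 g) z).
    have /eqP := ge; rewrite /gap mulf_eq0 !subr_eq0 => /orP[/eqP e|/eqP e]; apply: nw.
      have [_ h] := i1 wi; exists (a + s1 w.1).
      by rewrite -/(X (s1 w.1)) -/(V (s1 w.1)) h -e; case: (w).
    have [_ h] := i2 wi; exists (a + s2 w.1).
    by rewrite -/(X (s2 w.1)) -/(V (s2 w.1)) h -e; case: (w).
have [B hB] := boundedE; exists B => w Cw; apply: hB.
by move: Cw; rewrite -CE => -[].
Qed.

Let h u := eps F * (tau (s2 u) - tau (s1 u)).

Let hc : continuous h.
Proof.
by have tc := der_contT dtau; rewrite /h; cont.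
Qed.

Let X0b : X 0 < X b.
Proof.
by have /andP[b0 _] := bP; apply: (der_lt dX X'up).
Qed.

(** [h] is the derivative of the difference of a primitive of [tau * X'] along the two sections.
    These agree at [X b] and are [0] and [P] at [X 0], so the result is the integral around the
    closed curve, known from [tauX_closed]. *)
Let int_h (K : R -> R) : (forall x : R, is_derive x 1 K (k x)) ->
  (\int[mu]_(u in `]X 0, X b[) (h u)%:E = (K P - K 0 - 2 * pi)%:E)%E.
Proof.
move=> dK.
have tXc : continuous (fun s => tau s * X' s).
  move=> s; apply: contM; first exact: der_cont (dtau s).
  have [d _ _] := der_pt_shift (der_tg F (a + s)); exact: der_cont d.
have [I dI] := primitive tXc.
pose H u := eps F * (I (s2 u) - I (s1 u)).
have Ic : continuous I := der_contT dI.
have Hc : continuous H by rewrite /H; cont.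
have dH (u : R) : X 0 < u < X b -> is_derive u 1 H (h u).
  move=> ub; have /andP[u1 u2] := ub.
  have ub' : X 0 <= u <= X b by rewrite !ltW.
  have [/andP[p1 p2] e1] := i1 ub'; have [/andP[p3 p4] e2] := i2 ub'.
  have q1 : 0 < X' (s1 u).
    apply: X'up; rewrite !lt_neqAle p1 p2 !andbT; apply/andP; split.
      by apply: contraTneq u1 => e; rewrite -e1 -e ltxx.
    by apply: contraTneq u2 => e; rewrite -e1 e ltxx.
  have q2 : X' (s2 u) < 0.
    apply: X'dn; rewrite !lt_neqAle p3 p4 !andbT; apply/andP; split.
      by apply: contraTneq u2 => e; rewrite -e2 -e ltxx.
    by apply: contraTneq u1 => e; rewrite -e2 e XP ltxx.
  have [_ _ _ _ d1] := A1; have [_ _ _ _ d2] := A2.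
  have k1 := der_comp (dI (s1 u)) (d1 u ub); have k2 := der_comp (dI (s2 u)) (d2 u ub).
  apply: der_eq (derM (der_cst (eps F) u) (derD k2 (derN k1))) _.
  by rewrite /h; field; rewrite gt_eqF// lt_eqF.
have FT : (\int[mu]_(u in `[X 0, X b]) (h u)%:E = (H (X b))%:E - (H (X 0))%:E)%E.
  apply: continuous_FTC2 => //.
  - exact: cont_within.
  - split.
    + by move=> u; rewrite in_itv/= => /dH[].
    + by apply: cvg_at_right_filter; exact: Hc.
    + by apply: cvg_at_left_filter; exact: Hc.
  - by move=> u; rewrite in_itv/= => /dH d; rewrite derive1E; case: d.
have := FT; rewrite integral_itv_bndoo; last first.
  by apply/measurable_EFinP; apply: measurable_funTS; exact: continuous_measurable_fun.
move=> ->; rewrite -EFinB; congr EFin.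
have [a1 a2] := lo (lexx _); have [b1 b2] := hi (lexx _).
by rewrite /H a1 a2 b1 b2 !subrr mulr0 sub0r (tauX_closed dI dK) mulrA eps2; ring.
Qed.

Let slice (u c d : R) : c < d ->
  (\int[mu]_(v in `]c, d[) ((Num.sqrt (1 + u ^+ 2 + v ^+ 2))^-1)%:E =
   (ln (d + Num.sqrt (1 + u ^+ 2 + d ^+ 2)) - ln (c + Num.sqrt (1 + u ^+ 2 + c ^+ 2)))%:E)%E.
Proof.
move=> cd.
have p (v : R) : 0 < 1 + u ^+ 2 + v ^+ 2.
  by have := sqr_ge0 u; have := sqr_ge0 v; lra.
have sp (v : R) : 0 < Num.sqrt (1 + u ^+ 2 + v ^+ 2) by rewrite sqrtr_gt0.
have dq (v : R) : is_derive v 1 (fun v => 1 + u ^+ 2 + v ^+ 2) (2 * v) by dereq; ring.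
have ds (v : R) : is_derive v 1 (fun v => Num.sqrt (1 + u ^+ 2 + v ^+ 2)) (v / Num.sqrt (1 + u ^+ 2 + v ^+ 2)).
  apply: der_eq (@der_sqrt R (fun v => 1 + u ^+ 2 + v ^+ 2) v _ (p v) (dq v)) _.
  by field; rewrite gt_eqF.
have pp (v : R) : 0 < v + Num.sqrt (1 + u ^+ 2 + v ^+ 2).
  have s2' : Num.sqrt (1 + u ^+ 2 + v ^+ 2) ^+ 2 = 1 + u ^+ 2 + v ^+ 2 by rewrite sqr_sqrtr// ltW.
  by rewrite ltNge; apply/negP => h4; have := sp v; have := sqr_ge0 u; nra.
apply: (@FTC_der R (fun v => (Num.sqrt (1 + u ^+ 2 + v ^+ 2))^-1)
  (fun v => ln (v + Num.sqrt (1 + u ^+ 2 + v ^+ 2))) c d false true cd).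
  by cont; rewrite gt_eqF.
move=> v; apply: der_eq (@der_ln R (fun v => v + Num.sqrt (1 + u ^+ 2 + v ^+ 2)) v _ (pp v) (derD (der_id v) (ds v))) _.
by field; rewrite !gt_eqF.
Qed.

Let sqrt_arc u s : X s = u -> Num.sqrt (1 + u ^+ 2 + V s ^+ 2) = W s.
Proof. by move=> <-; exact: Wsqrt. Qed.

Let slice_h u : X 0 < u < X b ->
  (\int[mu]_(v in [set v | (gap (u, v) < 0)%R]) ((Num.sqrt (1 + u ^+ 2 + v ^+ 2))^-1)%:E = (`|h u|)%:E)%E.
Proof.
move=> ub; have ub' : X 0 <= u <= X b by move: ub => /andP[? ?]; rewrite !ltW.
have [_ e1] := i1 ub'; have [_ e2] := i2 ub'.
have eps1 : `|eps F| = 1.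
  by have := eps2 F; rewrite -expr2 => /(congr1 Num.sqrt); rewrite sqrtr_sqr sqrtr1.
have key (s s' : R) : X s = u -> X s' = u -> V s <= V s' ->
   [set v | (v - V s) * (v - V s') < 0] = `]V s, V s'[%classic /\ 
   (\int[mu]_(v in `]V s, V s'[) ((Num.sqrt (1 + u ^+ 2 + v ^+ 2))^-1)%:E = (`|tau s' - tau s|)%:E)%E.
  move=> es es' le; split.
    by apply/seteqP; split => v; rewrite /= in_itv/= between.
  move: le; rewrite le_eqVlt => /predU1P[e|lt].
    rewrite e set_itv_ge ?bnd_simp ?ltxx// integral_set0.
    have -> : tau s = tau s'.
      by rewrite /tau -!(sqrt_arc es) -(sqrt_arc es') e.
    by rewrite subrr normr0.
  have := slice u lt; rewrite (sqrt_arc es) (sqrt_arc es') -/(tau s) -/(tau s') => I.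
  have : (0%:E <= (tau s' - tau s)%:E)%E.
    by rewrite -I; apply: integral_ge0 => v _; rewrite lee_fin invr_ge0 sqrtr_ge0.
  by rewrite lee_fin I => /ger0_norm ->.
rewrite /h normrM eps1 mul1r /gap/=.
have [le|lt] := leP (V (s1 u)) (V (s2 u)).
  by have [-> ->] := key _ _ e1 e2 le.
have [h1 h2] := key _ _ e2 e1 (ltW lt).
rewrite (_ : [set v | _] = `]V (s2 u), V (s1 u)[%classic).
  by rewrite h2 distrC.
by rewrite -h1; apply/seteqP; split => v /=; rewrite mulrC.
Qed.

(** The area of [E] is the integral of the slices [|h|], bounded below by that of [h]; this settles
    the orientation of the arcs without a case distinction, and [E] lies in the enclosed region. *)
Lemma area_ge_arcs (K : R -> R) : (forall x : R, is_derive x 1 K (k x)) ->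
  ((K P - K 0 - 2 * pi)%:E <= harea (enclosed_region g))%E.
Proof.
move=> dK.
pose f (z : R * R) := (Num.sqrt (1 + z.1 ^+ 2 + z.2 ^+ 2))^-1.
have f0 z : 0 <= f z by rewrite invr_ge0 sqrtr_ge0.
have p (z : R * R) : 0 < 1 + z.1 ^+ 2 + z.2 ^+ 2.
  by have := sqr_ge0 z.1; have := sqr_ge0 z.2; lra.
have fc : continuous f.
  by rewrite /f; cont; rewrite gt_eqF// sqrtr_gt0.
have mE : measurable E by apply: open_measurable2; exact: openE.
apply: (@le_trans _ _ (harea E)); last first.
  apply: integral_mono_set; last exact: E_enclosed.
  by move=> z _; rewrite lee_fin; exact: f0.
pose fE : R * R -> \bar R := (fun z : R * R => (f z)%:E) \_ E.
have mf : measurable_fun setT fE.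
  apply/(measurable_restrictT _ mE)/measurable_EFinP.
  by apply: continuous_measurable2; [exact: openE|move=> z _; exact: fc].
have fE0 z : (0 <= fE z)%E.
  by rewrite /fE patchE; case: ifPn => // _; rewrite lee_fin.
rewrite /harea integral_mkcond -/fE.
rewrite (@fubini_tonelli1 _ _ _ _ R (@lebesgue_measure R) (@lebesgue_measure R) fE mf fE0).
apply: (@le_trans _ _ (\int[mu]_(u in `]X 0, X b[) fubini_F mu fE u)%E); last first.
  apply: integral_mono_set => // u _; apply: integral_ge0 => v _; exact: fE0.
have -> : (\int[mu]_(u in `]X 0, X b[) fubini_F mu fE u = \int[mu]_(u in `]X 0, X b[) (`|h u|)%:E)%E.
  apply: eq_integral => u /set_mem/=; rewrite in_itv/= => ub.
  rewrite -slice_h// /fubini_F [RHS]integral_mkcond; apply: eq_integral => v _.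
  by rewrite /fE !patchE !mem_setE.
rewrite -(int_h dK).
have intg (q : R -> R) : continuous q -> mu.-integrable `]X 0, X b[ (EFin \o q).
  move=> qc; apply: (@integrableS _ _ _ mu `[X 0, X b]%classic) => //.
    by apply: subset_itv; rewrite bnd_simp.
  by apply: continuous_compact_integrable; [exact: segment_compact|exact: cont_within].
apply: le_integral.
- exact: measurable_itv.
- exact: intg.
- apply: intg => u; apply: (cont_comp (f := Num.norm) (u := h)); [exact: hc|exact: norm_continuous].
- by move=> u _; rewrite lee_fin ler_norm.
Qed.

End Region.

Lemma area_ge (K : R -> R) : (forall x : R, is_derive x 1 K (k x)) ->
  ((K P - K 0 - 2 * pi)%:E <= harea (enclosed_region g))%E.
Proof.
by move=> dK; have [s1 [s2 [h1 h2]]] := arcs; exact: (area_ge_arcs h1 h2).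
Qed.

End EnclosedArea.

Lemma area_lower_bound (R : realType) (P : R) (F : frenet P) (K : R -> R) :
  (forall x : R, is_derive x 1 K (kk F x)) ->
  ((K P - K 0 - 2 * pi)%:E <= harea (enclosed_region (cu F)))%E.
Proof.
have [a [b [th [bP up dn dth thP]]]] := abscissa_two_arcs F.
exact: (area_ge bP up dn dth thP).
Qed.

(** * Measure of the complement of the m-orbits *)

Section Conclusion.
Variables (R : realType) (P : R) (F : frenet P).
Local Notation g := (cu F).
Local Notation k := (kk F).
Let P0 : 0 < P := P_gt0 F.
Let mu2 := (@lebesgue_measure R \x @lebesgue_measure R)%E.

Lemma bmuE (c : R) : 0 <= c ->
  (\int[mu2]_(z in phase_space P) (c * sin z.2)%:E = (2 * c * P)%:E)%E.
Proof. by move=> c0; rewrite -(phase_intE (admissible_cst P c0)) phase_int_cst. Qed.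

Lemma bmu_phase_space : bmu (phase_space P) = (2 * P)%:E.
Proof.
rewrite -[in RHS](mulr1 2) -(bmuE ler01); apply: eq_integral => z _.
by rewrite mul1r.
Qed.

Let sin_phase (z : R * R) : phase_space P z -> 0 <= sin z.2.
Proof. by move=> [_ zp]; apply/ltW/sin_gt0_pi. Qed.

Lemma bmu_mono (D1 D2 : set (R * R)) : D1 `<=` D2 -> D2 `<=` phase_space P ->
  (bmu D1 <= bmu D2)%E.
Proof.
move=> D12 D2P; apply: integral_mono_set => // z /D2P/sin_phase.
by rewrite lee_fin.
Qed.

Lemma fine_bmu (D : set (R * R)) : D `<=` phase_space P ->
  exists2 m, bmu D = m%:E & 0 <= m.
Proof.
move=> DP; have le := bmu_mono DP (@subset_refl _ _); rewrite bmu_phase_space in le.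
have ge : (0 <= bmu D)%E.
  by apply: integral_ge0 => z /DP/sin_phase; rewrite lee_fin.
exists (fine (bmu D)); last exact: fine_ge0.
by rewrite fineK// ge0_fin_numE//; apply: le_lt_trans le _; rewrite ltry.
Qed.

(* Chebyshev-type bound; D need not be measurable, since the superlevel set of
   H is measurable and contained in D. *)
Lemma phase_int_excess H (c M m : R) (D : set (R * R)) :
  admissible P H -> 0 <= c -> 0 <= M ->
  (forall x phi, 0 < phi < pi -> H x phi <= c + M) ->
  D `<=` phase_space P ->
  (forall z, phase_space P z -> ~ D z -> H z.1 z.2 <= c) ->
  bmu D = m%:E ->
  (phase_int P H <= (2 * c * P + M * m)%:E)%E.
Proof.
move=> adH c0 M0 HM DP HD mD; rewrite (phase_intE adH).
have [_ _ H0] := adH.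
have mP := @measurable_phase R P.
have mH := measurable_admissible adH.
pose U := phase_space P `&`
  (fun z : R * R => H z.1 z.2 * sin z.2 - c * sin z.2) @^-1` `]0, +oo[%classic.
have mc := measurable_admissible (admissible_cst P c0).
have mM := measurable_admissible (admissible_cst P M0).
have mU : measurable U.
  have md : measurable_fun (phase_space P) (fun z : R * R => H z.1 z.2 * sin z.2 - c * sin z.2).
    exact: measurable_funB.
  by apply: md => //; exact: measurable_itv.
have UD : U `<=` D.
  move=> z [zP]; rewrite /= in_itv/= andbT => h; apply: contrapT => nD.
  have : (H z.1 z.2 - c) * sin z.2 <= 0.
    by apply: mulr_le0_ge0; [rewrite subr_le0; exact: HD|exact: sin_phase].
  by rewrite mulrBl leNgt h.
have sU : (bmu U <= m%:E)%E by rewrite -mD; apply: bmu_mono.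
pose f2 : R * R -> \bar R := (fun z : R * R => (M * sin z.2)%:E) \_ U.
have f20 z : (0 <= f2 z)%E.
  rewrite /f2 patchE; case: ifPn => // /set_mem[zP _].
  by rewrite lee_fin mulr_ge0// sin_phase.
have mf2 : measurable_fun (phase_space P) f2.
  apply: (proj1 (measurable_restrict _ mU mP)); apply/measurable_EFinP.
  by apply: measurable_funS mM; [exact: mP|move=> z []].
apply: (@le_trans _ _ (\int[mu2]_(z in phase_space P) ((c * sin z.2)%:E + f2 z))%E).
  apply: ge0_le_integral => //.
  - by move=> z zP; rewrite lee_fin mulr_ge0 ?sin_phase//; apply: H0; case: zP.
  - exact/measurable_EFinP.
  - by apply: emeasurable_funD => //; exact/measurable_EFinP.
  - move=> z zP; have s0 := sin_phase zP; rewrite /f2 patchE; case: ifPn => h.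
      rewrite -EFinD lee_fin -mulrDl ler_wpM2r//; apply: HM; by case: zP.
    rewrite adde0 lee_fin -subr_le0 leNgt; apply/negP => h'; move/negP: h; apply.
    by apply/mem_set; split => //=; rewrite in_itv/= h'.
rewrite ge0_integralD//.
- rewrite bmuE// EFinD leeD2l// /f2 -integral_mkcondr.
  have -> : phase_space P `&` U = U by rewrite /U setIA setIid.
  under eq_integral do rewrite EFinM.
  rewrite ge0_integralZl_EFin//.
  + by rewrite EFinM; apply: lee_wpmul2l; rewrite ?lee_fin.
  + by move=> z [zP _]; rewrite lee_fin sin_phase.
  + apply/measurable_EFinP; apply: measurable_funTS.
    by apply: measurableT_comp; [exact: continuous_measurable_fun (@continuous_sin R)|exact: measurable_snd].
- by move=> z zP; rewrite lee_fin mulr_ge0 ?sin_phase.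
- exact/measurable_EFinP.
Qed.

Lemma orbit_sum_le H (c : R) N : (forall x phi, 0 < phi < pi -> H x phi <= c) ->
  forall x phi, 0 < phi < pi -> orbit_sum F H N x phi <= N%:R * c.
Proof.
move=> Hc x phi pp.
have it j : forall x phi, 0 < phi < pi -> iter j (billiard_pull F) H x phi <= c.
  elim: j => [//|j IH] y psi pq; rewrite iterS.
  have [h _] := hitP F y pq; have hh := Phi_itv (apartC (apart_itv (F := F) h)).
  rewrite {1}/billiard_pull /swap_phase /mirror_phase.
  by apply: IH; move: hh; lra.
have -> : N%:R * c = \sum_(j < N) c by rewrite sumr_const card_ord mulr_natl.
by apply: ler_sum => j _; exact: it.
Qed.

Variables (km : R).
Hypotheses (km1 : 1 < km) (kmk : forall x, km <= k x).

Lemma non_m_measure (K Q : R -> R) (m : R) :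
  (forall x : R, is_derive x 1 K (k x)) ->
  (forall x : R, is_derive x 1 Q (Num.sqrt (k x ^+ 2 - 1))) ->
  bmu (phase_space P `\` m_set g P) = m%:E ->
  2 * pi * (2 * pi - (Q P - Q 0)) <= 2 * artanh km^-1 * m.
Proof.
move=> dK dQ mE.
have [C C0 hC] := chord_len_bound F.
set B := 2 * artanh km^-1.
have B0 : 0 <= B.
  rewrite /B mulr_ge0//; apply: artanh_ge0.
  by have kmp := km1; rewrite invr_ge0 invf_lt1; lra.
have m0 : 0 <= m.
  have [//|m' e m'0] := @fine_bmu (phase_space P `\` m_set g P).
  by move: e; rewrite mE => -[->].
(* [C] bounds all chord lengths, so adding it makes [H] nonnegative. *)
pose H x phi := curv_term F x phi - chord_len F x (hit F x phi) + C.
have [c1 c2 c3] := admissible_curv_term F.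
have [l1 l2 l3] := admissible_chord_len F.
have adH : admissible P H.
  split => x phi pp.
  - by rewrite /H c1// l1.
  - apply: contD; last exact: cont_cst.
    by apply: contD; [exact: c2|apply: contN; exact: l2].
  - have := hC _ _ (@apart_hit R P F x phi pp); have := c3 x phi pp.
    by rewrite /H; lra.
have HB x phi : 0 < phi < pi -> H x phi <= B + C.
  move=> pp; have /andP[_ h] := curv_term_bounds x km1 kmk pp.
  by have := l3 x phi pp; rewrite /H /B; lra.
(* The total curvature [K P - K 0] occurs in both integrals and cancels. *)
have JH : phase_int P H = (2 * pi * (2 * pi - (Q P - Q 0)) + 2 * C * P)%:E.
  have := phase_intD adH (admissible_chord_len F).
  have -> : (fun x phi => H x phi + chord_len F x (hit F x phi)) = (fun x phi => curv_term F x phi + C).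
    by apply/funext => x; apply/funext => phi; rewrite /H; ring.
  rewrite (phase_intD (admissible_curv_term F) (admissible_cst P C0)).
  rewrite (phase_int_curv_term dK dQ) (phase_int_cst F) (phase_int_chord_len dK).
  case: (phase_int P H) => [r||]//=; rewrite -!EFinD => -[e]; congr EFin; lra.
(* The orbit sum contributes [N] copies of [C] on the left and [N + 1] on the right. The single
   remaining copy does not depend on [N], so the bracket cannot be positive. *)
have key (N : nat) : N%:R * (2 * pi * (2 * pi - (Q P - Q 0)) - B * m) <= 2 * C * P.
  have adN := admissible_orbit_sum F N adH.
  have cN : 0 <= N.+1%:R * C by rewrite mulr_ge0.
  have MN : 0 <= N%:R * B by rewrite mulr_ge0.
  have := @phase_int_excess (orbit_sum F H N) (N.+1%:R * C) (N%:R * B) m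
     (phase_space P `\` m_set g P) adN cN MN _ _ _ mE.
  rewrite (phase_int_orbit_sum F N adH JH) lee_fin -natr1 => h.
  have u1 x phi : 0 < phi < pi -> orbit_sum F H N x phi <= (N%:R + 1) * C + N%:R * B.
    move=> pp; have o := @orbit_sum_le H (B + C) N HB x phi pp.
    by rewrite mulrDr in o; rewrite mulrDl mul1r; move: C0 o; clear; lra.
  have u2 z : phase_space P z -> ~ (phase_space P `\` m_set g P) z ->
      orbit_sum F H N z.1 z.2 <= (N%:R + 1) * C.
    move=> zP nz; rewrite natr1; apply: (m_set_orbit_sum N adH hC).
    by apply: contrapT => nm; apply: nz.
  have := h u1 (@subDsetl _ _ _) u2; clear; lra.
rewrite leNgt; apply/negP; rewrite -subr_gt0 => d0.
set d := _ - _ in d0 key.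
have cp : 0 <= 2 * C * P / d by rewrite divr_ge0 ?(ltW d0)// mulr_ge0 ?(ltW P0)// mulr_ge0.
have := archi_boundP cp; rewrite ltr_pdivrMr// ltNge => /negP; apply; exact: key.
Qed.

End Conclusion.

Theorem theorem1p1 (R : realType) (gam : R -> pt R) (P A km : R) :
  arclength_closed_curve gam P ->
  harea (enclosed_region gam) = A%:E ->
  (forall x, km <= gcurv gam x) ->
  (exists x, gcurv gam x = km) ->
  1 < km ->
  delta gam P >=
    pi / (2 * artanh (km^-1)) *
    ((P ^+ 2 - A ^+ 2 - 4 * pi * A) /
     (P * (2 * pi + Num.sqrt ((2 * pi + A) ^+ 2 - P ^+ 2)))).
Proof.
move=> gamP hA kmk _ km1.
have [F [Fg Ft Fk]] := frenet_of_curve gamP kmk km1.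
have kmF x : km <= kk F x by rewrite Fk.
have P0 := P_gt0 F; have pp0 := pi_gt0 R.
have [K dK] := primitive (@kk_cont R P F).
have Qc : continuous (fun x => Num.sqrt (kk F x ^+ 2 - 1)).
  by have kc := @kk_cont R P F; cont.
have [Q dQ] := primitive Qc.
have AA : K P - K 0 - 2 * pi <= A.
  by have := area_lower_bound dK; rewrite Fg hA lee_fin.
have IP := mean_curv_gt1 dK.
have QS := integral_sqrt_le dK dQ.
have [|m mE m0] := @fine_bmu R P F (phase_space P `\` m_set gam P); first by move=> z [].
have := non_m_measure km1 kmF dK dQ (m := m); rewrite Fg => /(_ mE) main.
rewrite /delta mE (bmu_phase_space F)/=.
set S := Num.sqrt ((2 * pi + A) ^+ 2 - P ^+ 2).
set I := K P - K 0 in AA IP QS.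
have IA : I <= 2 * pi + A by lra.
have SS : Num.sqrt (I ^+ 2 - P ^+ 2) <= S.
  by apply: ler_wsqrtr; rewrite lerD2r ler_pXn2r ?nnegrE//; lra.
have S2 : S ^+ 2 = (2 * pi + A) ^+ 2 - P ^+ 2.
  have PA : P <= 2 * pi + A by lra.
  by rewrite sqr_sqrtr// subr_ge0 ler_pXn2r ?nnegrE// ?(ltW P0)// (le_trans (ltW P0)).
have S0 : 0 <= S by exact: sqrtr_ge0.
have a0 : 0 < artanh km^-1.
  have i0 : 0 < km^-1 by rewrite invr_gt0; lra.
  have i1 : km^-1 < 1 by rewrite invf_lt1; lra.
  by rewrite /artanh mulr_gt0 ?invr_gt0// ln_gt0// ltr_pdivlMr; lra.
have -> : P ^+ 2 - A ^+ 2 - 4 * pi * A = (2 * pi - S) * (2 * pi + S).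
  have -> : (2 * pi - S) * (2 * pi + S) = 4 * pi ^+ 2 - S ^+ 2 by ring.
  by rewrite S2; ring.
have s0 : 2 * pi + S != 0 by rewrite gt_eqF//; lra.
have -> : pi / (2 * artanh km^-1) * ((2 * pi - S) * (2 * pi + S) / (P * (2 * pi + S))) =
  2 * pi * (2 * pi - S) / (2 * artanh km^-1) / (2 * P).
  by move: s0; set T := 2 * pi + S => T0; field; rewrite T0 !gt_eqF.
have p2 : 0 < 2 * P by rewrite mulr_gt0.
have a2 : 0 < 2 * artanh km^-1 by rewrite mulr_gt0.
rewrite (ler_pM2r (x := (2 * P)^-1)) ?invr_gt0// ler_pdivrMr// [m * _]mulrC.
by apply: le_trans main; rewrite ler_pM2l ?mulr_gt0//; lra.
Qed.
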